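(* Let $K$ be a field of characteristic zero, let $\phi(z)=\sum_{k\ge 0}\phi_k z^k\in K[[z]]$ with $\phi_0=1$, let $F(z)=\sum_{i\ge 0} f_i z^i\in K[[z]]$, and let $L_{bin},L_{div}:K[y]\to K[y]$ be the binomial and divided power 1-cocycle operators determined by $F$ (see context). For $L\in\{L_{bin},L_{div}\}$, extended to $K[y][[x]]$ coefficientwise in $x$, consider the functional equation $$G(x,y)=x\,L(\phi(G(x,y)))$$ for $G\in K[y][[x]]$ (with zero constant term in $x$). It is uniquely solved by $$G(x,y)=\sum_{C\in\mathcal C} f_C\,\phi_C\,x^{|C|}\,\frac{L_{bin}(y^{t_1(C)-1})}{(t_1(C)-1)!}\quad\text{if } L=L_{bin},$$ and by $$G(x,y)=\sum_{C\in\mathcal C_{top}} f_C\,\phi_C\,x^{|C|}\,L_{div}(y^{t_1(C)-1})\quad\text{if } L=L_{div},$$ where $\mathcal C$ is the set of (nonempty) connected chord diagrams, $\mathcal C_{top}\subseteq\mathcal C$ is the set of connected top-cycle-free chord diagrams, $\phi_C=\prod_{c\in C}\phi_{\mathrm{val}(c)}$, and, for a diagram $C$ with exactly $k$ terminal chords, $$f_C=f_0^{|C|-k}\,f_{t_2(C)-t_1(C)}\,f_{t_3(C)-t_2(C)}\cdots f_{t_k(C)-t_{k-1}(C)}.$$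
   Context: Operators: $L_{bin}(y^n)=\int_0^y F\left(\frac{d}{dt}\right)t^n\,dt=n!\sum_{i=1}^{n+1} f_{n+1-i}\frac{y^i}{i!}$ and $L_{div}(y^n)=yF\left(\frac{\delta}{\delta y}\right)y^n=\sum_{i=1}^{n+1} f_{n+1-i}y^i$, where $\frac{\delta}{\delta y}y^n=y^{n-1}$ for $n>0$ and $\frac{\delta}{\delta y}1=0$. (These are the forms of the Hochschild 1-cocycle operators of the binomial coalgebra $\Delta(y^n)=\sum_k\binom nk y^k\otimes y^{n-k}$ and the divided power coalgebra $\Delta(y^n)=\sum_k y^k\otimes y^{n-k}$ on $K[y]$.) Chord diagrams: a chord diagram (diagram) $C$ of size $|C|=n$ is a perfect matching of $\{1,\dots,2n\}$. Its chords are ordered pairs $(a,b)$ with $a<b$; $a$ is the source, $b$ the sink. The chord containing $1$ is the root. A subset $D\subseteq C$ is a subdiagram, viewed as a diagram by order-preserving relabelling of its endpoints. For chords $c_1=(a_1,b_1)$, $c_2=(a_2,b_2)$ with $a_1<a_2$: they cross if $a_2<b_1<b_2$, and then $c_2$ is a right neighbor of $c_1$ and $c_1$ is a left neighbor of $c_2$. The intersection graph has the chords as vertices and crossings as edges; $C$ is connected if this graph is connected, and connected components of a diagram are those of its intersection graph. A diagram is indecomposable if it is not the concatenation of two smaller nonempty diagrams; indecomposable components are the maximal nonempty indecomposable subdiagrams (into whose concatenation the diagram factors). The standard order on chords is the order of their sources. Intersection order on a connected diagram: starting with label 1, label the root with the next available label, remove it, and then label the resulting connected components recursively, one after another, in the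 standard order of their roots. Terminal chords: a chord is terminal if it has no right neighbors. $t_j(C)$ denotes the index (label) in the intersection order of the $j$th terminal chord of $C$ in that order. Top cycles: for $m\ge 3$, the top cycle diagram of size $m$ is $T_m=\{(2i-1,2i+2):1\le i\le m-1\}\cup\{(2,2m-1)\}$. A diagram is top-cycle-free if it has no subdiagram equal (after relabelling) to some $T_m$, $m\ge3$. Valency: $\mathrm{val}(c)=k+\ell$, where $k$ is the number of left neighbors of $c$ which do not cross any chord $c'>c$ (standard order), and $\ell$ is the number of indecomposable components immediately following the source of $c$ after the left neighbors of $c$ have been removed, i.e. in the diagram obtained by deleting all left neighbors of $c$, $\ell$ is the maximal number of consecutive intervals of endpoints, beginning directly after the source of $c$, each of which is the set of endpoints of an indecomposable subdiagram. *)

(* Defs.v *)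
From mathcomp Require Import all_boot all_order all_algebra.

Set Implicit Arguments.
Unset Strict Implicit.
Unset Printing Implicit Defensive.

Import GRing.Theory.

(** * Chord diagrams *)

Section ChordDiagrams.

Variable N : nat.

(* The pair (source, sink). Endpoints are numbered 0, ..., N - 1 instead of
   1, ..., N. *)
Definition chord : Type := 'I_N * 'I_N.

Implicit Types (c d e : chord) (C D E : {set chord}).

Definition source c : 'I_N := c.1.
Definition sink c : 'I_N := c.2.

(* Perfect matchings of the N points. This forces N = 2 #|C|. *)
Definition diagram C : bool :=
  [forall c in C, source c < sink c] &&
  [forall p : 'I_N, #|[set c in C | (source c == p) || (sink c == p)]| == 1].

(* Everything below is defined for arbitrary sets of chords, so that it applies
   to the subsets of a diagram without relabelling them: it only depends on the
   relative order of the endpoints. *)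

Definition endpoints D : {set 'I_N} :=
  [set p | [exists c in D, (source c == p) || (sink c == p)]].

(* In increasing order, as is [enum 'I_N]. *)
Definition endpoint_seq D : seq 'I_N := enum (endpoints D).

Definition standard_order D : seq chord :=
  sort (fun c d => source c <= source d) (enum D).

(* d is a right neighbor of c. *)
Definition right_neighbor c d : bool :=
  [&& source c < source d, source d < sink c & sink c < sink d].

(* d is a left neighbor of c. *)
Definition left_neighbor c d : bool := right_neighbor d c.

Definition cross c d : bool := right_neighbor c d || right_neighbor d c.

Definition intersection_graph D : rel chord :=
  fun c d => [&& c \in D, d \in D & cross c d].

Definition component D c : {set chord} :=
  [set d in D | connect (intersection_graph D) c d].

Definition connected D : bool :=
  [forall c in D, forall d in D, connect (intersection_graph D) c d].

Definition is_root D c : bool :=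
  (c \in D) && [forall d in D, source c <= source d].

(* In the standard order of their roots. *)
Definition components D : seq {set chord} :=
  [seq component D c | c <- standard_order D & is_root (component D c) c].

(* The first argument only bounds the depth of the recursion. *)
Fixpoint intersection_order_rec (fuel : nat) D : seq chord :=
  if fuel is fuel'.+1 then
    if standard_order D is r :: _ then
      r :: flatten [seq intersection_order_rec fuel' E | E <- components (D :\ r)]
    else [::]
  else [::].

Definition intersection_order D : seq chord := intersection_order_rec #|D| D.

Definition terminal D c : bool := [forall d in D, ~~ right_neighbor c d].

(* Labels start at 1, whereas [index] starts at 0. *)
Definition terminal_labels D : seq nat :=
  [seq (index c (intersection_order D)).+1
     | c <- intersection_order D & terminal D c].

Definition num_terminal D : nat := size (terminal_labels D).

(* Used for 1 <= j <= num_terminal D. *)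
Definition t (j : nat) D : nat := nth 0 (terminal_labels D) j.-1.

(* The order-preserving relabelling of the endpoints of D by 1, ..., 2 #|D|. *)
Definition relabel_point D (p : 'I_N) : nat := #|[set q in endpoints D | q <= p]|.

Definition relabel D : seq (nat * nat) :=
  [seq (relabel_point D (source c), relabel_point D (sink c)) | c <- enum D].

Definition top_cycle (m : nat) : seq (nat * nat) :=
  (2, 2 * m - 1) :: [seq (2 * i - 1, 2 * i + 2) | i <- iota 1 m.-1].

(* A subdiagram equal to T_m has m chords. *)
Definition top_cycle_free C : bool :=
  ~~ [exists D : {set chord},
        [&& D \subset C, 3 <= #|D| & perm_eq (relabel D) (top_cycle #|D|)]].

(* D is nonempty, and is not A followed by D :\: A for A and D :\: A nonempty. *)
Definition indecomposable D : bool :=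
  (D != set0) &&
  [forall A : {set chord},
     [&& A \subset D, A != set0 & A != D] ==>
     ~~ [forall p in endpoints A, forall q in endpoints (D :\: A), p < q]].

Definition endpoints_after D c : seq 'I_N :=
  filter (fun p : 'I_N => source c < p) (endpoint_seq D).

(* The l sets in Ds are indecomposable subdiagrams of D whose endpoints form
   consecutive intervals of endpoints of D, beginning directly after the source
   of c. *)
Definition follow_source D c (l : nat) (Ds : l.-tuple {set chord}) : bool :=
  all (fun E => (E \subset D) && indecomposable E) Ds &&
  prefix (flatten [seq endpoint_seq E | E <- Ds]) (endpoints_after D c).

Definition valency C c : nat :=
  #|[set d in C | left_neighbor c d &&
       [forall e in C, (source c < source e) ==> ~~ cross d e]]| +
  \max_(l < #|C|.+1
          | [exists Ds : l.-tuple {set chord},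
               follow_source [set d in C | ~~ left_neighbor c d] c Ds]) l.

Definition connected_diagram C : bool :=
  [&& diagram C, C != set0 & connected C].

Section Weights.

Local Open Scope ring_scope.

Variables (K : fieldType) (phi f : nat -> K).

Definition weight_phi C : K := \prod_(c in C) phi (valency C c).

Definition weight_f C : K :=
  f 0%N ^+ (#|C| - num_terminal C) *
  \prod_(2 <= j < (num_terminal C).+1) f (t j C - t j.-1 C)%N.

End Weights.

End ChordDiagrams.

(** * Formal power series *)

Local Open Scope ring_scope.

Section PowerSeries.

Variable R : nzRingType.

(* The series in R[[x]] with coefficients F 0, F 1, ... *)
Definition fps : Type := nat -> R.

Implicit Types F G : fps.

Definition fps_one : fps := fun n => (n == 0%N)%:R.

Definition fps_mul F G : fps := fun n => \sum_(i < n.+1) F i * G (n - i)%N.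

Definition fps_exp F (k : nat) : fps := iter k (fps_mul F) fps_one.

(* Multiplication by x. *)
Definition fps_mulx F : fps := fun n => if n is m.+1 then F m else 0.

End PowerSeries.

Arguments fps R%_type_scope : clear implicits.

(* phi(G) for phi in K[[z]] and G in K[y][[x]]. If G has zero constant term, then
   G ^ k does not contribute to the coefficient of x ^ n for k > n. *)
Definition fps_comp (K : fieldType) (phi : fps K) (G : fps {poly K}) :
    fps {poly K} :=
  fun n => \sum_(k < n.+1) phi k *: fps_exp G k n.

Definition fps_map (R S : nzRingType) (L : R -> S) (G : fps R) : fps S :=
  fun n => L (G n).

(* G = x L(phi(G)), with zero constant term. *)
Definition solution (K : fieldType) (L : {poly K} -> {poly K}) (phi : fps K)
    (G : fps {poly K}) : Prop :=
  G 0%N = 0 /\ G =1 fps_mulx (fps_map L (fps_comp phi G)).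

(** * The 1-cocycle operators *)

Section Operators.

Variable K : fieldType.

Implicit Types (p : {poly K}) (f : fps K).

(* f(D) p, for an operator D that lowers degrees. *)
Definition apply_series f (D : {poly K} -> {poly K}) p : {poly K} :=
  \sum_(i < size p) f i *: iter i D p.

(* The integral of p from 0 to y. *)
Definition integral p : {poly K} :=
  \sum_(i < size p) (p`_i / i.+1%:R) *: 'X^(i.+1).

(* Maps y ^ n.+1 to y ^ n, and 1 to 0. *)
Definition divided_deriv p : {poly K} := drop_poly 1 p.

Definition Lbin f p : {poly K} := integral (apply_series f (@deriv K) p).

Definition Ldiv f p : {poly K} := 'X * apply_series f divided_deriv p.

Lemma integral_wide n p : (size p <= n)%N ->
  integral p = \sum_(i < n) (p`_i / i.+1%:R) *: 'X^(i.+1).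
Proof.
move=> le_pn; rewrite /integral.
rewrite (big_ord_widen n (fun i : nat => (p`_i / i.+1%:R) *: 'X^(i.+1)) le_pn).
rewrite big_mkcond; apply: eq_bigr => i _; case: ltnP => // le_pi.
by rewrite nth_default // mul0r scale0r.
Qed.

Lemma integralXn n : integral 'X^n = n.+1%:R^-1 *: 'X^(n.+1).
Proof.
rewrite /integral size_polyXn big_ord_recr /= coefXn eqxx mul1r big1 ?add0r //.
by move=> i _; rewrite coefXn ltn_eqF // mul0r scale0r.
Qed.

Lemma integralZD a p q : integral (a *: p + q) = a *: integral p + integral q.
Proof.
pose n := maxn (size (a *: p + q)) (maxn (size p) (size q)).
rewrite !(@integral_wide n) ?leq_max ?leqnn ?orbT // scaler_sumr -big_split /=.
by apply: eq_bigr => i _; rewrite coefD coefZ mulrDl scalerDl scalerA mulrA.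
Qed.

Lemma integral0 : integral 0 = 0.
Proof. by rewrite /integral size_poly0 big_ord0. Qed.

Lemma integral_sum n (a : 'I_n -> K) (p : 'I_n -> {poly K}) :
  integral (\sum_(i < n) a i *: p i) = \sum_(i < n) a i *: integral (p i).
Proof.
elim/big_rec2: _ => [|i x y _ <-]; [exact: integral0 | exact: integralZD].
Qed.

Lemma LbinXn f n : [pchar K] =i pred0 ->
  Lbin f 'X^n = n`!%:R *: \sum_(1 <= i < n.+2) (f (n.+1 - i)%N / i`!%:R) *: 'X^i.
Proof.
move=> charK0; have nz k : (k > 0)%N -> k%:R != 0 :> K.
  by case: k => // k _; rewrite ((pcharf0P _).1 charK0).
rewrite /Lbin /apply_series size_polyXn integral_sum scaler_sumr big_add1 /= big_mkord.
rewrite (reindex_inj rev_ord_inj) /=; apply: eq_bigr => i _.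
rewrite -/(derivn _ _) derivnXn -scaler_nat !subSS; have le_in : (i <= n)%N := ltn_ord i.
rewrite subKn // -[_ *: 'X^i]addr0 integralZD integral0 addr0 integralXn !scalerA.
congr (_ *: _).
have -> : (n ^_ (n - i))%:R = n`!%:R / i`!%:R :> K.
  apply: (canRL (mulfK (nz _ (fact_gt0 i)))).
  by rewrite -natrM -[in i`!](subKn le_in) ffact_fact ?leq_subr.
rewrite factS natrM invfM -!mulrA [LHS]mulrCA; congr (_ * (_ * _)).
by rewrite mulrC.
Qed.

Lemma LdivXn f n : Ldiv f 'X^n = \sum_(1 <= i < n.+2) f (n.+1 - i)%N *: 'X^i.
Proof.
rewrite /Ldiv /apply_series size_polyXn mulr_sumr big_add1 /= big_mkord.
rewrite (reindex_inj rev_ord_inj) /=; apply: eq_bigr => i _.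
rewrite !subSS; have le_in : (i <= n)%N := ltn_ord i.
rewrite -scalerAr exprS; congr (_ *: ('X * _)).
have iterE k m : iter k divided_deriv 'X^(k + m) = 'X^m.
  elim: k m => [|k IHk] m //; rewrite addSnnS /= IHk.
  by rewrite /divided_deriv exprSr (drop_polyMXn_id 1 'X^m).
by rewrite -[in 'X^n](subnK le_in) iterE.
Qed.

End Operators.

(* Main.v *)
(* Let C be a connected diagram with root r and at least two chords. Let E be the
   component of the second chord in C minus r, and A the rest of C, which contains r.
   Then A and E are connected and all endpoints of A but the first lie in one
   inner gap of E, so that C is determined by (A, E, gap), and every such triple
   occurs. This insertion of A into E has t_1(C) = t_1(E) + 1 and
   f_C = f_(t_1(A) - 1) f_A f_E. It leaves all valencies unchanged, except that
   the last chord (by source) of E passing above the gap gains one. A chord of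
   valency v is the last one above exactly v + 1 gaps. Finally C is
   top-cycle-free iff A and E are and, for each chord of E above the gap, the
   gap is not to the right of all the gaps in which this chord is the last one.
   These admissible gaps belong to distinct chords.

   Hence, if each chord of valency v is weighted by the Taylor coefficient
   phi^(v)(z) / v! instead of phi_v, summing over the gaps of E amounts to d/dz:
   the diagrams with t_1 = J + 1 have generating series (P d/dz)^J (x phi(z)),
   where P is that of all diagrams C, weighted by f_(t_1(C) - 1) f_C. As
   exp(y P d/dz) is a ring morphism, it maps phi(z) to phi(exp(y P d/dz) z),
   which is phi(G) at z = 0: this is the equation for L_bin. For L_div one uses
   the difference quotient (a(z) - a(0)) / z instead of d/dz, and the geometric
   series instead of exp. *)

From HB Require Import structures.
Require Import Defs.
From mathcomp Require Import all_boot all_order all_algebra.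
From mathcomp Require Import zify ring.

Set Implicit Arguments.
Unset Strict Implicit.
Unset Printing Implicit Defensive.

(** * Matchings and connectedness *)

(** A subset of a diagram is not a diagram on the same points. The geometric part therefore works
    with sets of chords in one fixed range of points that satisfy [matching]: distinct chords share
    no endpoint, but points may stay free. The decomposition is recorded in the type [code], which
    does not mention the points at all. Once [coded] has linked a code to its endpoints and chords,
    labels, valencies, weights and top-cycle-freeness become recursive functions on codes, and sums
    over diagrams become sums over codes.

    The second summand of [valency] concerns what is left after a deletion, which is awkward to
    follow through an insertion. Hence the valency is first rewritten as the count of gaps
    [valence].

    All series are replaced by polynomials: [phi] is cut at a degree no smaller than any valency
    that occurs, and powers of x are cut at a bound [M]. Setting z = 0 in the weight of a code gives
    back its product of values of [phi]. Both equations then follow from one argument, with an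
    operator on K[z] and a normalization [N] as parameters: [N J] is J! for the derivative and 1 for
    the difference quotient. *)

Ltac is_arith T :=
  lazymatch T with
  | is_true (leq _ _) => idtac
  | is_true (andb _ _) => idtac
  | is_true (orb _ _) => idtac
  | is_true (negb ?b) => is_arith (is_true b)
  | is_true (@eq_op _ (_ : nat) _) => idtac
  | and ?A _ => is_arith A
  | or ?A _ => is_arith A
  | @eq nat _ _ => idtac
  | @eq bool (leq _ _) _ => idtac
  end.

Ltac order :=
  repeat match goal with H : ?T |- _ => first [is_arith T; fail 1 | clear H] end; lia.

Section Matchings.

Variable N : nat.
Implicit Types (c d e r x y : chord N) (C D E S : {set chord N}).

Definition matching C : Prop :=
  forall c d, c \in C -> d \in C ->
    source c < sink c /\
    (c != d -> [/\ source c != source d :> nat, source c != sink d :> nat,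
                  sink c != source d :> nat & sink c != sink d :> nat]).

Lemma matchingS C D : D \subset C -> matching C -> matching D.
Proof. by move=> /subsetP sDC mC c d /sDC cC /sDC dC; apply: mC. Qed.

Lemma chord_lt C c : matching C -> c \in C -> source c < sink c.
Proof. by move=> mC cC; case: (mC c c cC cC). Qed.

Lemma diagram_matching C : diagram C -> matching C.
Proof.
case/andP=> /forall_inP lt_C /forallP one_C c d cC dC; split; first exact: lt_C.
have same p : (source c == p) || (sink c == p) ->
    (source d == p) || (sink d == p) -> c = d.
  move=> cp dp; have /cards1P[a defa] := one_C p.
  have: c \in [set a] by rewrite -defa inE cC.
  have: d \in [set a] by rewrite -defa inE dC.
  by rewrite !inE => /eqP-> /eqP->.
move=> ne_cd; split; apply/negP => /eqP/val_inj eq_p; case/eqP: ne_cd;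
  [apply: (same (source c)) | apply: (same (source c))
  |apply: (same (sink c)) | apply: (same (sink c))]; rewrite ?eqxx ?eq_p ?eqxx ?orbT //.
Qed.

Lemma crossC c d : cross c d = cross d c.
Proof. exact: orbC. Qed.

Lemma graph_sym D : symmetric (intersection_graph D).
Proof. by move=> c d; rewrite /intersection_graph crossC andbCA. Qed.

Lemma connect_graph_sym D : connect_sym (intersection_graph D).
Proof. exact/sym_connect_sym/graph_sym. Qed.

Lemma connect_closed D c d (Q : chord N -> Prop) :
    connect (intersection_graph D) c d -> Q c ->
    (forall x y, x \in D -> y \in D -> cross x y -> Q x -> Q y) ->
  Q d.
Proof.
case/connectP=> p + -> Qc clQ; elim: p c Qc => [|y p IHp] c Qc //=.
by case/andP=> /and3P[cD yD cy]; apply: IHp; apply: clQ cy Qc.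
Qed.

Lemma connected_closed D c (Q : chord N -> Prop) :
    connected D -> c \in D -> Q c ->
    (forall x y, x \in D -> y \in D -> cross x y -> Q x -> Q y) ->
  forall d, d \in D -> Q d.
Proof.
move=> /forall_inP cnD cD Qc clQ d dD.
by apply: connect_closed Qc clQ; have /forall_inP := cnD c cD; apply.
Qed.

Lemma connectedI D c : c \in D ->
    (forall S, c \in S ->
       (forall x y, x \in D -> y \in D -> cross x y -> x \in S -> y \in S) ->
     D \subset S) ->
  connected D.
Proof.
move=> cD clD; have cD_ d : d \in D -> connect (intersection_graph D) c d.
  pose S := [set x | connect (intersection_graph D) c x].
  have /subsetP sDS: D \subset S.
    apply: clD => [|x y xD yD xy]; rewrite !inE ?connect0 // => cx.
    by apply: connect_trans cx _; apply/connect1/and3P.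
  by move/sDS; rewrite inE.
apply/forall_inP => x xD; apply/forall_inP => y yD.
by apply: connect_trans (cD_ y yD); rewrite connect_graph_sym cD_.
Qed.

Lemma component_sub D c : component D c \subset D.
Proof. by apply/subsetP => d; rewrite inE => /andP[]. Qed.

Lemma mem_component D c : c \in D -> c \in component D c.
Proof. by move=> cD; rewrite inE cD connect0. Qed.

Lemma component_closed D c x y :
  x \in component D c -> y \in D -> cross x y -> y \in component D c.
Proof.
rewrite !inE => /andP[xD cx] yD xy; rewrite yD /=.
by apply: connect_trans cx _; apply/connect1/and3P.
Qed.

Lemma component_connected D c : c \in D -> connected (component D c).
Proof.
move=> cD; apply: (connectedI (mem_component cD)) => S cS clS.
apply/subsetP => x; rewrite inE => /andP[xD].
move=> cx; suff [] : x \in S /\ x \in component D c by [].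
apply: (connect_closed (Q := fun z => z \in S /\ z \in component D c) cx).
  by split=> //; apply: mem_component.
move=> d y dD yD dy [dS dc].
by have yc := component_closed dc yD dy; split=> //; apply: clS dy dS.
Qed.

Lemma componentE D E c : E \subset D -> connected E -> c \in E ->
    (forall x y, x \in E -> y \in D -> cross x y -> y \in E) ->
  component D c = E.
Proof.
move=> sED cnE cE clE; apply/setP => x; apply/idP/idP.
  rewrite inE => /andP[xD cx].
  by apply: (connect_closed (Q := fun z => z \in E) cx cE) => y z _ zD yz yE; apply: clE yz.
apply: (connected_closed (Q := fun x => x \in component D c) cnE cE).
  exact/mem_component/(subsetP sED).
by move=> y z _ zE yz yc; apply: component_closed yc _ yz; apply: (subsetP sED).
Qed.

(** Half-open because a point q stands for the gap right after it: a chord passes above the gap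
    after its source, but not above the gap after its sink. *)
Definition covers x (q : nat) : bool := source x <= q < sink x.

(** If no chord passed above the gap after q, every chord would lie on one side of it, and no
    crossing could lead from the side of x to that of y. *)
Lemma connected_cover D x y (q : nat) : connected D -> x \in D -> y \in D ->
  source x <= q -> q < sink y -> exists2 e, e \in D & covers e q.
Proof.
move=> cnD xD yD xq qy; apply/exists_inP; apply: contraLR qy => /exists_inPn nq.
rewrite -leqNgt; apply: (connected_closed (Q := fun e => sink e <= q) cnD xD) => //.
  by have := nq x xD; rewrite /covers; order.
move=> d e dD eD; have := nq e eD.
by rewrite /covers /cross /right_neighbor; order.
Qed.

Lemma connected_overlap D x y : connected D -> x \in D -> y \in D -> x != y ->
  exists2 e, e \in D & cross x e.
Proof.
move=> cnD xD yD ne_xy; apply/exists_inP; apply: contra_neqT ne_xy => /exists_inPn nx.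
apply/esym; apply: (connected_closed (Q := fun e => e = x) cnD xD) => // d e _ eD + dx.
by rewrite dx => xe; case/negP: (nx e eD).
Qed.

Lemma is_root_mem D r : is_root D r -> r \in D.
Proof. by case/andP. Qed.

Lemma is_root_le D r x : is_root D r -> x \in D -> source r <= source x.
Proof. by case/andP=> _ /forall_inP le_r /le_r. Qed.

Lemma is_root_lt D r x :
  matching D -> is_root D r -> x \in D -> x != r -> source r < source x.
Proof.
move=> mD rD xD ne_xr; have := is_root_le rD xD.
by case: (mD x r xD (is_root_mem rD)) => _ /(_ ne_xr)[]; order.
Qed.

Lemma root_uniq D r s : matching D -> is_root D r -> is_root D s -> r = s.
Proof.
move=> mD rD sD; apply/eqP/negPn/negP => ne_rs.
have := is_root_lt mD sD (is_root_mem rD) ne_rs.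
by have := is_root_le rD (is_root_mem sD); order.
Qed.

Lemma root_exists D : D != set0 -> exists r, is_root D r.
Proof.
case/set0Pn=> c cD; case: (arg_minnP (fun d => source d : nat) cD) => r rD le_r.
by exists r; apply/andP; split=> //; apply/forall_inP.
Qed.

Lemma root_neighbor D r x :
    matching D -> connected D -> is_root D r -> x \in D -> x != r ->
  exists2 e, e \in D & right_neighbor r e.
Proof.
move=> mD cnD rD xD ne_xr.
have [|e eD re] := connected_overlap cnD (is_root_mem rD) xD; first by rewrite eq_sym.
by exists e => //; have := is_root_le rD eD; move: re; rewrite /cross /right_neighbor; order.
Qed.

(* Removing the root leaves an indecomposable set of chords. *)
Lemma root_cover D r x y (q : nat) :
    matching D -> connected D -> is_root D r ->
    x \in D -> x != r -> y \in D -> y != r -> source x <= q -> q < sink y ->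
  exists e, [/\ e \in D, e != r & covers e q].
Proof.
move=> mD cnD rD xD xr yD yr xq qy.
suff: [exists e in D, (e != r) && covers e q].
  by case/exists_inP=> e eD /andP[er eq]; exists e.
apply: contraLR qy => /exists_inPn nq; rewrite -leqNgt.
have out e : e \in D -> e != r -> sink e <= q \/ q < source e.
  by move=> eD er; have := nq e eD; rewrite er /covers; order.
have lt_r e : e \in D -> e != r -> source r < source e by apply: is_root_lt.
have [rq | rq] := leqP (sink r) q.
  apply: (connected_closed (Q := fun e => sink e <= q) cnD (is_root_mem rD)) => //.
  move=> d e dD eD de dq; have [->// | er] := eqVneq e r.
  by have := out e eD er; move: de; rewrite /cross /right_neighbor; order.
(* Here the root passes above the gap. It then encloses every other chord left of the gap without
   crossing it, so these chords form a closed set. *)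
suff [] : y != r /\ sink y <= q by [].
apply: (connected_closed (Q := fun e => e != r /\ sink e <= q) cnD xD) => //.
  by split=> //; have := out x xD xr; order.
move=> d e dD eD de [dr dq]; have [er | er] := eqVneq e r.
  by have := lt_r d dD dr; move: de; rewrite er /cross /right_neighbor; order.
by split=> //; have := out e eD er; move: de; rewrite /cross /right_neighbor; order.
Qed.

(* One less than the number of gaps between endpoints in which x is the last
   chord, by source, passing above. The first such gap follows the source of x;
   each other one is identified by the sink to its left. *)
Definition valence C x : nat :=
  #|[set d in C | (source x < sink d < sink x) &&
      [forall e in C, (source x < source e) ==> ~~ (source e < sink d < sink e)]]|.

End Matchings.

(** * Valencies *)

Section Valency.

Variable N : nat.
Implicit Types (c d e r x y : chord N) (C D E S : {set chord N}).

Lemma source_endpoint D c : c \in D -> source c \in endpoints D.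
Proof. by move=> cD; rewrite inE; apply/exists_inP; exists c; rewrite ?eqxx. Qed.

Lemma sink_endpoint D c : c \in D -> sink c \in endpoints D.
Proof. by move=> cD; rewrite inE; apply/exists_inP; exists c; rewrite ?eqxx ?orbT. Qed.

Lemma endpointsP D (p : 'I_N) :
  reflect (exists2 c, c \in D & p = source c \/ p = sink c) (p \in endpoints D).
Proof.
rewrite inE; apply: (iffP exists_inP) => [[c cD /orP[/eqP|/eqP]]|[c cD [->|->]]].
- by exists c; [|left].
- by exists c; [|right].
- by exists c; rewrite ?eqxx.
- by exists c; rewrite ?eqxx ?orbT.
Qed.

Lemma mem_endpoint_seq D (p : 'I_N) : (p \in endpoint_seq D) = (p \in endpoints D).
Proof. by rewrite mem_enum. Qed.

Definition ord_lt (p q : 'I_N) : bool := p < q.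

Lemma ord_lt_trans : transitive ord_lt.
Proof. by move=> q p s; apply: ltn_trans. Qed.

Lemma ord_lt_irr : irreflexive ord_lt.
Proof. by move=> p; apply: ltnn. Qed.

Lemma enum_ord_sorted : sorted ord_lt (enum 'I_N).
Proof. by have := iota_ltn_sorted 0 N; rewrite -val_enum_ord sorted_map. Qed.

Lemma endpoint_seq_sorted D : sorted ord_lt (endpoint_seq D).
Proof.
rewrite /endpoint_seq /enum_mem -enumT.
exact/(sorted_filter ord_lt_trans)/enum_ord_sorted.
Qed.

Lemma eq_sorted_lt (s1 s2 : seq 'I_N) :
  sorted ord_lt s1 -> sorted ord_lt s2 -> s1 =i s2 -> s1 = s2.
Proof. exact: irr_sorted_eq ord_lt_trans ord_lt_irr _ _. Qed.

(* No chord of D has exactly one endpoint in the interval ]p, sink y]. *)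
Definition closers D (p : nat) : {set chord N} :=
  [set y in D | (p < sink y) &&
    [forall e in D, [|| sink e <= p, (p < source e) && (sink e <= sink y),
                        sink y < source e | (source e <= p) && (sink y < sink e)]]].

Lemma closersP D p y :
  reflect [/\ y \in D, p < sink y
    & forall e, e \in D -> sink e <= p \/ (p < source e /\ sink e <= sink y) \/
        sink y < source e \/ (source e <= p /\ sink y < sink e)]
  (y \in closers D p).
Proof.
rewrite inE; apply: (iffP and3P) => [][yD py clo]; split=> //.
  move=> e eD; have /or4P[|/andP[]||/andP[]] := forall_inP clo e eD; tauto.
apply/forall_inP => e eD; apply/or4P; case: (clo e eD) => [|[[? ?]|[|[? ?]]]].
- by constructor 1.
- by constructor 2; apply/andP.
- by constructor 3.
- by constructor 4; apply/andP.
Qed.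

Lemma max_sink D : D != set0 ->
  exists2 y, y \in D & forall e, e \in D -> sink e <= sink y.
Proof.
case/set0Pn=> c cD; case: (arg_maxnP (fun d => sink d : nat) cD) => y yD le_y.
by exists y.
Qed.

Lemma endpoint_chord D E c (u : 'I_N) : matching D -> E \subset D -> c \in D ->
  u = source c \/ u = sink c -> u \in endpoints E -> c \in E.
Proof.
move=> mD /subsetP sED cD uc /endpointsP[d dE ud].
have [<-//|ne_dc] := eqVneq d c.
have [_ /(_ ne_dc)[/eqP n1 /eqP n2 /eqP n3 /eqP n4]] := mD d c (sED _ dE) cD.
by case: uc => uc; case: ud => ud; move: n1 n2 n3 n4; rewrite -uc -ud.
Qed.

Lemma max_endpoint E y (u : 'I_N) : matching E ->
    (forall e, e \in E -> sink e <= sink y) ->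
  u \in endpoints E -> u <= sink y.
Proof.
move=> mE ymax /endpointsP[e eE ue]; have ey := ymax e eE; have := chord_lt mE eE.
by case: ue => ->; order.
Qed.

(* The chord with the last sink in an indecomposable diagram of a run is a
   closer; conversely, consecutive closers delimit indecomposable diagrams. *)
Lemma run_le D (p : nat) (Ds : seq {set chord N}) :
    matching D -> all (fun E => (E \subset D) && indecomposable E) Ds ->
    prefix (flatten [seq endpoint_seq E | E <- Ds])
      [seq q : 'I_N <- endpoint_seq D | p < q] ->
  size Ds <= #|closers D p|.
Proof.
move=> mD; elim: Ds p => //= E Ds IHDs p /andP[/andP[sED indE] allDs].
have mE := matchingS sED mD.
case/prefixP=> s def_s; rewrite -catA in def_s.
have nzE : E != set0 by case/andP: indE.
have [y yE ymax] := max_sink nzE; have yD := subsetP sED y yE.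
pose q := sink y; set rest := _ ++ s in def_s.
have leq u : u \in endpoints E -> u <= q by apply: max_endpoint.
have qE : q \in endpoints E by apply: sink_endpoint.
have srt : sorted ord_lt (endpoint_seq E ++ rest).
  by rewrite -def_s; exact/(sorted_filter ord_lt_trans)/endpoint_seq_sorted.
have gtq u : u \in rest -> q < u.
  move: srt; rewrite (sorted_pairwise ord_lt_trans) pairwise_cat => /and3P[/allrelP lt_ _ _].
  by move=> uR; apply: lt_ uR; rewrite mem_endpoint_seq.
have pE u : u \in endpoints E -> p < u.
  move=> uE; have: u \in [seq q : 'I_N <- endpoint_seq D | p < q].
    by rewrite def_s mem_cat mem_endpoint_seq uE.
  by rewrite mem_filter => /andP[].
have inE_ u : u \in endpoints D -> p < u -> u <= q -> u \in endpoints E.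
  move=> uD pu uq; have: u \in [seq q : 'I_N <- endpoint_seq D | p < q].
    by rewrite mem_filter pu mem_endpoint_seq.
  rewrite def_s mem_cat mem_endpoint_seq => /orP[//|/gtq].
  by rewrite ltnNge uq.
have def_rest : rest = [seq u : 'I_N <- endpoint_seq D | q < u].
  have -> : [seq u : 'I_N <- endpoint_seq D | q < u] =
            [seq u : 'I_N <- [seq u : 'I_N <- endpoint_seq D | p < u] | q < u].
    rewrite -filter_predI; apply: eq_filter => u /=.
    by have := pE q qE; case: ltnP => //=; order.
  rewrite def_s filter_cat (eq_in_filter (a2 := pred0)) ?filter_pred0 => [|u].
    by apply/esym/all_filterP/allP => u /gtq.
  by rewrite mem_endpoint_seq => /leq; rewrite ltnNge => ->.
have := IHDs q allDs; rewrite -def_rest prefix_prefix => /(_ isT) leDs.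
have y_cl : y \in closers D p.
  apply/closersP; split=> // [|e eD]; first exact: pE.
  have [eE|eE] := boolP (e \in E).
    by right; left; split; [apply/pE/source_endpoint|apply/leq/sink_endpoint].
  have out (u : 'I_N) : u = source e \/ u = sink e -> u <= p \/ q < u.
    move=> eu; apply/orP; apply: contraNT eE; rewrite negb_or -!ltnNge => /andP[pu uq].
    apply: (endpoint_chord mD sED eD eu); apply: inE_ pu _; last by rewrite -ltnS.
    by case: eu => ->; [apply: source_endpoint|apply: sink_endpoint].
  have := out _ (or_introl erefl); have := out _ (or_intror erefl).
  by have := chord_lt mD eD; rewrite -/q; order.
(* Moving the start from p to q loses the closer [y] and gains none, just as the run loses [E]. *)
have y_ncl : y \notin closers D q by apply/closersP => -[_]; rewrite ltnn.
apply: leq_trans (_ : #|y |: closers D q| <= _); first by rewrite cardsU1 y_ncl.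
apply/subset_leq_card/subsetP => z; rewrite in_setU1 => /predU1P[->//|].
have /closersP[_ + cly] := y_cl; rewrite -/q => pq.
case/closersP=> zD qz clz; apply/closersP; split=> // [|e eD]; first exact: ltn_trans qz.
have := cly e eD; rewrite -/q => ye.
by case: ye (clz e eD); order.
Qed.

(** The run is built greedily: the closer with the smallest sink ends the first indecomposable
    piece, and starting again from that sink removes exactly this closer. *)
Lemma run_ge D (p : nat) : matching D ->
  exists Ds : seq {set chord N}, [/\ size Ds = #|closers D p|,
    all (fun E => (E \subset D) && indecomposable E) Ds
  & prefix (flatten [seq endpoint_seq E | E <- Ds])
      [seq q : 'I_N <- endpoint_seq D | p < q]].
Proof.
move=> mD; have [n] := ubnP #|closers D p|; elim: n p => // n IHn p ltn.
have [cl0|] := eqVneq (closers D p) set0.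
  by exists [::]; split=> //=; rewrite ?cl0 ?cards0 ?prefix0s.
case/set0Pn=> c cc; case: (arg_minnP (fun d => sink d : nat) cc) => y y_cl0 ymin.
have {y_cl0} y_cl : y \in closers D p by [].
have /closersP[yD py cly] := y_cl.
have py' : p < source y by case: (cly y yD); order.
pose E := [set e in D | p < source e <= sink y].
have sED : E \subset D by apply/subsetP => e; rewrite inE => /andP[].
have mE := matchingS sED mD.
have yE : y \in E by have := chord_lt mD yD; rewrite inE yD py' => /ltnW->.
have memE e : e \in D -> p < sink e <= sink y -> e \in E.
  by move=> eD; rewrite inE eD; case: (cly e eD); have := chord_lt mD eD; order.
have inE_ e : e \in E -> [/\ e \in D, p < source e <= sink y & p < sink e <= sink y].
  rewrite inE => /andP[eD he]; split=> //.
  by have := chord_lt mD eD; case: (cly e eD); order.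
have cl_y : closers D (sink y) = closers D p :\ y.
  apply/setP => z; rewrite in_setD1; apply/closersP/andP => [[zD qz clz]|[ne_zy z_cl]].
    split; first by apply: contraTneq qz => ->; rewrite ltnn.
    apply/closersP; split=> // [|e eD]; first exact: ltn_trans qz.
    by case: (clz e eD); case: (cly e eD); order.
  have le_yz := ymin z z_cl; have /closersP[zD pz clz] := z_cl.
  have [_ /(_ ne_zy)[_ _ _ ne]] := mD z y zD yD.
  split=> // [|e eD]; first by order.
  by case: (clz e eD); case: (cly e eD); order.
have indE : indecomposable E.
  apply/andP; split; first by apply/set0Pn; exists y.
  apply/forall_inP => A /and3P[sAE nzA neA]; apply/negP => /forall_inP sepA.
  have [z zA zmax] := max_sink nzA; have zE := subsetP sAE z zA.
  have [zD pzs pzt] := inE_ z zE.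
  have /set0Pn[b] : E :\: A != set0 by apply: contraNneq neA => /eqP;
    rewrite setD_eq0 eqEsubset sAE.
  move=> bEA; have [bE bA] : b \in E /\ b \notin A by case/setDP: bEA.
  have sepAB u d : u \in A -> d \in E -> d \notin A -> sink u < source d /\ sink u < sink d.
    move=> uA dE dA; have dEA : d \in E :\: A by rewrite in_setD dA.
    have /forall_inP ltu := sepA _ (sink_endpoint uA).
    by rewrite !ltu ?source_endpoint ?sink_endpoint.
  suff z_cl : z \in closers D p.
    by have := ymin z z_cl; have [_ _] := inE_ b bE; have := sepAB z b zA bE bA; order.
  apply/closersP; split=> // [|e eD]; first by case/andP: pzt.
  have [eE|eE] := boolP (e \in E).
    have [eA|eA] := boolP (e \in A); last by have := sepAB z e zA eE eA; order.
    by right; left; have [_ /andP[-> _] _] := inE_ e eE; have := zmax e eA.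
  by move: eE; rewrite inE eD /=; case: (cly e eD); order.
have [|Ds [szDs allDs preDs]] := IHn (sink y).
  by rewrite cl_y (cardsD1 y (closers D p)) y_cl in ltn *; apply: ltn.
exists (E :: Ds); split=> /=; first by rewrite szDs cl_y (cardsD1 y (closers D p)) y_cl.
  by rewrite sED indE.
have -> : [seq q : 'I_N <- endpoint_seq D | p < q] =
    endpoint_seq E ++ [seq q : 'I_N <- endpoint_seq D | sink y < q].
  apply: eq_sorted_lt.
  - by exact/(sorted_filter ord_lt_trans)/endpoint_seq_sorted.
  - rewrite (sorted_pairwise ord_lt_trans) pairwise_cat -!(sorted_pairwise ord_lt_trans).
    rewrite endpoint_seq_sorted (sorted_filter ord_lt_trans) ?endpoint_seq_sorted ?andbT //=.
    apply/allrelP => u v; rewrite mem_endpoint_seq mem_filter => /endpointsP[e /inE_[eD h1 h2] ue].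
    by case/andP=> yv _; rewrite /ord_lt; case: ue => ->; order.
  move=> u; rewrite mem_cat mem_endpoint_seq.
  rewrite mem_filter mem_endpoint_seq mem_filter mem_endpoint_seq.
  apply/idP/idP => [/andP[pu uD]|/orP[|/andP[yu uD]]].
  - rewrite uD andbT; have [//|uy] := ltnP (sink y) u; first by rewrite orbT.
    rewrite orbF; have /endpointsP[e eD eu] := uD.
    have eE : e \in E.
      by case: eu => ue; [rewrite inE eD|apply: memE => //]; rewrite -ue pu uy.
    by apply/endpointsP; exists e.
  - case/endpointsP=> e /inE_[eD h1 h2] ue; apply/andP; split.
      by case: ue => ->; order.
    by apply/endpointsP; exists e.
  - by rewrite uD andbT; apply: leq_trans yu; rewrite ltnW.
by case/prefixP: preDs => s ->; rewrite catA prefix_prefix.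
Qed.

Lemma run_max D x (n : nat) : matching D -> #|closers D (source x)| <= n ->
  \max_(l < n.+1 | [exists Ds : l.-tuple {set chord N}, follow_source D x Ds]) l =
  #|closers D (source x)|.
Proof.
move=> mD le_n; apply/eqP; rewrite eqn_leq; apply/andP; split.
  apply/bigmax_leqP => l /existsP[Ds /andP[allDs preDs]].
  by rewrite -(size_tuple Ds); apply: run_le.
have [Ds [szDs allDs preDs]] := run_ge (source x) mD.
have lt_l : #|closers D (source x)| < n.+1 by [].
apply: (leq_trans _ (leq_bigmax_cond (Ordinal lt_l) _)) => //.
by apply/existsP; exists (tcast szDs (in_tuple Ds)); rewrite /follow_source val_tcast allDs.
Qed.

Lemma valenceP C x d :
  reflect [/\ d \in C, source x < sink d < sink x
    & forall e, e \in C -> source x < source e -> ~~ (source e < sink d < sink e)]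
  (d \in [set d in C | (source x < sink d < sink x) &&
      [forall e in C, (source x < source e) ==> ~~ (source e < sink d < sink e)]]).
Proof.
rewrite inE; apply: (iffP and3P) => [][dC xd unc]; split=> //.
  by move=> e eC xe; have /implyP := forall_inP unc e eC; apply.
by apply/forall_inP => e eC; apply/implyP => /(unc e eC).
Qed.

(** The sinks counted by [valence] are split according to the sources of their chords. Those
    starting before x belong to the left neighbors counted in the first summand; those starting
    after x belong to the closers from [source x], whose number is the length of the longest run. *)
Lemma valencyE C x : matching C -> x \in C -> valency C x = valence C x.
Proof.
move=> mC xC; rewrite /valency; set D := [set d in C | ~~ left_neighbor x d].
have sDC : D \subset C by apply/subsetP => d; rewrite inE => /andP[].
have mD := matchingS sDC mC; rewrite run_max //; last first.
  apply: subset_leq_card; apply: subset_trans sDC.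
  by apply/subsetP => d /closersP[].
rewrite /valence -[RHS](cardsID [set d | source d < source x]).
have memD e : e \in C -> source x <= source e -> e \in D.
  by move=> eC xe; rewrite inE eC /left_neighbor /right_neighbor; order.
congr (_ + _); apply: eq_card => d.
  rewrite in_setI [d \in [set d | source d < _]]inE inE; apply/idP/andP.
    case/and3P=> dC xd /forall_inP unc; move: (xd); rewrite /left_neighbor /right_neighbor.
    case/and3P=> -> h1 h2; split=> //; apply/valenceP; split=> //; first by rewrite h1.
    move=> e eC xe; have := implyP (unc e eC) xe; move: xd.
    by rewrite /left_neighbor /cross /right_neighbor; order.
  case=> /valenceP[dC xd unc] lt_dx; rewrite dC /left_neighbor /right_neighbor lt_dx /=.
  rewrite xd /=; apply/forall_inP => e eC; apply/implyP => xe.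
  by have := unc e eC xe; rewrite /cross /right_neighbor; order.
rewrite in_setD [d \in [set d | source d < _]]inE -leqNgt.
apply/closersP/andP => [[dD xd clo]|[le_xd /valenceP[dC xd unc]]].
  have dC := subsetP sDC d dD; have lt_x := chord_lt mC xC; have lt_d := chord_lt mC dC.
  have xd' : source x < source d by case: (clo d dD); order.
  split; first exact: ltnW.
  apply/valenceP; split=> //.
    by case: (clo x (memD x xC (leqnn _))); order.
  by move=> e eC xe; case: (clo e (memD e eC (ltnW xe))); order.
split=> // [||e]; [exact: memD|by case/andP: xd|].
rewrite inE => /andP[eC]; rewrite /left_neighbor /right_neighbor => ne.
have lt_d := chord_lt mC dC; have lt_e := chord_lt mC eC.
have ne_dx : d != x by apply: contraTneq xd => ->; order.
have [_ /(_ ne_dx)[m1 _ _ _]] := mC d x dC xC.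
have [->|ne_ed] := eqVneq e d; first by right; left; order.
have [_ /(_ ne_ed)[n1 n2 n3 n4]] := mC e d eC dC.
have [->|ne_ex] := eqVneq e x; first by right; right; right; order.
have [_ /(_ ne_ex)[m1' m2 m3 m4]] := mC e x eC xC.
have [xe|ex] := ltnP (source x) (source e).
  by have := unc e eC xe; order.
by have [ex'|xe'] := leqP (sink e) (source x); [left | right; right; right; order].
Qed.

End Valency.

(** * Inserting one connected diagram into another *)

Section Insertion.

Variable N : nat.
Implicit Types (c d e r x y : chord N) (A C D E S : {set chord N}).

Definition beside (q b : nat) d : Prop :=
  (q < source d /\ q < sink d /\ q < b) \/ (source d < q /\ sink d < q /\ b < q).

(* A root r of A whose source precedes E, while all other endpoints of A lie in
   one inner gap of E. *)
Record insertion A E r : Prop := Insertion {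
  ins_mA : matching A;
  ins_mE : matching E;
  ins_cA : connected A;
  ins_cE : connected E;
  ins_root : is_root A r;
  ins_first : forall x, x \in E -> source r < source x;
  ins_neq : forall x, x \in E -> source x != sink r :> nat /\ sink x != sink r :> nat;
  ins_gap : forall x d, x \in E -> d \in A -> d != r ->
    beside (source x) (sink r) d /\ beside (sink x) (sink r) d;
  ins_lo : exists2 x, x \in E & source x < sink r;
  ins_hi : exists2 x, x \in E & sink r < sink x }.

(** By [root_cover], the chords other than the root leave no gap uncovered between their first
    source and their last sink; every sink but the last falls in this range. *)
Lemma sink_covered A r d m :
    matching A -> connected A -> is_root A r -> d \in A -> m \in A ->
    sink d < sink m ->
  exists e, [/\ e \in A, e != r & source e < sink d < sink e].
Proof.
move=> mA cA rA dA mA_ ltdm; have rA_ := is_root_mem rA.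
have ne_md : m != d by apply: contraTneq ltdm => ->; rewrite ltnn.
(* The root may be [d] or [m] itself; its right neighbor [z] then takes its place as a witness. *)
have [z zA rz] : exists2 z, z \in A & right_neighbor r z.
  have [mr|mr] := eqVneq m r; last exact: root_neighbor mr.
  by apply: (root_neighbor mA cA rA dA); rewrite -mr eq_sym.
have zr : z != r by apply: contraTneq rz => ->; rewrite /right_neighbor ltnn.
have [y [yA yr dy]] : exists y, [/\ y \in A, y != r & sink d < sink y].
  have [mr|mr] := eqVneq m r; last by exists m.
  by exists z; split=> //; move: rz ltdm; rewrite mr /right_neighbor; order.
have [x [xA xr xd]] : exists x, [/\ x \in A, x != r & source x <= sink d].
  have [->|dr] := eqVneq d r; last by exists d; rewrite dr dA ltnW ?(chord_lt mA).
  by exists z; split=> //; move: rz; rewrite /right_neighbor; order.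
have [e [eA er ecov]] := root_cover mA cA rA xA xr yA yr xd dy.
have [es et] := andP ecov.
exists e; split=> //; have ne_ed : e != d by apply: contraTneq et => ->; rewrite ltnn.
by have [_ /(_ ne_ed)[_ n _ _]] := mA e d eA dA; rewrite ltn_neqAle n es.
Qed.

(** This is the chord whose valency goes up when a diagram is inserted into the gap after q. *)
Definition top_chord E (q : nat) x : bool :=
  [&& x \in E, covers x q & [forall e in E, (source x < source e) ==> ~~ covers e q]].

Lemma top_chordP E q x :
  reflect [/\ x \in E, covers x q
            & forall e, e \in E -> source x < source e -> ~~ covers e q]
          (top_chord E q x).
Proof.
apply: (iffP and3P) => [][xE xq unc]; split=> //.
  by move=> e eE xe; have /implyP := forall_inP unc e eE; apply.
by apply/forall_inP => e eE; apply/implyP => /(unc e eE).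
Qed.

Variables (A E : {set chord N}) (r : chord N).
Hypothesis insAE : insertion A E r.

Let mA := ins_mA insAE.
Let mE := ins_mE insAE.
Let rA := ins_root insAE.
Let rinA := is_root_mem rA.

Lemma ins_pair x d : x \in E -> d \in A ->
  [/\ source x < sink x, source d < sink d
  & (d = r /\ source r < source x /\ source x != sink r :> nat /\ sink x != sink r :> nat) \/
    (d != r /\ beside (source x) (sink r) d /\ beside (sink x) (sink r) d)].
Proof.
move=> xE dA; split; [exact: chord_lt mE xE|exact: chord_lt mA dA|].
have [->|dr] := eqVneq d r; last by right; split=> //; apply: (ins_gap insAE).
by left; have [n1 n2] := ins_neq insAE xE; rewrite (ins_first insAE xE).
Qed.

Lemma ins_ne x d : x \in E -> d \in A -> x != d.
Proof.
move=> xE dA; apply: contraTneq isT => xd; have [_ _] := ins_pair xE dA.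
rewrite -xd; case=> [[xr]|[_ []]]; last by rewrite /beside; order.
by rewrite -xr; order.
Qed.

Lemma ins_notin x : x \in E -> x \notin A.
Proof. by move=> xE; apply/negP => xA; have := ins_ne xE xA; rewrite eqxx. Qed.

Lemma ins_disjoint : [disjoint A & E].
Proof.
by apply/pred0P => x /=; apply/andP => -[xA xE]; have := ins_notin xE; rewrite xA.
Qed.

Lemma ins_card : #|A :|: E| = #|A| + #|E|.
Proof. by rewrite cardsU (disjoint_setI0 ins_disjoint) cards0 subn0. Qed.

Lemma ins_matching : matching (A :|: E).
Proof.
have mAE x d : x \in E -> d \in A -> [/\ source x != source d :> nat,
    source x != sink d :> nat, sink x != source d :> nat & sink x != sink d :> nat].
  move=> xE dA; have [h1 h2 h3] := ins_pair xE dA.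
  case: h3 => [[-> h]|[_ []]]; last by rewrite /beside; split; order.
  by split; order.
move=> c d; rewrite !in_setU => /orP[cA|cE] /orP[dA|dE].
- exact: mA.
- split; first exact: chord_lt mA cA.
  by have [h1 h2 h3 h4] := mAE d c dE cA => _; split; order.
- split; first exact: chord_lt mE cE.
  by have := mAE c d cE dA.
- exact: mE.
Qed.

Lemma ins_is_root : is_root (A :|: E) r.
Proof.
rewrite /is_root in_setU rinA /=; apply/forall_inP => x; rewrite in_setU => /orP[xA|xE].
  exact: is_root_le rA xA.
exact/ltnW/(ins_first insAE).
Qed.

Lemma ins_cross_AE x d : x \in E -> d \in A ->
  right_neighbor d x = (d == r) && (source x < sink r < sink x).
Proof.
move=> xE dA; have [h1 h2 h3] := ins_pair xE dA; rewrite /right_neighbor.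
case: h3 => [[-> [h [n1 n2]]]|[/negPf-> [b1 b2]]]; first by rewrite eqxx; order.
by move: b1 b2; rewrite /beside; order.
Qed.

Lemma ins_cross_EA x d : x \in E -> d \in A -> right_neighbor x d = false.
Proof.
move=> xE dA; have [h1 h2 h3] := ins_pair xE dA; rewrite /right_neighbor.
by case: h3 => [[-> [h [n1 n2]]]|[_ []]]; rewrite /beside; order.
Qed.

Lemma ins_cross x d : x \in E -> d \in A ->
  cross x d = (d == r) && (source x < sink r < sink x).
Proof. by move=> xE dA; rewrite /cross (ins_cross_AE xE dA) (ins_cross_EA xE dA). Qed.

Lemma ins_crossing : exists2 x, x \in E & source x < sink r < sink x.
Proof.
have [[x xE lox] [y yE hiy]] := (ins_lo insAE, ins_hi insAE).
have [e eE ecov] := connected_cover (ins_cE insAE) xE yE (ltnW lox) hiy.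
have [es et] := andP ecov.
by exists e => //; rewrite et andbT ltn_neqAle es andbT; case: (ins_neq insAE eE).
Qed.

Lemma ins_connected : connected (A :|: E).
Proof.
have [x xE xr] := ins_crossing.
have rAE : r \in A :|: E by rewrite in_setU rinA.
apply: (connectedI rAE) => S rS clS; have subS d : d \in A -> d \in S.
  apply: (connected_closed (Q := fun d => d \in S) (ins_cA insAE) rinA rS).
  by move=> y z yA zA yz; apply: clS yz; rewrite in_setU ?yA ?zA.
have xS : x \in S.
  by apply: clS (rS); rewrite // ?in_setU ?xE ?orbT // crossC ins_cross // eqxx.
apply/subsetP => y; rewrite in_setU => /orP[/subS//|].
apply: (connected_closed (Q := fun d => d \in S) (ins_cE insAE) xE xS).
by move=> y' z yA zA yz; apply: clS yz; rewrite in_setU ?yA ?zA orbT.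
Qed.

(** Only the root passes above points of [E]. The sinks of [E] below it are covered by later chords,
    since the connected set [E] reaches beyond [sink r]; the sinks of [A] below it are so by
    [sink_covered]. Hence the root counts no sink, before or after the insertion. *)
Lemma ins_valence_A x : x \in A -> valence (A :|: E) x = valence A x.
Proof.
move=> xA; apply: eq_card => d; apply/valenceP/valenceP => [][dAE xd unc].
  split=> [||e eA]; [|by []|by apply: unc; rewrite in_setU eA].
  move: dAE; rewrite in_setU => /orP[//|dE]; have [h1 h2 h3] := ins_pair dE xA.
  case: h3 => [[xr [h [n1 n2]]]|[_ []]]; last by rewrite /beside; order.
  have [y yE hiy] := ins_hi insAE.
  have [|e eE ecov] := connected_cover (q := sink d) (ins_cE insAE) dE yE (ltnW h1).
    by move: xd; rewrite xr; order.
  have [es et] := andP ecov.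
  have ne_ed : e != d by apply: contraTneq et => ->; rewrite ltnn.
  have [_ /(_ ne_ed)[_ n3 _ _]] := mE eE dE.
  have := unc e; rewrite in_setU eE orbT xr => /(_ isT (ins_first insAE eE)).
  by order.
split=> [||e]; rewrite ?in_setU ?dAE // => /orP[eA|eE]; first exact: unc.
move=> xe; apply/negP => edt; have [h1 h2 hd] := ins_pair eE dAE.
have [_ h4 hx] := ins_pair eE xA.
case: hx => [[xr _]|[_ []]]; last first.
  rewrite /beside; case: hd => [[dr [h [n1 n2]]]|[_ []]]; rewrite /beside ?dr; last by order.
  by move: edt; rewrite dr; order.
have [|e' [eA er edt']] := sink_covered mA (ins_cA insAE) rA dAE rinA.
  by rewrite -xr; case/andP: xd.
by have := unc e' eA; rewrite xr (is_root_lt mA rA eA er) edt' => /(_ isT).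
Qed.

(** All sinks of [A] lie in the gap of [E] that contains [sink r], and all but the last are covered
    by a chord of [A] other than the root. So only the last one can be new for x, and it counts
    exactly if x is the top chord of that gap. *)
Lemma ins_valence_E x : x \in E ->
  valence (A :|: E) x = valence E x + top_chord E (sink r) x.
Proof.
move=> xE; rewrite /valence -[LHS](cardsID E); congr (_ + _).
  apply: eq_card => d; rewrite in_setI; apply/andP/valenceP => [[/valenceP[_ xd unc] dE]|].
    by split=> // e eE; apply: unc; rewrite in_setU eE orbT.
  case=> dE xd unc; split=> //; apply/valenceP; split; rewrite ?in_setU ?dE ?orbT //.
  move=> e; rewrite in_setU => /orP[eA|]; last exact: unc.
  move=> xe; have [h1 h2 h3] := ins_pair xE eA; have [_ _ hd] := ins_pair dE eA.
  case: h3 => [[er [h [n1 n2]]]|[_ [b1 b2]]]; first by move: xe; rewrite er; order.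
  case: hd => [[er [h [n1 n2]]]|[_ []]]; rewrite /beside.
    by have := ins_first insAE xE; move: xe; rewrite er; order.
  by order.
have nzA : A != set0 by apply/set0Pn; exists r.
have [m mA_ mmax] := max_sink nzA.
have eq_cov e d : e \in E -> d \in A -> (source e < sink d < sink e) = covers e (sink r).
  move=> eE dA; have [h1 h2 h3] := ins_pair eE dA; rewrite /covers.
  by case: h3 => [[-> [h [n1 n2]]]|[_ []]]; [order|rewrite /beside; order].
set S := _ :\: E; have memS d : (d \in S) = (d == m) && top_chord E (sink r) x.
  rewrite in_setD; apply/andP/andP => [[dE /valenceP[]]|[/eqP-> /top_chordP[_ xr unc]]].
    rewrite in_setU (negPf dE) orbF => dA xd unc; split; last first.
      apply/top_chordP; split=> // [|e eE xe]; first by rewrite -(eq_cov x d).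
      by rewrite -(eq_cov e d) // unc // in_setU eE orbT.
    have [dm|md] := ltnP (sink d) (sink m).
      have [e [eA er edt]] := sink_covered mA (ins_cA insAE) rA dA mA_ dm.
      have [h1 h2 h3] := ins_pair xE eA; case: h3 => [[]|[_ [b1 b2]]].
        by move=> er'; rewrite er' eqxx in er.
      have [_ _ h4] := ins_pair xE dA.
      have := unc e; rewrite in_setU eA edt => /(_ isT) /implyP.
      rewrite implybF; case: h4 => [[dr [h [n1 n2]]]|[_ []]]; move: b1 b2 xd; rewrite /beside ?dr; order.
    apply/negPn/negP => ne_dm; have [_ /(_ ne_dm)[_ _ _]] := mA dA mA_.
    by have := mmax d dA; order.
  split; first by apply/negP => /ins_notin; rewrite mA_.
  apply/valenceP; rewrite in_setU mA_ eq_cov //; split=> // e.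
  rewrite in_setU => /orP[eA xe|eE xe]; last by rewrite eq_cov // unc.
  by have := mmax e eA; order.
have [top|top] := boolP (top_chord _ _ _).
  by apply/eqP/cards1P; exists m; apply/setP => d; rewrite memS top andbT in_set1.
by apply: eq_card0 => d; rewrite memS (negPf top) andbF.
Qed.

End Insertion.

(** * Existence and uniqueness of the decomposition *)

Section Decomposition.

Variable N : nat.
Implicit Types (c d e r x y : chord N) (A C D E S : {set chord N}).

(** As d crosses nothing in [E], each chord of [E] is either nested in d or has no endpoint inside
    d. Crossings within [E] preserve this alternative, and the chord x, which starts before d,
    settles it. *)
Lemma nested_or_beside E d x : matching E -> connected E ->
    (forall y, y \in E -> [/\ source y != source d :> nat, source y != sink d :> nat,
      sink y != source d :> nat & sink y != sink d :> nat]) ->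
    (forall y, y \in E -> ~~ cross y d) -> source d < sink d ->
    x \in E -> source x < source d ->
  forall y, y \in E -> ~~ (source d < source y < sink d) && ~~ (source d < sink y < sink d).
Proof.
move=> mE cE neE ncE lt_d xE xd.
have in_or_out y : y \in E -> (source d < source y /\ sink y < sink d) \/
    (~~ (source d < source y < sink d) /\ ~~ (source d < sink y < sink d)).
  move=> yE; have [n1 n2 n3 n4] := neE y yE; have := ncE y yE; have := chord_lt mE yE.
  by rewrite /cross /right_neighbor; order.
move=> y yE; suff : source y < source d \/ sink d < sink y.
  by case: (in_or_out y yE); have := chord_lt mE yE; order.
apply: (connected_closed (Q := fun y => source y < source d \/ sink d < sink y) cE xE _ _ yE).
  by left.
move=> u v uE vE uv Qu; have ltu := chord_lt mE uE; have ltv := chord_lt mE vE.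
have [n1 n2 n3 n4] := neE v vE.
case: (in_or_out u uE) => [|[o1 o2]]; first by order.
case: (in_or_out v vE) => [[i1 i2]|[p1 p2]]; last by order.
by move: uv; rewrite /cross /right_neighbor; order.
Qed.

Lemma decomposition C : matching C -> connected C -> 1 < #|C| ->
  exists A E r, insertion A E r /\ C = A :|: E.
Proof.
move=> mC cC C2; have nzC : C != set0 by rewrite -card_gt0 ltnW.
have [r rC] := root_exists nzC; have rinC := is_root_mem rC.
pose D := C :\ r; have nzD : D != set0.
  by rewrite -card_gt0; move: C2; rewrite (cardsD1 r C) rinC.
have sDC : D \subset C by apply: subD1set.
have mD := matchingS sDC mC.
have [s sD] := root_exists nzD; have sinD := is_root_mem sD.
pose E := component D s; pose A := C :\: E.
have sED : E \subset D by apply: component_sub.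
have sEC := subset_trans sED sDC.
have mE := matchingS sED mD.
have sE : s \in E by apply: mem_component.
have cE : connected E by apply: component_connected.
have sAC : A \subset C by apply: subsetDl.
have mA := matchingS sAC mC.
have rE : r \notin E by apply/negP => /(subsetP sED); rewrite !inE eqxx.
have rinA : r \in A by rewrite in_setD rE.
have memD x : x \in C -> x != r -> x \in D by move=> xC xr; rewrite !inE xr.
have Ene x : x \in E -> x != r by apply: contraTneq => ->.
have ncEA x d : x \in E -> d \in A -> d != r -> ~~ cross x d.
  move=> xE; rewrite in_setD => /andP[dE dC] dr; apply: contra dE => xd.
  exact: component_closed xE (memD d dC dr) xd.
have rA : is_root A r.
  apply/andP; split=> //; apply/forall_inP => x /(subsetP sAC); exact: is_root_le.
have cA : connected A.
  apply: (connectedI rinA) => S rS clS; apply/subsetP => d dA.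
  (* A path in [C] from the root may run through [E], but it can return to [A] only at the root,
     which lies in [S]. *)
  suff [dE|//] : d \in E \/ d \in S by case/setDP: dA; rewrite dE.
  move: (subsetP sAC d dA).
  apply: (connected_closed (Q := fun d => d \in E \/ d \in S) cC rinC); first by right.
  move=> x y xC yC xy Qx; have [yE|yE] := boolP (y \in E); [by left|right].
  have yA : y \in A by rewrite in_setD yE.
  have [->//|yr] := eqVneq y r.
  have [xE|xE] := boolP (x \in E); first by case/negP: (ncEA x y xE yA yr).
  have xA : x \in A by rewrite in_setD xE.
  by case: Qx => [xE'|xS]; [rewrite xE' in xE|apply: clS xy xS].
have ne4 x d : x \in E -> d \in A -> [/\ source x != source d :> nat,
    source x != sink d :> nat, sink x != source d :> nat & sink x != sink d :> nat].
  move=> xE dA; have [_] := mC x d (subsetP sEC x xE) (subsetP sAC d dA).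
  by apply; apply: contraTneq dA => <-; rewrite in_setD xE.
(* Otherwise [E] would be closed under crossings in [C] and would contain the root. *)
have [x xE xr] : exists2 x, x \in E & right_neighbor r x.
  apply/exists_inP; apply: contraLR rE => /exists_inPn nx; apply/negPn.
  apply: (connected_closed (Q := fun d => d \in E) cC (subsetP sEC s sE) sE) rinC => //.
  move=> x y xC yC xy xE; have [yr|yr] := eqVneq y r; last first.
    exact: component_closed xE (memD y yC yr) xy.
  have := nx x xE; have := is_root_lt mC rC xC (Ene x xE).
  by move: xy; rewrite yr /cross /right_neighbor; order.
(* A chord of [A] other than the root starts after [s], so it has no point of [E] inside. Crossings
   in [A], followed from the root, thus never step over a point of [E]. *)
have gap d : d \in A -> d = r \/ forall y, y \in E -> beside (source y) (sink r) d /\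
    beside (sink y) (sink r) d.
  have nest e : e \in A -> e != r -> forall y, y \in E ->
    ~~ (source e < source y < sink e) && ~~ (source e < sink y < sink e).
    move=> eA er; have eC := subsetP sAC e eA.
    apply: (nested_or_beside mE cE _ _ (chord_lt mA eA) sE) => [y yE|y yE|].
    - exact: ne4.
    - exact: ncEA.
    - have eD := memD e eC er; have := is_root_lt mD sD eD.
      by apply; apply: contraTneq eA => ->; rewrite in_setD sE.
  apply: (connected_closed (Q := fun d => d = r \/ forall y, y \in E ->
    beside (source y) (sink r) d /\ beside (sink y) (sink r) d) cA rinA); first by left.
  move=> u v uA vA uv Qu; have [->|vr] := eqVneq v r; [by left|right=> y yE].
  have lt_v := chord_lt mA vA; have lt_u := chord_lt mA uA; have lt_y := chord_lt mE yE.
  have [n1 n2 n3 n4] := ne4 y v yE vA; have [m1 m2 m3 m4] := ne4 y r yE rinA.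
  have /andP[nv1 nv2] := nest v vA vr y yE.
  have [ur|ur] := eqVneq u r.
    have lt_r := is_root_lt mA rA vA vr.
    by move: uv; rewrite ur /cross /right_neighbor /beside; order.
  have /andP[nu1 nu2] := nest u uA ur y yE.
  case: Qu => [ur'|/(_ y yE)[b1 b2]]; first by rewrite ur' eqxx in ur.
  by move: uv b1 b2; rewrite /cross /right_neighbor /beside; order.
exists A, E, r; split; last first.
  apply/setP => y; rewrite in_setU in_setD.
  by have [/(subsetP sEC)|] := boolP (y \in E); rewrite ?orbF.
split=> //.
- by move=> y yE; apply: is_root_lt mC rC (subsetP sEC y yE) (Ene y yE).
- by move=> y yE; have [] := ne4 y r yE rinA.
- by move=> y d yE dA dr; case: (gap d dA) => [dr'|]; [rewrite dr' eqxx in dr|apply].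
- by exists x => //; case/and3P: xr.
- by exists x => //; case/and3P: xr.
Qed.

Section Components.

Variables (A E : {set chord N}) (r : chord N).
Hypothesis insAE : insertion A E r.

Let mA := ins_mA insAE.
Let mE := ins_mE insAE.
Let rA := ins_root insAE.
Let rinA := is_root_mem rA.

Lemma ins_remove : (A :|: E) :\ r = A :\ r :|: E.
Proof.
rewrite setDUl; congr (_ :|: _); apply/setP => x; rewrite !inE.
by have [->|] := eqVneq x r; rewrite //=; apply/esym/negP => /(ins_notin insAE); rewrite rinA.
Qed.

Lemma ins_component_E x : x \in E -> component ((A :|: E) :\ r) x = E.
Proof.
move=> xE; rewrite ins_remove; apply: componentE => //; first exact: subsetUr.
  exact: ins_cE insAE.
move=> y z yE; rewrite in_setU => /orP[/setD1P[zr zA]|//].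
by rewrite (ins_cross insAE) // (negPf zr).
Qed.

Lemma ins_component_A d : d \in A :\ r ->
  component ((A :|: E) :\ r) d = component (A :\ r) d.
Proof.
move=> dA; rewrite ins_remove; apply: componentE.
- by apply: subset_trans (component_sub _ _) _; apply: subsetUl.
- exact: component_connected.
- exact: mem_component.
move=> x y xc; rewrite in_setU => /orP[yA|yE] xy; first exact: component_closed xc yA xy.
have /setD1P[xr xA] := subsetP (component_sub _ _) x xc.
by move: xy; rewrite crossC (ins_cross insAE) // (negPf xr).
Qed.

Lemma ins_remove_root s : is_root E s -> is_root ((A :|: E) :\ r) s.
Proof.
move=> sE; rewrite ins_remove /is_root in_setU (is_root_mem sE) orbT /=.
apply/forall_inP => x; rewrite in_setU => /orP[/setD1P[xr xA]|xE]; last exact: is_root_le sE xE.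
have [y yE lo] := ins_lo insAE; have ley := is_root_le sE yE.
have [_ _ [[xr' _]|[_ []]]] := ins_pair insAE yE xA; first by rewrite xr' eqxx in xr.
by rewrite /beside; order.
Qed.

End Components.

Lemma insertion_inj A E r A' E' r' : insertion A E r -> insertion A' E' r' ->
  A :|: E = A' :|: E' -> [/\ A = A', E = E' & r = r'].
Proof.
move=> ins ins' eqC; have r_eq : r = r'.
  apply: root_uniq (ins_matching ins) (ins_is_root ins) _.
  by rewrite eqC; apply: ins_is_root.
have nz (B F : {set chord N}) s : insertion B F s -> F != set0.
  by case/ins_lo=> x xF _; apply/set0Pn; exists x.
have [s sE] := root_exists (nz A E r ins); have [s' sE'] := root_exists (nz A' E' r' ins').
have s_eq : s = s'.
  have rs := ins_remove_root ins sE; apply: root_uniq rs _.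
    by apply: matchingS (ins_matching ins); apply: subD1set.
  by rewrite eqC r_eq; apply: ins_remove_root.
have E_eq : E = E'.
  rewrite -(ins_component_E ins (is_root_mem sE)).
  by rewrite -(ins_component_E ins' (is_root_mem sE')) eqC r_eq s_eq.
split=> //; have defA (B F : {set chord N}) t : insertion B F t -> B = (B :|: F) :\: F.
  by move/ins_disjoint/disjoint_setI0 => d; rewrite setDUl setDv setU0 setDE;
    apply/esym/setIidPl; rewrite -disjoints_subset -setI_eq0 d.
by rewrite (defA A E r ins) (defA A' E' r' ins') eqC E_eq.
Qed.

End Decomposition.

(** * Codes of connected diagrams *)

(* Ins a e g is the diagram whose word is that of e, with the first endpoint of a
   put in front and all others in the gap after endpoint number g (from 0). *)
Inductive code : Type := One | Ins of code & code & nat.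

Fixpoint code_tree (c : code) : GenTree.tree nat :=
  if c is Ins a e g then GenTree.Node g [:: code_tree a; code_tree e] else GenTree.Leaf 0.

Fixpoint tree_code (t : GenTree.tree nat) : code :=
  if t is GenTree.Node g [:: a; e] then Ins (tree_code a) (tree_code e) g else One.

Lemma code_treeK : cancel code_tree tree_code.
Proof. by elim=> //= a -> e -> g. Qed.

HB.instance Definition _ := Choice.copy code (can_type code_treeK).

Fixpoint csize (c : code) : nat := if c is Ins a e _ then csize a + csize e else 1.

(** Of m chords, the 2m endpoints have 2m - 1 gaps between them; gap g follows endpoint g, both
    counted from 0. *)
Definition gaps (c : code) : nat := (csize c).*2.-1.

Fixpoint valid (c : code) : bool :=
  if c is Ins a e g then [&& valid a, valid e & g < gaps e] else true.

Lemma csize_gt0 c : 0 < csize c.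
Proof. by elim: c => //= a IHa e IHe g; rewrite addn_gt0 IHa. Qed.

Definition splice (T : Type) (g : nat) (a e : seq T) : seq T :=
  if a is p :: a' then p :: take g.+1 e ++ a' ++ drop g.+1 e else e.

Lemma perm_splice (T : eqType) g (a e : seq T) : perm_eq (splice g a e) (e ++ a).
Proof.
apply/permP => P; case: a => [|p a]; first by rewrite cats0.
rewrite /= !count_cat /= -[in RHS](cat_take_drop g.+1 e) count_cat; lia.
Qed.

Lemma size_splice (T : eqType) g (a e : seq T) : size (splice g a e) = size a + size e.
Proof. by rewrite (perm_size (perm_splice g a e)) size_cat addnC. Qed.

Section Coded.

Variable N : nat.
Implicit Types (x y r d : chord N) (C D A E : {set chord N}) (ep : seq 'I_N) (s : seq (chord N)).

Lemma sorted_lt_cat (s1 s2 : seq 'I_N) : sorted (@ord_lt N) (s1 ++ s2) =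
  [&& allrel (@ord_lt N) s1 s2, sorted (@ord_lt N) s1 & sorted (@ord_lt N) s2].
Proof. by rewrite !(sorted_pairwise (@ord_lt_trans N)) pairwise_cat. Qed.

(** The chord list puts [e] before [a]: chords of [e] keep their indices and those of [a] are
    shifted by [csize e]. This is the numbering behind [gap_tops] and [valences]. *)
Inductive coded : code -> seq 'I_N -> seq (chord N) -> Prop :=
  | coded_one p q : ord_lt p q -> coded One [:: p; q] [:: (p, q)]
  | coded_ins a e g pa sa pe se : coded a pa sa -> coded e pe se -> g < gaps e ->
      sorted (@ord_lt N) (splice g pa pe) -> coded (Ins a e g) (splice g pa pe) (se ++ sa).

Lemma coded_size c ep s : coded c ep s ->
  [/\ valid c, sorted (@ord_lt N) ep, size ep = (csize c).*2 & size s = csize c].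
Proof.
elim=> [p q pq|a e g pa sa pe se _ [va _ sza ssa] _ [ve _ sze sse] ge st] /=.
  by rewrite andbT pq.
by rewrite va ve; split; rewrite // ?size_splice ?sza ?sze ?doubleD // size_cat sse ssa addnC.
Qed.

Lemma splice_sorted_sub g pa pe :
  sorted (@ord_lt N) (splice g pa pe) -> sorted (@ord_lt N) pa /\ sorted (@ord_lt N) pe.
Proof.
have sub (T : eqType) (a e : seq T) : subseq a (splice g a e) /\ subseq e (splice g a e).
  case: a => [|p a]; rewrite ?sub0seq //; split.
    rewrite /= eqxx; apply: subseq_trans (suffix_subseq _ _); apply: prefix_subseq.
  apply: subseq_trans (subseq_cons _ _).
  by rewrite -{1}(cat_take_drop g.+1 e); apply: cat_subseq => //; apply: suffix_subseq.
by have [sa se] := sub _ pa pe => st; split; apply: subseq_sorted st => //; apply: ord_lt_trans.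
Qed.

Lemma spliceP g p pa pe : sorted (@ord_lt N) (splice g (p :: pa) pe) ->
  [/\ forall q, q \in pa -> p < q, forall q, q \in pe -> p < q
    & forall u q, u \in pa -> q \in pe ->
        (q \in take g.+1 pe) && (q < u) || (q \in drop g.+1 pe) && (u < q)].
Proof.
rewrite (sorted_pairwise (@ord_lt_trans N)) /= => /andP[/allP ltp].
rewrite !pairwise_cat => /and3P[/allrelP lt1 _ /and3P[/allrelP lt2 _ _]].
split=> [q qa|q qe|u q ua qe].
- by apply: ltp; rewrite !mem_cat qa orbT.
- by apply: ltp; rewrite !mem_cat orbCA -mem_cat cat_take_drop qe orbT.
move: (qe); rewrite -{1}(cat_take_drop g.+1 pe) mem_cat => /orP[q1|q2].
  by have := lt1 q u q1; rewrite /ord_lt q1 mem_cat ua => ->.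
by have := lt2 u q ua q2; rewrite /ord_lt q2 => ->; rewrite orbT.
Qed.

(** The condition [g.+1 < size pe] leaves points of [E] on both sides of the block of [A]; this is
    where the last two fields of [insertion] come from. *)
Lemma splice_insertion g (pa pe : seq 'I_N) A E :
    matching A -> matching E -> connected A -> connected E -> A != set0 ->
    endpoints A =i pa -> endpoints E =i pe -> g.+1 < size pe ->
    sorted (@ord_lt N) (splice g pa pe) ->
  exists2 r, insertion A E r & source r = head (source r) pa.
Proof.
move=> mA mE cA cE nzA epA epE lt_g st.
have [r rA] := root_exists nzA; have rinA := is_root_mem rA.
case: pa => [|p pa] in epA st *.
  by have := source_endpoint rinA; rewrite epA.
have [ltp1 ltp2 sep] := spliceP st.
have minp (u : 'I_N) : u \in endpoints A -> p <= u.
  by rewrite epA in_cons => /predU1P[->//|/ltp1/ltnW].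
have rp : source r = p.
  have: p \in endpoints A by rewrite epA mem_head.
  case/endpointsP=> d dA pd; apply/val_inj/eqP; rewrite eqn_leq minp ?source_endpoint // andbT.
  have := is_root_le rA dA; case: pd => [->//|pd _].
  by have := chord_lt mA dA; have := minp _ (source_endpoint dA); rewrite -pd; order.
have tA d : d \in A -> sink d \in pa.
  move=> dA; have := sink_endpoint dA; rewrite epA in_cons => /predU1P[dp|//].
  by have := minp _ (source_endpoint dA); have := chord_lt mA dA; rewrite dp; order.
have sA d : d \in A -> d != r -> source d \in pa.
  move=> dA dr; have := source_endpoint dA; rewrite epA in_cons => /predU1P[dp|//].
  by have := is_root_lt mA rA dA dr; rewrite dp rp ltnn.
have xE x : x \in E -> source x \in pe /\ sink x \in pe.
  by move=> xE; rewrite -!epE source_endpoint // sink_endpoint.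
have endE (q : 'I_N) : q \in pe -> exists2 x, x \in E & source x <= q <= sink x.
  rewrite -epE => /endpointsP[x xinE qx]; exists x => //.
  by have := chord_lt mE xinE; case: qx => ->; order.
have upe : uniq pe.
  by have [_ ] := splice_sorted_sub st; apply: sorted_uniq; [apply: ord_lt_trans|apply: ord_lt_irr].
have tdN (q : 'I_N) : q \in take g.+1 pe -> q \in drop g.+1 pe -> False.
  move: upe; rewrite -{1}(cat_take_drop g.+1 pe) cat_uniq => /and3P[_ /hasPn nh _] q1 q2.
  by have := nh q q2; rewrite q1.
have side (q : 'I_N) d : q \in pe -> d \in A -> d != r -> beside q (sink r) d.
  move=> qe dA dr; have := sep _ q (sA d dA dr) qe; have := sep _ q (tA d dA) qe.
  have := sep _ q (tA r rinA) qe; rewrite /beside.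
  case q1: (q \in take g.+1 pe); case q2: (q \in drop g.+1 pe) => /=.
  - by case: (tdN q q1 q2).
  - by rewrite !orbF; left.
  - by right.
  - by [].
exists r; last by rewrite /= rp.
split=> //.
- by move=> x /xE[xs _]; rewrite rp ltp2.
- move=> x /xE[xs xt]; have := sep _ _ (tA r rinA) xs; have := sep _ _ (tA r rinA) xt.
  by split; order.
- by move=> x d /xE[xs xt] dA dr; split; apply: side.
- have [q qt] : exists q, q \in take g.+1 pe.
    by case: (pe) lt_g => // q pe' _; exists q; rewrite /= mem_head.
  have qe : q \in pe := mem_take qt.
  have [x xinE /andP[xq _]] := endE q qe; exists x => //; apply: leq_ltn_trans xq _.
  have := sep _ q (tA r rinA) qe; rewrite qt => /orP[//|/andP[qd _]].
  by case: (tdN q qt qd).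
have [q qt] : exists q, q \in drop g.+1 pe.
  have := size_drop g.+1 pe; case: (drop _ _) => [|q s _]; last by exists q; rewrite mem_head.
  by move/esym/eqP; rewrite subn_eq0 leqNgt lt_g.
have qe : q \in pe := mem_drop qt.
have [x xinE /andP[_ qx]] := endE q qe; exists x => //; apply: leq_trans qx.
have := sep _ q (tA r rinA) qe; rewrite qt => /orP[/andP[qd _]|//].
by case: (tdN q qd qt).
Qed.

Lemma set_cat (s1 s2 : seq (chord N)) :
  [set x in s1 ++ s2] = [set x in s2] :|: [set x in s1].
Proof. by apply/setP => x; rewrite !inE mem_cat orbC. Qed.

Lemma endpointsU C D p : p \in endpoints (C :|: D) = (p \in endpoints C) || (p \in endpoints D).
Proof.
apply/endpointsP/orP => [[c]|[]/endpointsP[c cC pc]].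
- by rewrite in_setU => /orP[cC|cD] pc; [left|right]; apply/endpointsP; exists c.
- by exists c; rewrite ?in_setU ?cC.
- by exists c; rewrite ?in_setU ?cC ?orbT.
Qed.

Lemma coded_diagram c ep s : coded c ep s ->
  [/\ matching [set x in s], connected [set x in s], [set x in s] != set0
    & endpoints [set x in s] =i ep].
Proof.
elim=> [p q pq|a e g pa sa pe se ca [mA cA nzA epA] ce [mE cE nzE epE] ge st].
  have -> : [set x in [:: (p, q)]] = [set (p, q)] by apply/setP => x; rewrite !inE.
  split.
  - by move=> x y /set1P-> /set1P->; rewrite eqxx.
  - by apply/forall_inP => x /set1P->; apply/forall_inP => y /set1P->.
  - by apply/set0Pn; exists (p, q); rewrite set11.
  move=> u; rewrite !inE; apply/existsP/orP => [[x]|].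
    by rewrite !inE => /andP[/eqP->] /orP[]/eqP<-; [left|right]; apply/eqP.
  by move=> pu; exists (p, q); rewrite !inE eqxx /= ![_ == u]eq_sym; apply/orP.
have [_ _ sze _] := coded_size ce.
have [|r ins _] := splice_insertion mA mE cA cE nzA epA epE _ st.
  by rewrite sze; move: ge; rewrite /gaps; have := csize_gt0 e; order.
rewrite set_cat; split.
- exact: ins_matching ins.
- exact: ins_connected ins.
- by case/set0Pn: nzA => x xA; apply/set0Pn; exists x; rewrite in_setU xA.
by move=> u; rewrite endpointsU epA epE (perm_mem (perm_splice _ _ _)) mem_cat orbC.
Qed.

Lemma coded_endpoints c ep s : coded c ep s -> endpoint_seq [set x in s] = ep.
Proof.
move=> co; have [_ st _ _] := coded_size co; have [_ _ _ eqep] := coded_diagram co.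
by apply: eq_sorted_lt => //; [apply: endpoint_seq_sorted|move=> u; rewrite mem_endpoint_seq eqep].
Qed.

Lemma coded_insertion a e g pa sa pe se :
    coded a pa sa -> coded e pe se -> g < gaps e -> sorted (@ord_lt N) (splice g pa pe) ->
  exists2 r, insertion [set x in sa] [set x in se] r & source r = head (source r) pa.
Proof.
move=> ca ce ge st; have [mA cA nzA epA] := coded_diagram ca.
have [mE cE nzE epE] := coded_diagram ce; have [_ _ sze _] := coded_size ce.
apply: splice_insertion st => //.
by rewrite sze; move: ge; rewrite /gaps; have := csize_gt0 e; order.
Qed.

(** Undoes [splice]: after the first point, which belongs to [a], the other [n] points of [a] follow
    g + 1 points of [e]. *)
Fixpoint realize (c : code) ep : seq (chord N) :=
  match c, ep with
  | One, [:: p; q] => [:: (p, q)]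
  | Ins a e g, p :: ep' =>
      let n := (csize a).*2.-1 in
      realize e (take g.+1 ep' ++ drop (g.+1 + n) ep') ++
      realize a (p :: take n (drop g.+1 ep'))
  | _, _ => [::]
  end.

Lemma splice_split n g (pa pe : seq 'I_N) : size pa = n -> g < size pe ->
    let ep' := take g.+1 pe ++ pa ++ drop g.+1 pe in
  take g.+1 ep' ++ drop (g.+1 + n) ep' = pe /\ take n (drop g.+1 ep') = pa.
Proof.
move=> sza lt_g /=; have szt : size (take g.+1 pe) = g.+1 by rewrite size_takel.
rewrite take_size_cat // addnC -drop_drop drop_size_cat // drop_size_cat //.
by rewrite take_size_cat // cat_take_drop.
Qed.

Lemma coded_realize c ep s : coded c ep s -> s = realize c ep.
Proof.
elim=> // a e g pa sa pe se ca -> ce -> ge _.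
have [_ _ sza _] := coded_size ca; have [_ _ sze _] := coded_size ce.
case: pa sza {ca} => [|p pa] sza; first by have := csize_gt0 a; move: sza => /=; order.
have [||e1 e2] := @splice_split (csize a).*2.-1 g pa pe; first by rewrite -sza.
  by rewrite sze; move: ge; rewrite /gaps; order.
by rewrite [RHS]/= e1 e2.
Qed.

Lemma realize_coded c ep : valid c -> sorted (@ord_lt N) ep -> size ep = (csize c).*2 ->
  coded c ep (realize c ep).
Proof.
elim: c ep => [|a IHa e IHe g] ep /=.
  by case: ep => [|p [|q []]] //= _ /andP[pq _] _; constructor.
case/and3P=> va ve ge st szep; case: ep => [|p ep] in st szep *.
  by have := csize_gt0 a; move: szep => /=; order.
pose n := (csize a).*2.-1; pose pe := take g.+1 ep ++ drop (g.+1 + n) ep.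
pose pa := p :: take n (drop g.+1 ep).
have a_gt0 := csize_gt0 a; have e_gt0 := csize_gt0 e.
have szep' : size ep = n + (csize e).*2 by move: szep => /=; rewrite /n; order.
have szt : size (take g.+1 ep) = g.+1.
  by rewrite size_takel // szep'; move: ge; rewrite /gaps; order.
have defep : p :: ep = splice g pa pe.
  rewrite /= take_size_cat // drop_size_cat // addnC -drop_drop.
  by rewrite !cat_take_drop.
have ltg : g.+1 <= (csize e).*2 by move: ge; rewrite /gaps; order.
rewrite defep in st *; have [sta ste] := splice_sorted_sub st.
have [||e1 e2] := @splice_split n g (take n (drop g.+1 ep)) pe.
- by rewrite size_takel // size_drop szep'; order.
- by rewrite size_cat szt; order.
rewrite -/pe in e1; constructor=> //.
  apply: IHa => //; rewrite /= size_takel ?size_drop ?szep' /n; order.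
apply: IHe => //; rewrite size_cat szt size_drop szep'; order.
Qed.

Lemma coded_inj c c' ep ep' s s' : coded c ep s -> coded c' ep' s' ->
  [set x in s] = [set x in s'] -> c = c'.
Proof.
move=> co; elim: co c' ep' s' => [p q pq|a e g pa sa pe se ca IHa ce IHe ge st] c' ep' s' co' eq_s.
  have := coded_endpoints co'; rewrite -eq_s (coded_endpoints (coded_one pq)).
  move=> /(congr1 size)/=; have [_ _ -> _] := coded_size co'.
  clear co'; case: c' => //= a' e' g'; have := csize_gt0 a'; have := csize_gt0 e'; order.
have co := coded_ins ca ce ge st; have := coded_endpoints co'.
rewrite -eq_s (coded_endpoints co) => def_ep.
case: co' eq_s def_ep => [p q pq _ /(congr1 size)|a' e' g' pa' sa' pe' se' ca' ce' ge' st' eq_s eq_sp].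
  have [_ _ sza _] := coded_size ca; have [_ _ sze _] := coded_size ce.
  rewrite size_splice sza sze /=; have := csize_gt0 a; have := csize_gt0 e; order.
have [r ins _] := coded_insertion ca ce ge st; have [r' ins' _] := coded_insertion ca' ce' ge' st'.
have [|eqA eqE _] := insertion_inj ins ins'; first by rewrite -!set_cat.
have eqa := IHa _ _ _ ca' eqA; have eqe := IHe _ _ _ ce' eqE.
rewrite -(coded_endpoints ca') -eqA (coded_endpoints ca) in eq_sp.
rewrite -(coded_endpoints ce') -eqE (coded_endpoints ce) in eq_sp.
rewrite -eqa -eqe in ge' *; congr Ins.
have [_ _ sza _] := coded_size ca; have [_ _ sze _] := coded_size ce.
have [a_gt0 e_gt0] := (csize_gt0 a, csize_gt0 e).
have [p [u [pa1 def_pa]]] : exists p u pa1, pa = [:: p, u & pa1].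
  case: (pa) sza => [|p [|u pa1]]; rewrite /=; [order|order|by exists p, u, pa1].
have [_ _ sep] : [/\ True, True & uniq (splice g pa pe)].
  by split=> //; apply: (sorted_uniq (@ord_lt_trans N) (@ord_lt_irr N)).
have {}sep : u \notin pe.
  move: sep; rewrite (perm_uniq (perm_splice _ _ _)) cat_uniq => /and3P[_ /hasPn nh _].
  by apply: nh; rewrite def_pa !inE eqxx orbT.
(* The gap can be read off from the position of the second point [u] of [a], which is preceded by
   the first point of [a] and by h + 1 points of [e]. *)
have idx h : h < gaps e -> index u (splice h pa pe) = h.+2.
  move=> lt_h; rewrite def_pa /=.
  have pu : p == u = false.
    have [_ + _ _] := coded_size ca; rewrite def_pa /= => /andP[+ _].
    by rewrite /ord_lt; case: eqP => [->|//]; rewrite ltnn.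
  rewrite pu index_cat ifN; last by apply: contra sep; apply: mem_take.
  by rewrite /= eqxx addn0 size_takel // sze; move: lt_h; rewrite /gaps; order.
by have := congr1 (index u) eq_sp; rewrite !idx // => -[].
Qed.

Lemma coded_exists C : matching C -> connected C -> C != set0 ->
  exists c s, coded c (endpoint_seq C) s /\ C = [set x in s].
Proof.
have [n] := ubnP #|C|; elim: n C => // n IHn C ltn mC cC nzC.
have [C2|C1] := ltnP 1 #|C|; last first.
  have /cards1P[[p q] defC] : #|C| == 1 by rewrite eqn_leq C1 card_gt0.
  have pqC : (p, q) \in C by rewrite defC set11.
  have lt_pq := chord_lt mC pqC; exists One, [:: (p, q)].
  have defC' : C = [set x in [:: (p, q)]] by rewrite defC; apply/setP => x; rewrite !inE.
  by split=> //; rewrite {1}defC' (coded_endpoints (coded_one lt_pq)); constructor.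
have [A [E [r [ins defC]]]] := decomposition mC cC C2.
have rA := ins_root ins; have rinA := is_root_mem rA.
have [[x xE lox] [y yE hiy]] := (ins_lo ins, ins_hi ins).
have [mA mE] := (ins_mA ins, ins_mE ins).
have cardC : #|C| = #|A| + #|E| by rewrite defC (ins_card ins).
have A_gt0 : 0 < #|A| by rewrite card_gt0; apply/set0Pn; exists r.
have E_gt0 : 0 < #|E| by rewrite card_gt0; apply/set0Pn; exists x.
have [||||a [sa [ca defA]]] := IHn A; [by order|by []|exact: ins_cA ins|by rewrite -card_gt0|].
have [||||e [se [ce defE]]] := IHn E; [by order|by []|exact: ins_cE ins|by rewrite -card_gt0|].
pose pe := endpoint_seq E; pose pa := endpoint_seq A; pose b : nat := sink r.
have ste : sorted (@ord_lt N) pe by apply: endpoint_seq_sorted.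
have sta : sorted (@ord_lt N) pa by apply: endpoint_seq_sorted.
pose lo := [seq q : 'I_N <- pe | q < b]; pose hi := [seq q : 'I_N <- pe | b < q].
have neb (q : 'I_N) : q \in pe -> q != b :> nat.
  rewrite mem_endpoint_seq => /endpointsP[z zE zq]; have [] := ins_neq ins zE.
  by case: zq => ->.
have def_pe : pe = lo ++ hi.
  apply: eq_sorted_lt => // [|q].
    rewrite sorted_lt_cat; apply/and3P; split; try exact: sorted_filter (@ord_lt_trans N) _ _ ste.
    by apply/allrelP => u v; rewrite !mem_filter /ord_lt => /andP[ub _] /andP[bv _]; order.
  have qlo : (q \in lo) = (q < b) && (q \in pe) by exact: mem_filter.
  have qhi : (q \in hi) = (b < q) && (q \in pe) by exact: mem_filter.
  rewrite mem_cat qlo qhi -andb_orl -neq_ltn.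
  by apply/idP/andP => [qe|[]//]; split; first exact: neb.
have lox' : source x \in lo by rewrite mem_filter lox mem_endpoint_seq source_endpoint.
have hiy' : sink y \in hi by rewrite mem_filter hiy mem_endpoint_seq sink_endpoint.
(* The gap of [sink r] follows the last point of [lo], whose number from 0 is one less than the size
   of [lo]. *)
pose g := (size lo).-1; have szlo : g.+1 = size lo.
  by rewrite prednK //; case: (lo) lox'.
have tk : take g.+1 pe = lo by rewrite szlo def_pe take_size_cat.
have dr : drop g.+1 pe = hi by rewrite szlo def_pe drop_size_cat.
have ge : g < gaps e.
  have [_ _ sze _] := coded_size ce; have := congr1 size def_pe.
  rewrite size_cat /pe -/(endpoint_seq E) sze /gaps -szlo.
  have : 0 < size hi by case: (hi) hiy'.
  by order.
have [p [pa' def_pa]] : exists p pa', pa = p :: pa'.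
  have : source r \in pa by rewrite mem_endpoint_seq source_endpoint.
  by case: (pa) => // p pa' _; exists p, pa'.
have rp : source r = p.
  have pA : p \in endpoints A by rewrite -mem_endpoint_seq -/pa def_pa mem_head.
  have : source r \in pa by rewrite mem_endpoint_seq source_endpoint.
  rewrite def_pa in_cons => /predU1P[//|rpa].
  move: sta; rewrite def_pa /= (path_sortedE (@ord_lt_trans N)) => /andP[/allP/(_ _ rpa) lt_pr _].
  have /endpointsP[d dA pd] := pA; have := is_root_le rA dA; have := chord_lt mA dA.
  by move: lt_pr; rewrite /ord_lt; case: pd => ->; order.
have lt_p (q : 'I_N) : q \in pe -> p < q.
  rewrite mem_endpoint_seq -rp => /endpointsP[z zE zq].
  have := ins_first ins zE; have := chord_lt mE zE.
  by case: zq => ->; order.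
have side (u q : 'I_N) : u \in pa' -> q \in pe -> (q < u /\ q < b) \/ (u < q /\ b < q).
  move=> ua; rewrite mem_endpoint_seq => /endpointsP[z zE zq].
  have : u \in pa by rewrite def_pa in_cons ua orbT.
  rewrite mem_endpoint_seq => /endpointsP[d dA ud].
  have up : p < u.
    move: sta; rewrite def_pa /= (path_sortedE (@ord_lt_trans N)) => /andP[/allP/(_ _ ua) //].
  have [_ _] := ins_pair ins zE dA; rewrite /beside -/b => -[[dr' [_ [n1 n2]]]|[_ [b1 b2]]].
    case: ud => ud; first by move: up; rewrite ud dr' rp ltnn.
    by case: zq => ->; rewrite ud dr' -/b; order.
  by case: zq => ->; case: ud => ->; order.
have st : sorted (@ord_lt N) (splice g pa pe).
  rewrite def_pa /= tk dr (path_sortedE (@ord_lt_trans N)); apply/andP; split.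
    apply/allP => u; rewrite !mem_cat orbCA -mem_cat -def_pe => /orP[ua|]; last exact: lt_p.
    by move: sta; rewrite def_pa /= (path_sortedE (@ord_lt_trans N)) => /andP[/allP/(_ _ ua) //].
  rewrite !sorted_lt_cat; apply/and3P; split; last (apply/and3P; split); last first.
  - exact: sorted_filter (@ord_lt_trans N) _ _ ste.
  - by move: sta; rewrite def_pa => /path_sorted.
  - apply/allrelP => u v ua; rewrite mem_filter => /andP[bv ve].
    by case: (side u v ua ve); rewrite /ord_lt; order.
  - exact: sorted_filter (@ord_lt_trans N) _ _ ste.
  - apply/allrelP => u v; rewrite mem_cat.
    rewrite mem_filter => /andP[ub ue] /orP[va|]; rewrite /ord_lt.
      by case: (side v u va ue); order.
    by rewrite mem_filter => /andP[bv _]; order.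
exists (Ins a e g), (se ++ sa); split; last by rewrite set_cat -defA -defE.
have -> : endpoint_seq C = splice g pa pe; last by constructor.
apply: eq_sorted_lt => //; first exact: endpoint_seq_sorted.
move=> u; rewrite mem_endpoint_seq defC endpointsU (perm_mem (perm_splice _ _ _)) mem_cat.
by rewrite !mem_endpoint_seq orbC.
Qed.

End Coded.

(** * The intersection order *)

Fixpoint first_label (c : code) : nat := if c is Ins _ e _ then (first_label e).+1 else 1.

(** The labels of the terminal chords. The root takes label 1, then come the chords of [e], then the
    rest of [a]. As the root had label 1 in [a] as well, label k of [a] becomes [csize e + k]. If
    [a] is [One], its only chord is the root, which ceases to be terminal. *)
Fixpoint labels (c : code) : seq nat :=
  match c with
  | One => [:: 1]
  | Ins a e _ => [seq k.+1 | k <- labels e] ++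
      (if a is One then [::] else [seq csize e + k | k <- labels a])
  end.

Lemma labels_Ins a e g : a != One ->
  labels (Ins a e g) = [seq k.+1 | k <- labels e] ++ [seq csize e + k | k <- labels a].
Proof. by case: a. Qed.

Lemma head_labels c : head 0 (labels c) = first_label c.
Proof.
suff: labels c != [::] /\ head 0 (labels c) = first_label c by case.
by elim: c => //= a _ e [+ <-] g; case: (labels e).
Qed.

Lemma labels_nonempty c : labels c = first_label c :: behead (labels c).
Proof.
rewrite -head_labels; suff: labels c != [::] by case: (labels c).
by elim: c => //= a _ e + g; case: (labels e).
Qed.

(** The last chord in the intersection order is always terminal. Hence the jump from the labels of
    [e] to those of [a] depends on [a] alone. *)
Lemma last_labels c x : last x (labels c) = csize c.
Proof.
elim: c x => //= a IHa e IHe g x; rewrite last_cat.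
have laste : last x [seq k.+1 | k <- labels e] = (csize e).+1.
  by rewrite labels_nonempty /= last_map -(IHe 0) [in RHS]labels_nonempty.
rewrite laste; case: a IHa => [_ /=|a1 e1 g1 IHa]; first by rewrite add1n.
rewrite (labels_nonempty (Ins a1 e1 g1)) /= last_map -/(csize (Ins a1 e1 g1)).
rewrite -(IHa 0) addnC; congr addn; by rewrite [in RHS]labels_nonempty.
Qed.

Lemma size_labels c : size (labels c) <= csize c.
Proof.
elim: c => //= a IHa e IHe g; rewrite size_cat size_map.
by case: a IHa => [_|a1 e1 g1]; rewrite ?size_map /=; lia.
Qed.

Section IntersectionOrder.

Variable N : nat.
Implicit Types (x y r d : chord N) (C D A E : {set chord N}) (s : seq (chord N)).

Definition source_lt x y : bool := source x < source y.

Lemma source_lt_trans : transitive source_lt.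
Proof. by move=> y x z; apply: ltn_trans. Qed.

Lemma source_lt_irr : irreflexive source_lt.
Proof. by move=> x; apply: ltnn. Qed.

Lemma mem_standard_order D x : (x \in standard_order D) = (x \in D).
Proof. by rewrite mem_sort mem_enum. Qed.

Lemma standard_order_sorted D : matching D -> sorted source_lt (standard_order D).
Proof.
move=> mD; pose m := [seq nat_of_ord (source x) | x <- standard_order D].
suff: sorted ltn m by rewrite sorted_map.
rewrite ltn_sorted_uniq_leq map_inj_in_uniq ?sort_uniq ?enum_uniq /=.
  by rewrite sorted_map; apply: sort_sorted => x y; apply: leq_total.
move=> x y; rewrite !mem_standard_order => xD yD eq_xy; apply/eqP/negPn/negP => ne_xy.
by have [_ /(_ ne_xy)[]] := mD x y xD yD; rewrite eq_xy eqxx.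
Qed.

Lemma standard_order_eq D s : matching D -> sorted source_lt s -> s =i D -> standard_order D = s.
Proof.
move=> mD st eqs.
apply: (irr_sorted_eq source_lt_trans source_lt_irr) (standard_order_sorted mD) st _.
by move=> x; rewrite eqs mem_standard_order.
Qed.

Lemma standard_order_cons D r : matching D -> is_root D r ->
  standard_order D = r :: standard_order (D :\ r).
Proof.
move=> mD rD; have rinD := is_root_mem rD.
have mDr : matching (D :\ r) by apply: matchingS mD; apply: subD1set.
apply: standard_order_eq => // [|x].
  rewrite /= (path_sortedE source_lt_trans) standard_order_sorted // andbT.
  apply/allP => x; rewrite mem_standard_order => /setD1P[xr xD]; exact: is_root_lt mD rD xD xr.
by rewrite in_cons mem_standard_order in_setD1; have [->|] := eqVneq x r.
Qed.

Lemma components_sub D X : X \in components D -> X \subset D.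
Proof. by case/mapP=> x _ ->; apply: component_sub. Qed.

Lemma intersection_order_fuel k l D : #|D| <= k -> #|D| <= l ->
  intersection_order_rec k D = intersection_order_rec l D.
Proof.
have nil D0 : #|D0| <= 0 -> standard_order D0 = [::].
  rewrite leqn0 cards_eq0 => /eqP->; apply/eqP; rewrite -size_eq0 size_sort -cardE.
  by rewrite cards0.
elim: k l D => [|k IHk] [|l] D //= Dk Dl; [by rewrite nil|by rewrite nil|].
have := mem_standard_order D; case: (standard_order D) => // r s memD.
congr (_ :: flatten _); apply/eq_in_map => X /components_sub/subset_leq_card.
have rD : r \in D by rewrite -memD mem_head.
move: Dk Dl; rewrite (cardsD1 r D) rD !add1n !ltnS => Dk Dl le_X.
by apply: IHk; apply: leq_trans le_X _.
Qed.

Lemma intersection_order_cons D r : matching D -> is_root D r ->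
  intersection_order D =
    r :: flatten [seq intersection_order X | X <- components (D :\ r)].
Proof.
move=> mD rD; have rinD := is_root_mem rD.
rewrite {1}/intersection_order (cardsD1 r D) rinD /= (standard_order_cons mD rD).
congr (_ :: flatten _); apply/eq_in_map => X /components_sub/subset_leq_card le_X.
exact: intersection_order_fuel.
Qed.

Section Ins.

Variables (A E : {set chord N}) (r : chord N).
Hypothesis insAE : insertion A E r.

Let mA := ins_mA insAE.
Let mE := ins_mE insAE.
Let rA := ins_root insAE.
Let rinA := is_root_mem rA.

(** Without r nothing joins [E] to [A], and [E] comes first because its root has the first remaining
    source. *)
Lemma ins_components : components ((A :|: E) :\ r) = E :: components (A :\ r).
Proof.
have nzE : E != set0 by case: (ins_lo insAE) => x xE _; apply/set0Pn; exists x.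
have [s sE] := root_exists nzE; have sinE := is_root_mem sE.
have sF := ins_remove_root insAE sE; set F := _ :\ r in sF *.
have mF : matching F by apply: matchingS (ins_matching insAE); apply: subD1set.
have mAr : matching (A :\ r) by apply: matchingS mA; apply: subD1set.
have mFs : matching (F :\ s) by apply: matchingS mF; apply: subD1set.
have compE x : x \in E -> component F x = E by apply: ins_component_E.
have compA x : x \in A :\ r -> component F x = component (A :\ r) x.
  exact: ins_component_A.
rewrite /components (standard_order_cons mF sF) /= compE // sE /= compE //.
congr (_ :: _); rewrite (_ : filter _ _ =
    [seq c <- standard_order (A :\ r) | is_root (component (A :\ r) c) c]).
  apply/eq_in_map => x; rewrite mem_filter mem_standard_order => /andP[_ xA].
  exact: compA.
apply: (irr_sorted_eq source_lt_trans source_lt_irr).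
- exact/(sorted_filter source_lt_trans)/standard_order_sorted.
- exact/(sorted_filter source_lt_trans)/standard_order_sorted.
move=> x; rewrite !mem_filter !mem_standard_order [x \in F :\ s]in_setD1.
have defF : x \in F = (x \in A :\ r) || (x \in E) by rewrite /F (ins_remove insAE) in_setU.
rewrite defF; have [xA|xA] := boolP (x \in A :\ r).
  rewrite compA //= !andbT; suff -> : x != s by rewrite andbT.
  by apply: contraTneq xA => ->; rewrite in_setD1 negb_and (ins_notin insAE sinE) orbT.
rewrite andbF /=; have [xE|] := boolP (x \in E); last by rewrite !andbF.
rewrite compE // andbT; apply/andP => -[xrE]; apply/negP/negPn/eqP.
exact: root_uniq mE xrE sE.
Qed.

Lemma ins_intersection_order : intersection_order (A :|: E) =
  r :: intersection_order E ++ behead (intersection_order A).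
Proof.
rewrite (intersection_order_cons (ins_matching insAE) (ins_is_root insAE)).
by rewrite ins_components (intersection_order_cons mA rA).
Qed.

Lemma ins_terminal_root : ~~ terminal (A :|: E) r.
Proof.
have [x xE xr] := ins_crossing insAE; apply/negP => /forall_inP/(_ x).
by rewrite in_setU xE orbT (ins_cross_AE insAE) // eqxx xr => /(_ isT).
Qed.

Lemma ins_terminal_E x : x \in E -> terminal (A :|: E) x = terminal E x.
Proof.
move=> xE; apply/forall_inP/forall_inP => tx y; first by move=> yE; rewrite tx // in_setU yE orbT.
by rewrite in_setU => /orP[yA|/tx//]; rewrite (ins_cross_EA insAE).
Qed.

Lemma ins_terminal_A x : x \in A -> x != r -> terminal (A :|: E) x = terminal A x.
Proof.
move=> xA xr; apply/forall_inP/forall_inP => tx y; first by move=> yA; rewrite tx // in_setU yA.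
by rewrite in_setU => /orP[/tx//|yE]; rewrite (ins_cross_AE insAE) // (negPf xr).
Qed.

End Ins.

Lemma coded_uniq c ep s : coded c ep s -> uniq s.
Proof.
elim=> // a e g pa sa pe se ca uA ce uE ge st; rewrite cat_uniq uA uE andbT /=.
have [r ins _] := coded_insertion ca ce ge st; apply/hasPn => x xA.
by apply/negP => xE; have := @ins_notin _ _ _ _ ins x; rewrite !inE xE xA => /(_ isT).
Qed.

Lemma perm_intersection_order c ep s : coded c ep s ->
  perm_eq (intersection_order [set x in s]) s.
Proof.
elim=> [p q pq|a e g pa sa pe se ca IHa ce IHe ge st].
  have [mC _ nzC _] := coded_diagram (coded_one pq).
  have [r rC] := root_exists nzC; rewrite (intersection_order_cons mC rC).
  have : r \in [set x in [:: (p, q)]] by apply: is_root_mem rC.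
  rewrite !inE => /eqP->; rewrite (_ : _ :\ _ = set0).
    rewrite /components (_ : standard_order set0 = [::]) //.
    by apply/eqP; rewrite -size_eq0 size_sort -cardE cards0.
  by apply/setP => x; rewrite !inE; case: eqP.
have [r ins _] := coded_insertion ca ce ge st.
rewrite set_cat (ins_intersection_order ins).
have := IHa; rewrite (intersection_order_cons (ins_mA ins) (ins_root ins)) /= => pa_r.
rewrite -cat_cons -cat1s -catA perm_catCA /=.
by apply: perm_cat.
Qed.

Lemma coded_labels c ep s : coded c ep s -> terminal_labels [set x in s] = labels c.
Proof.
elim=> [p q pq|a e g pa sa pe se ca IHa ce IHe ge st].
  rewrite /terminal_labels.
  have /perm_small_eq-> // := perm_intersection_order (coded_one pq).
  have tpq : terminal [set x in [:: (p, q)]] (p, q).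
    by apply/forall_inP => x; rewrite !inE => /eqP->; rewrite /right_neighbor ltnn.
  by rewrite /= tpq /= eqxx.
have [r ins _] := coded_insertion ca ce ge st.
have [mA rA] := (ins_mA ins, ins_root ins); have rinA := is_root_mem rA.
have [perm_a perm_e] := (perm_intersection_order ca, perm_intersection_order ce).
have mem_a : intersection_order [set x in sa] =i [set x in sa].
  by move=> x; rewrite (perm_mem perm_a) inE.
have mem_e : intersection_order [set x in se] =i [set x in se].
  by move=> x; rewrite (perm_mem perm_e) inE.
have size_e : size (intersection_order [set x in se]) = csize e.
  by rewrite (perm_size perm_e); case: (coded_size ce).
have uniq_a : uniq (intersection_order [set x in sa]).
  by rewrite (perm_uniq perm_a) (coded_uniq ca).
rewrite /labels -/labels -IHe -/(labels a) /terminal_labels set_cat (ins_intersection_order ins).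
move: IHa mem_a uniq_a; rewrite /terminal_labels.
rewrite (intersection_order_cons mA rA) /behead; set io_a := flatten _ => IHa mem_a /andP[r_a _].
set io_e := intersection_order [set x in se] in mem_e size_e *.
have ne_r x : x \in io_e -> r == x = false.
  by rewrite mem_e eq_sym => xE; apply/negbTE/(ins_ne ins).
rewrite /= (negPf (ins_terminal_root ins)) filter_cat map_cat; congr cat.
  rewrite -map_comp (eq_in_filter (a2 := terminal [set x in se])) => [|x]; last first.
    by rewrite mem_e => xE; rewrite (ins_terminal_E ins).
  apply/eq_in_map => x; rewrite mem_filter => /andP[_ xE].
  by rewrite /= ne_r // index_cat xE.
rewrite (eq_in_filter (a2 := terminal [set x in sa])) => [|x xa]; last first.
  rewrite (ins_terminal_A ins) // -?mem_a ?in_cons ?xa ?orbT //.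
  by apply: contraTneq xa => ->.
have [_ _ _ size_a] := coded_size ca.
have size_io : size (r :: io_a) = csize a.
  rewrite -size_a -(perm_size perm_a) (intersection_order_cons mA rA) //.
case: a ca IHa size_a size_io {perm_a ge st} => [|a1 e1 g1] ca IHa size_a size_io.
  by move: size_io; case: (io_a).
rewrite -/(labels _) -IHa /=.
(* With a second chord in [A], the root has a right neighbor there, so no terminal chord is lost by
   the insertion. *)
have -> : terminal [set x in sa] r = false.
  apply/negbTE/negP => /forall_inP tr.
  have [x xio] : exists x, x \in io_a.
    move: size_io; case: (io_a) => [|x io] /=; last by exists x; rewrite mem_head.
    by have := csize_gt0 a1; have := csize_gt0 e1; order.
  have xA : x \in [set x in sa] by rewrite -mem_a in_cons xio orbT.
  have xr : x != r by apply: contraTneq xio => ->.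
  have [y yA ry] := root_neighbor mA (ins_cA ins) rA xA xr.
  by have := tr y yA; rewrite ry.
rewrite -map_comp; apply/eq_in_map => x; rewrite mem_filter => /andP[_ xa] /=.
have xr : r == x = false by apply/negbTE; apply: contraTneq xa => <-.
have xE : x \in io_e = false.
  apply/negbTE; rewrite mem_e; apply/negP => /(ins_notin ins).
  by rewrite -mem_a in_cons xa orbT.
by rewrite xr index_cat xE size_e !addnS.
Qed.

Lemma coded_t1 c ep s : coded c ep s -> t 1 [set x in s] = first_label c.
Proof. by move=> co; rewrite /t (coded_labels co) labels_nonempty. Qed.

End IntersectionOrder.

(** * The weight f_C as a recursive function *)

Section WeightF.

Local Open Scope ring_scope.
Import GRing.Theory.

Variables (K : fieldType) (f : nat -> K).

(** The jump from the last label of [e] to the first one of [a] is csize e + t_1(a) - (csize e + 1)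
    = t_1(a) - 1. If [a] is [One] there is no jump, and the factor [f 0] stands for the root, which
    has become non-terminal. *)
Fixpoint code_weight_f (c : code) : K :=
  if c is Ins a e _ then f (first_label a - 1) * code_weight_f a * code_weight_f e else 1.

Definition label_gaps (x : nat) (l : seq nat) : K :=
  \prod_(d <- pairmap (fun x y => y - x)%N x l) f d.

Lemma label_gaps_cat x l1 l2 :
  label_gaps x (l1 ++ l2) = label_gaps x l1 * label_gaps (last x l1) l2.
Proof. by rewrite /label_gaps pairmap_cat big_cat. Qed.

Lemma label_gaps_cons x y l : label_gaps x (y :: l) = f (y - x)%N * label_gaps y l.
Proof. by rewrite /label_gaps /= big_cons. Qed.

Lemma code_weight_fE c : f 0%N ^+ (csize c - size (labels c)) *
  label_gaps (first_label c) (behead (labels c)) = code_weight_f c.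
Proof.
elim: c => [|a IHa e IHe g]; first by rewrite /label_gaps big_nil expr0 mulr1.
have pm_map (h : nat -> nat) x l : (forall u v, h u - h v = u - v)%N ->
    pairmap (fun x y => y - x)%N (h x) (map h l) = pairmap (fun x y => y - x)%N x l.
  by move=> hh; elim: l x => //= y l IHl x; rewrite hh IHl.
have [sa se] := (size_labels a, size_labels e).
have last_e : last (first_label e) (behead (labels e)) = csize e.
  by rewrite -(last_labels e 0) [in RHS]labels_nonempty.
have gapsS x l : label_gaps x.+1 [seq k.+1 | k <- l] = label_gaps x l.
  by rewrite /label_gaps (pm_map S).
have gapsD n x l : label_gaps (n + x) [seq n + k | k <- l]%N = label_gaps x l.
  by rewrite /label_gaps (pm_map (addn n)) // => u v; rewrite subnDl.
have [->|aO] := eqVneq a One.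
  rewrite /= -IHe cats0 {2}(labels_nonempty e) /= gapsS size_map subnn mulr1.
  by rewrite add1n subSn // exprS mulrA.
rewrite labels_Ins // size_cat !size_map {2}(labels_nonempty e) {2}(labels_nonempty a) /=.
rewrite -IHa -IHe label_gaps_cat label_gaps_cons gapsS gapsD last_map last_e.
have -> : (csize a + csize e - (size (labels e) + size (labels a)) =
    (csize a - size (labels a)) + (csize e - size (labels e)))%N by lia.
have -> : (csize e + first_label a - (csize e).+1 = first_label a - 1)%N by lia.
rewrite exprD; move: (f 0%N ^+ _) (f 0%N ^+ _) => u v.
move: (label_gaps _ _) (label_gaps _ _) (f _) => w w' w''.
by ring.
Qed.

Lemma coded_weight_f N c ep (s : seq (chord N)) : coded c ep s ->
  weight_f f [set x in s] = code_weight_f c.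
Proof.
move=> co; rewrite -code_weight_fE /weight_f /num_terminal /t (coded_labels co).
have [_ _ _ szs] := coded_size co.
rewrite cardsE (card_uniqP (coded_uniq co)) szs; congr (_ * _).
rewrite big_add1 big_add1 /= /label_gaps [RHS](big_nth 0%N) size_pairmap.
rewrite {1}labels_nonempty /= [in RHS]big_nat_cond [in LHS]big_nat_cond.
apply: eq_bigr => i; rewrite andbT => /andP[_ lti].
by rewrite (nth_pairmap 0%N) // (labels_nonempty c).
Qed.

End WeightF.

(** * Gaps *)

(* The top chord of each inner gap, from left to right; chords are numbered by
   their index in realize. *)
Fixpoint gap_tops (c : code) : seq nat :=
  if c is Ins a e g then
    let ta := [seq csize e + k | k <- gap_tops a] in
    head 0 ta :: take g.+1 (gap_tops e) ++ behead ta ++ drop g (gap_tops e)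
  else [:: 0].

Fixpoint valences (c : code) : seq nat :=
  if c is Ins a e g then
    incr_nth (valences e) (nth 0 (gap_tops e) g) ++ valences a
  else [:: 0].

(* The gaps in which an insertion creates no top cycle. *)
Fixpoint active (c : code) : seq bool :=
  if c is Ins a e g then
    true :: nseq g.+1 false ++ behead (active a) ++ drop g (active e)
  else [:: true].

Fixpoint cycle_free (c : code) : bool :=
  if c is Ins a e g then [&& cycle_free a, cycle_free e & nth false (active e) g] else true.

Lemma gaps_gt0 c : 0 < gaps c.
Proof. by have := csize_gt0 c; rewrite /gaps; lia. Qed.

Lemma size_gap_tops c : valid c -> size (gap_tops c) = gaps c.
Proof.
elim: c => //= a IHa e IHe g /and3P[/IHa{IHa}IHa /IHe{IHe}IHe ge].
have [ca ce] := (csize_gt0 a, csize_gt0 e).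
rewrite !size_cat size_behead size_map size_drop size_takel ?IHa ?IHe //.
by rewrite /gaps /= in ge *; lia.
Qed.

Lemma size_active c : valid c -> size (active c) = gaps c.
Proof.
elim: c => //= a IHa e IHe g /and3P[/IHa{IHa}IHa /IHe{IHe}IHe ge].
have [ca ce] := (csize_gt0 a, csize_gt0 e).
rewrite !size_cat size_behead size_drop size_nseq IHa IHe.
by rewrite /gaps /= in ge *; lia.
Qed.

Lemma gap_tops_lt c : valid c -> all (fun k => k < csize c) (gap_tops c).
Proof.
elim: c => //= a IHa e IHe g /and3P[va ve ge].
have sza := size_gap_tops va; have := gaps_gt0 a; rewrite -sza.
have := IHa va; case: (gap_tops a) => //= k ta /andP[lt_k all_a] _.
rewrite addnC ltn_add2r lt_k /= !all_cat all_map; apply/and3P; split.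
- by apply/allP => j /mem_take/(allP (IHe ve)); lia.
- by apply: sub_all all_a => j /=; lia.
- by apply/allP => j /mem_drop/(allP (IHe ve)); lia.
Qed.

Lemma nth_gap_tops c i : valid c -> i < gaps c -> nth 0 (gap_tops c) i < csize c.
Proof.
move=> vc lti; apply: (allP (gap_tops_lt vc)); apply: mem_nth.
by rewrite size_gap_tops.
Qed.

Lemma size_valences c : valid c -> size (valences c) = csize c.
Proof.
elim: c => //= a IHa e IHe g /and3P[va ve ge].
by rewrite size_cat size_incr_nth IHa // IHe // nth_gap_tops // addnC.
Qed.

(** The points of [a] split gap [g] of [e], so its top chord occurs once more, in step with
    [incr_nth]; the tops of [a] keep their multiplicities. *)
Lemma count_gap_tops c i : valid c -> i < csize c ->
  count_mem i (gap_tops c) = (nth 0 (valences c) i).+1.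
Proof.
elim: c i => [[]|a IHa e IHe g] //= i /and3P[va ve ge] lti.
have szv := size_valences ve; have szt := size_gap_tops ve; have sza := size_gap_tops va.
set k := nth 0 _ g; have lt_k : k < csize e by apply: nth_gap_tops.
have szi : size (incr_nth (valences e) k) = csize e by rewrite size_incr_nth szv lt_k.
have -> : (head 0 [seq csize e + k | k <- gap_tops a] == i) +
    count_mem i (take g.+1 (gap_tops e) ++
       behead [seq csize e + k | k <- gap_tops a] ++ drop g (gap_tops e)) =
    count_mem i [seq csize e + k | k <- gap_tops a] +
      (count_mem i (gap_tops e) + (k == i)).
  rewrite !count_cat -[in RHS](cat_take_drop g (gap_tops e)) count_cat.
  rewrite (take_nth 0) ?szt // -cats1 count_cat /= -/k.
  case: (gap_tops a) sza (gaps_gt0 a) => [<- //|j ta _ _] /=; lia.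
rewrite count_map nth_cat szi; have [lt_ie|le_ei] := ltnP i (csize e).
  rewrite (IHe i) // nth_incr_nth (_ : count _ _ = 0); first by rewrite add0n addSn addnC.
  by apply/eqP; rewrite -leqn0 leqNgt -has_count; apply/hasPn => j _ /=; lia.
have -> : count (preim (addn (csize e)) (pred1 i)) (gap_tops a) =
    count_mem (i - csize e) (gap_tops a).
  by apply: eq_count => j; rewrite /preim /=; apply/eqP/eqP; order.
rewrite IHa //; last by lia.
have -> : (k == i) = false by apply: contraTF lt_k => /eqP->; rewrite -leqNgt.
suff -> : count_mem i (gap_tops e) = 0 by rewrite !addn0.
by apply/eqP; rewrite -leqn0 leqNgt -has_count; apply/hasPn => j /(allP (gap_tops_lt ve)) /=; lia.
Qed.

(** The common shape of [gap_tops] and [active] for an insertion, where [l] describes the gaps of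
    [e] up to [g]. Gap [g] is taken up again after the last endpoint of [a], whence [drop g] and the
    condition on [last x0 pa]. *)
Lemma splice_gaps (S T : Type) (P : S -> T -> Prop) x0 y0 g pa pe la l le :
    size pa = (size la).+1 -> size pe = (size le).+1 -> g < size le -> size l = g.+1 ->
    0 < size la ->
    P (nth x0 pa 0) (nth y0 la 0) ->
    (forall i, i <= g -> P (nth x0 pe i) (nth y0 l i)) ->
    (forall i, 0 < i < size la -> P (nth x0 pa i) (nth y0 la i)) ->
    P (last x0 pa) (nth y0 le g) ->
    (forall i, g < i < size le -> P (nth x0 pe i) (nth y0 le i)) ->
  forall i, i < size la + size le + 1 ->
    P (nth x0 (splice g pa pe) i) (nth y0 (head y0 la :: l ++ behead la ++ drop g le) i).
Proof.
case: pa la => [|p pa] [|y la] //= [sza] sze lt_g szl _ P0 Pl Pa Plast Pr [|i] //= lti.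
rewrite !nth_cat szl size_takel ?sze; last by lia.
have [lt_ig|le_gi] := ltnP i g.+1; first by rewrite nth_take //; apply: Pl.
set j := i - g.+1; rewrite sza; have defi : i = j + g.+1 by rewrite subnK.
have [lt_j|le_j] := ltnP j (size la).
  by rewrite ltnS ltnW //; apply: (Pa j.+1).
have [|lt_laj] := leqP j.+1 (size la).+1.
  rewrite ltnS => le_j'; have -> : j = size la by lia.
  have szla : size la = (size pa).-1 by rewrite sza.
  rewrite subnn nth_drop addn0 szla nth_last.
  by case: (pa) sza Plast.
rewrite !nth_drop.
have -> : g.+1 + (j - (size la).+1) = g + (j - size la) by lia.
by apply: Pr; move: lti; lia.
Qed.

(** * Top chords and admissible gaps under insertion *)

Section Tops.

Variable N : nat.
Implicit Types (x y z r d e : chord N) (C D A E : {set chord N}) (s : seq (chord N)).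

Lemma top_chord_uniq C q x y : matching C -> top_chord C q x -> top_chord C q y -> x = y.
Proof.
move=> mC /top_chordP[xC xq ux] /top_chordP[yC yq uy]; apply/eqP/negPn/negP => ne_xy.
have [_ /(_ ne_xy)[n _ _ _]] := mC x y xC yC.
have := ux y yC; have := uy x xC; rewrite xq yq.
by case: ltngtP n => // _ _ => [/(_ isT)|_ /(_ isT)].
Qed.

(** Letting [q'] range over the N points loses nothing: a top chord covers [q'], which is then
    smaller than a sink. *)
Definition allowed C (q : nat) : bool :=
  [forall z in C, covers z q ==> [exists q' : 'I_N, (q <= q') && top_chord C q' z]].

Lemma allowedP C q :
  reflect (forall z, z \in C -> covers z q -> exists2 q', q <= q' & top_chord C q' z)
          (allowed C q).
Proof.
apply: (iffP forall_inP) => alw z zC.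
  by move=> zq; have /implyP/(_ zq)/existsP[q' /andP[]] := alw z zC; exists q'.
apply/implyP => /(alw z zC)[q' le_qq' top]; apply/existsP.
have /top_chordP[_ /andP[_ lt_q'] _] := top.
by exists (Ordinal (ltn_trans lt_q' (ltn_ord _))); rewrite le_qq'.
Qed.

Section Ins.

Variables (A E : {set chord N}) (r : chord N).
Hypothesis insAE : insertion A E r.

Let mA := ins_mA insAE.
Let mE := ins_mE insAE.
Let rA := ins_root insAE.
Let rinA := is_root_mem rA.
Let b : nat := sink r.

(* The points that lie in the same gap of E as the sink of r. *)
Definition in_block (q : nat) : Prop := forall x, x \in E ->
  ((source x < q /\ source x < b) \/ (q < source x /\ b < source x)) /\
  ((sink x < q /\ sink x < b) \/ (q < sink x /\ b < sink x)).

Lemma in_block_sink d : d \in A -> in_block (sink d).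
Proof.
move=> dA x xE; have [_ _] := ins_pair insAE xE dA.
by rewrite /beside -/b => -[[-> [_ []]]|[_ []]]; rewrite -/b; order.
Qed.

Lemma in_block_source d : d \in A -> d != r -> in_block (source d).
Proof.
move=> dA dr x xE; have [_ _ [[dr' _]|[_ []]]] := ins_pair insAE xE dA.
  by rewrite dr' eqxx in dr.
by rewrite /beside -/b; order.
Qed.

Lemma in_block_covers q x : in_block q -> x \in E -> covers x q = covers x b.
Proof. by move=> qb xE; have [] := qb x xE; rewrite /covers; order. Qed.

Lemma in_block_top q x : in_block q -> top_chord E q x = top_chord E b x.
Proof.
move=> qb; apply/top_chordP/top_chordP => -[xE xq ux]; split=> //.
- by rewrite -(in_block_covers qb xE).
- by move=> e eE; rewrite -(in_block_covers qb eE); apply: ux.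
- by rewrite (in_block_covers qb xE).
- by move=> e eE; rewrite (in_block_covers qb eE); apply: ux.
Qed.

Lemma ins_top_source : top_chord (A :|: E) (source r) r.
Proof.
apply/top_chordP; split; first by rewrite in_setU rinA.
  by rewrite /covers leqnn (chord_lt mA rinA).
by move=> e _ re; rewrite /covers leqNgt re.
Qed.

Lemma top_chordU q x : x \in A -> top_chord (A :|: E) q x -> top_chord A q x.
Proof.
move=> xA /top_chordP[_ xq ux]; apply/top_chordP; split=> // e eA.
by apply: ux; rewrite in_setU eA.
Qed.

Lemma ins_top_A q x : x != r -> top_chord A q x -> top_chord (A :|: E) q x.
Proof.
move=> xr /top_chordP[xA xq ux]; apply/top_chordP; split=> // [|e]; first by rewrite in_setU xA.
rewrite in_setU => /orP[|eE xe]; first exact: ux.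
have [_ _ [[xr' _]|[_ []]]] := ins_pair insAE eE xA; first by rewrite xr' eqxx in xr.
by move: xq; rewrite /beside /covers; order.
Qed.

(** By [root_cover], from the second endpoint of [A] on, every gap below the root also lies below a
    chord of [A] that starts later. *)
Lemma root_not_top (q : 'I_N) (q' : nat) :
  q \in endpoints A -> q != source r -> q <= q' -> ~~ top_chord A q' r.
Proof.
move=> /endpointsP[d dA dq] qr le_q; apply/negP => /top_chordP[_ /andP[_ q'r] ur].
have dr : d != r.
  apply: contraNneq qr => dr; case: dq => dq; first by rewrite dq dr.
  by move: le_q; rewrite dq dr leqNgt q'r.
have [y yA ry] := root_neighbor mA (ins_cA insAE) rA dA dr.
have yr : y != r by apply: contraTneq ry => ->; rewrite /right_neighbor ltnn.
have [||e [eA er eq]] := root_cover (q := q') mA (ins_cA insAE) rA dA dr yA yr.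
- by have := chord_lt mA dA; move: le_q; case: dq => ->; order.
- by move: ry; rewrite /right_neighbor; order.
by have := ur e eA (is_root_lt mA rA eA er); rewrite eq.
Qed.

Lemma ins_top_E (q : nat) x : top_chord E q x ->
  (forall d, d \in A -> d != r -> ~~ covers d q) -> top_chord (A :|: E) q x.
Proof.
case/top_chordP=> xE xq ux nA; apply/top_chordP; split=> // [|e]; first by rewrite in_setU xE orbT.
rewrite in_setU => /orP[eA xe|]; last exact: ux.
by apply: nA => //; apply: contraTneq xe => ->; rewrite -leqNgt; exact/ltnW/(ins_first insAE).
Qed.

Lemma endpoint_uncovered (q : 'I_N) d :
  q \in endpoints E -> d \in A -> d != r -> ~~ covers d q.
Proof.
case/endpointsP=> x xE xq dA dr; have [lx ld [[dr' _]|[_ []]]] := ins_pair insAE xE dA.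
  by rewrite dr' eqxx in dr.
by rewrite /beside /covers; case: xq => ->; order.
Qed.

Lemma allowed_source : allowed (A :|: E) (source r).
Proof.
apply/allowedP => z; rewrite in_setU => /orP[zA|zE] /andP[zr _]; last first.
  by have := ins_first insAE zE; rewrite ltnNge zr.
have [->|ne_zr] := eqVneq z r; first by exists (source r); [|apply: ins_top_source].
by have := is_root_lt mA rA zA ne_zr; rewrite ltnNge zr.
Qed.

(** The root covers such a gap, but from there to its sink some chord of [E], starting later, is
    always above: the root is never the top chord again. *)
Lemma allowed_left (q : 'I_N) : q \in endpoints E -> q < b -> ~~ allowed (A :|: E) q.
Proof.
move=> qE qb; have /endpointsP[x xE xq] := qE.
have lt_x := chord_lt mE xE; have lt_rx := ins_first insAE xE.
apply/negP => /allowedP/(_ r).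
rewrite in_setU rinA /covers qb andbT => /(_ isT)[|q' le_qq' /top_chordP[_ /andP[_ q'r] ur]].
  by case: xq => ->; order.
have [y yE hiy] := ins_hi insAE.
have [||e eE eq'] := connected_cover (q := q') (ins_cE insAE) xE yE.
- by move: le_qq'; case: xq => ->; order.
- exact: ltn_trans hiy.
by have := ur e; rewrite in_setU eE orbT eq' => /(_ isT (ins_first insAE eE)).
Qed.

Lemma uncovered_right (q : 'I_N) (q' : nat) d :
  q \in endpoints E -> b < q -> q <= q' -> d \in A -> ~~ covers d q'.
Proof.
move=> /endpointsP[x xE xq] bq qq' dA; have := in_block_sink dA xE; rewrite /covers.
by case: xq bq qq' => ->; order.
Qed.

Lemma allowed_right (q : 'I_N) :
  q \in endpoints E -> b < q -> allowed (A :|: E) q = allowed E q.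
Proof.
move=> qE bq; apply/allowedP/allowedP => alw z; last first.
  rewrite in_setU => /orP[zA|zE] zq; first by case/negP: (uncovered_right qE bq (leqnn q) zA).
  have [q' le_q top] := alw z zE zq; exists q' => //; apply: ins_top_E top _ => d dA _.
  exact: (uncovered_right qE bq le_q dA).
move=> zE zq; have [|q' le_q /top_chordP[_ zq' uz]] := alw z _ zq; first by rewrite in_setU zE orbT.
by exists q' => //; apply/top_chordP; split=> // e eE; apply: uz; rewrite in_setU eE orbT.
Qed.

(** The witness for z in [E] still serves if it lies at or beyond the last sink of [A]. Otherwise it
    lies in the same gap of [E] as that sink and is moved there, where no chord of [A] covers. *)
Lemma allowed_block_E m q z : m \in A -> (forall e, e \in A -> sink e <= sink m) ->
    allowed E b -> in_block q -> q <= sink m -> z \in E -> covers z q ->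
  exists2 q', q <= q' & top_chord (A :|: E) q' z.
Proof.
move=> mA_ mmax /allowedP alw qb le_qm zE.
rewrite (in_block_covers qb zE) => /(alw z zE)[q' le_bq' top].
have outA (q'' : nat) d : sink m <= q'' -> d \in A -> d != r -> ~~ covers d q''.
  by move=> le_m dA _; have := mmax d dA; rewrite /covers; order.
have [le_m|lt_m] := leqP (sink m) q'.
  by exists q'; [apply: leq_trans le_m|apply: ins_top_E top _ => d; apply: outA].
exists (sink m) => //; apply: ins_top_E => [|d]; last exact: outA.
have mb := in_block_sink mA_; rewrite (in_block_top z mb).
suff eq_cov e : e \in E -> covers e q' = covers e b.
  case/top_chordP: top => _ zq' uz; apply/top_chordP; rewrite -eq_cov //; split=> // e eE.
  by rewrite -eq_cov //; apply: uz.
by move=> eE; have := mb e eE; rewrite /covers; order.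
Qed.

Lemma allowed_block (q : 'I_N) : allowed E b -> q \in endpoints A -> q != source r ->
  allowed (A :|: E) q = allowed A q.
Proof.
move=> alwE qA qr; have nzA : A != set0 by apply/set0Pn; exists r.
have [m mA_ mmax] := max_sink nzA; have /endpointsP[d dA dq] := qA.
have qb : in_block q.
  case: dq qr => -> qr; last exact: in_block_sink.
  by apply: in_block_source => //; apply: contraNneq qr => ->.
have le_qm : q <= sink m.
  by have := chord_lt mA dA; have := mmax d dA; case: dq => ->; order.
apply/allowedP/allowedP => alw z.
  move=> zA zq; have [|q' le_q top] := alw z _ zq; first by rewrite in_setU zA.
  by exists q' => //; apply: top_chordU top.
rewrite in_setU => /orP[zA zq|zE]; last exact: (allowed_block_E mA_ mmax alwE qb).
have [q' le_q top] := alw z zA zq; exists q' => //; apply: (ins_top_A _ top).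
by apply: contraTneq (top) => ->; apply: root_not_top le_q.
Qed.

Lemma allowed_last (q : 'I_N) : allowed E b -> q \in endpoints A -> q != source r ->
  (forall d, d \in A -> sink d <= q) -> allowed (A :|: E) q.
Proof.
move=> alwE qA qr le_q; rewrite allowed_block //; apply/allowedP => z zA.
by rewrite /covers ltnNge le_q ?andbF.
Qed.

End Ins.

Section Gap.

Variables (E : {set chord N}) (p b : nat).
Hypotheses (le_pb : p <= b).
Hypothesis gap_pb : forall u : 'I_N, u \in endpoints E -> (u <= p) = (u <= b).

Lemma gap_covers (q : nat) x : x \in E -> p <= q -> q <= b -> covers x q = covers x b.
Proof.
move=> xE pq qb; have := gap_pb (source_endpoint xE); have := gap_pb (sink_endpoint xE).
by rewrite /covers; order.
Qed.

Lemma gap_top (q : nat) x : p <= q -> q <= b -> top_chord E q x = top_chord E b x.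
Proof.
move=> pq qb; have cov y (yE : y \in E) := gap_covers yE pq qb.
apply/top_chordP/top_chordP => -[xE xq ux]; split=> //.
- by rewrite -cov.
- by move=> e eE; rewrite -cov //; apply: ux.
- by rewrite cov.
- by move=> e eE; rewrite cov //; apply: ux.
Qed.

(** In the inductions a gap of [E] is named by the endpoint before it, in the geometric lemmas by
    the sink of the root of [A]; this passes from one to the other. *)
Lemma gap_allowed : allowed E p = allowed E b.
Proof.
apply/allowedP/allowedP => alw z zE; rewrite -?(gap_covers zE (leqnn p) le_pb) => zq.
  have [q' le_q top] := alw z zE zq; have [le_b|lt_b] := leqP b q'; first by exists q'.
  by exists b => //; rewrite -(@gap_top q') // ltnW.
rewrite (gap_covers zE (leqnn p) le_pb) in zq.
by have [q' le_q top] := alw z zE zq; exists q' => //; apply: leq_trans le_q.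
Qed.

End Gap.

Lemma splice_nth g p pa pe : sorted (@ord_lt N) (splice g (p :: pa) pe) ->
  forall p0 i (u : 'I_N), u \in pa -> i < size pe ->
    nth p0 pe i != u /\ (nth p0 pe i < u) = (i <= g).
Proof.
move=> st p0 i u ua lti; have [_ _ sep] := spliceP st.
have [_ ste] := splice_sorted_sub st.
have := sep u _ ua (mem_nth p0 lti); have := nth_drop g.+1 p0 pe (i - g.+1).
have := nth_take p0 (n0 := g.+1) (i := i)^~ pe.
move: ste; rewrite -{1}(cat_take_drop g.+1 pe) sorted_lt_cat => /and3P[/allrelP sepE _ _] tk dr.
have [le_ig|lt_gi] := leqP i g.
  have in_t : nth p0 pe i \in take g.+1 pe.
    by rewrite -(tk _) // mem_nth // size_take; case: ifP => //; order.
  rewrite in_t => /orP[/= lt_u|/andP[in_d _]]; first by rewrite lt_u -val_eqE /=; split; order.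
  by have := sepE _ _ in_t in_d; rewrite ord_lt_irr.
have in_d : nth p0 pe i \in drop g.+1 pe.
  by move: dr; rewrite subnKC // => <-; apply: mem_nth; rewrite size_drop; rewrite ltn_sub2r //; exact: leq_ltn_trans lt_gi lti.
rewrite in_d => /orP[/andP[in_t _]|/= lt_u]; last by rewrite -val_eqE /=; split; order.
by have := sepE _ _ in_t in_d; rewrite ord_lt_irr.
Qed.

(** The dictionary between positions in [splice g pa pe] and the geometry of the insertion, shared
    by the inductions over [coded] that follow. *)
Lemma coded_step (a e : code) g (pa : seq 'I_N) sa pe se :
    coded a pa sa -> coded e pe se -> g < gaps e -> sorted (@ord_lt N) (splice g pa pe) ->
  exists r, [/\ insertion [set x in sa] [set x in se] r,
    forall p0, nth p0 pa 0 = source r,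
    forall p0 i, i < gaps a -> nth p0 pa i.+1 \in endpoints [set x in sa] /\ nth p0 pa i.+1 != source r,
    forall p0 i, i < size pe -> nth p0 pe i \in endpoints [set x in se] /\
      (nth p0 pe i != sink r :> nat /\ (nth p0 pe i < sink r) = (i <= g))
    & forall p0, [/\ last p0 pa \in endpoints [set x in sa], last p0 pa != source r,
        forall d, d \in [set x in sa] -> sink d <= last p0 pa &
        nth p0 pe g <= sink r /\
        forall u : 'I_N, u \in endpoints [set x in se] -> (u <= nth p0 pe g) = (u <= sink r)]].
Proof.
move=> ca ce ge st; have [r ins rp] := coded_insertion ca ce ge st.
have [mA _ _ epA] := coded_diagram ca; have [_ _ _ epE] := coded_diagram ce.
have [_ sta sza _] := coded_size ca; have [_ ste sze _] := coded_size ce.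
have rinA := is_root_mem (ins_root ins).
have lt_g : g.+1 < size pe by rewrite sze; move: ge; rewrite /gaps; have := csize_gt0 e; order.
case: pa => [|p pa] in ca st rp epA sta sza *.
  by have := csize_gt0 a; move: sza => /=; order.
rewrite /= in rp; have lt_r := chord_lt mA rinA.
have r_pa : sink r \in pa.
  have := sink_endpoint rinA; rewrite epA in_cons => /predU1P[rp'|//].
  by move: lt_r; rewrite rp' rp ltnn.
have p_pa u : u \in pa -> p < u.
  by move: sta; rewrite /= (path_sortedE (@ord_lt_trans N)) => /andP[/allP lt_p _] /lt_p.
have ltE p0 i : i < size pe -> nth p0 pe i \in endpoints [set x in se] /\
    (nth p0 pe i != sink r :> nat /\ (nth p0 pe i < sink r) = (i <= g)).
  by move=> lti; rewrite epE mem_nth //; have [] := splice_nth st p0 r_pa lti.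
have inA u : u \in pa -> u \in endpoints [set x in sa] /\ u != source r.
  move=> ua; rewrite epA in_cons ua orbT rp; split=> //.
  by apply: contraTneq (p_pa u ua) => ->; rewrite ltnn.
exists r; split=> // [p0 i lti|p0].
  by apply: inA; rewrite /= mem_nth //; move: sza lti; rewrite /gaps /=; order.
have la : last p pa \in pa by case: (pa) r_pa => // q pa' _; rewrite /= mem_last.
have le_last u : u \in p :: pa -> u <= last p pa.
  move: sta; rewrite [p :: pa]lastI -cats1 sorted_lt_cat => /and3P[/allrelP lt_l _ _].
  rewrite cats1 mem_rcons in_cons => /predU1P[->//|/lt_l]/(_ (last p pa)).
  by rewrite mem_seq1 eqxx => /(_ isT)/ltnW.
have [-> ->] := inA _ la; split=> // [d dA|]; first by rewrite le_last // -epA sink_endpoint.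
have [_ [_ lt_b]] := ltE p0 g (ltnW lt_g); split; first by rewrite ltnW // lt_b.
move=> u; rewrite epE => /(nthP p0)[i lti <-]; have [_ [ne_i lt_i]] := ltE p0 i lti.
have -> : (nth p0 pe i <= nth p0 pe g) = (i <= g).
  have lt_nth j k : j < size pe -> k < size pe -> j < k -> nth p0 pe j < nth p0 pe k.
    by move=> ltj ltk; apply: (sorted_ltn_nth (@ord_lt_trans N) p0 ste) ltj ltk.
  case: (ltngtP i g) => [lt_ig|lt_gi|->]; rewrite ?leqnn //.
    by rewrite ltnW // lt_nth // ltnW.
  by apply/negbTE; rewrite -ltnNge lt_nth // ltnW.
by rewrite -lt_i [RHS]leq_eqVlt (negPf ne_i).
Qed.

(** The two claims are proved together because the valencies after an insertion refer to the top
    chord of gap [g]. *)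
Lemma coded_tops c ep s : coded c ep s ->
  [seq valence [set x in s] x | x <- s] = valences c /\
  forall p0 (s0 : chord N) i, i < gaps c ->
    top_chord [set x in s] (nth p0 ep i) (nth s0 s (nth 0 (gap_tops c) i)).
Proof.
elim=> [p q pq|a e g pa sa pe se ca [va topa] ce [ve tope] ge st].
  have pq_in : (p, q) \in [set x in [:: (p, q)]] by rewrite !inE.
  split=> [|p0 s0 [|//] _] /=; last first.
    apply/top_chordP; split=> // [|x]; first by rewrite /covers leqnn.
    by rewrite !inE => /eqP->; rewrite ltnn.
  congr (_ :: _); apply: eq_card0 => x; apply/valenceP; rewrite !inE => -[/eqP-> /andP[_]].
  by rewrite ltnn.
have [r [ins pa0 inA inE_ gap]] := coded_step ca ce ge st.
have [_ _ sza ssa] := coded_size ca; have [_ _ sze sse] := coded_size ce.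
have [vca _ _ _] := coded_size ca; have [vce _ _ _] := coded_size ce.
have [[mA cA _ epA] [mE _ _ _]] := (coded_diagram ca, coded_diagram ce).
have use := coded_uniq ce; have [szta szte] := (size_gap_tops vca, size_gap_tops vce).
have rinA := is_root_mem (ins_root ins).
set A := [set x in sa] in ins inA rinA gap va topa mA cA epA *.
set E := [set x in se] in ins inE_ gap ve tope mE *.
have top_gap p0 x : top_chord E (nth p0 pe g) x = top_chord E (sink r) x.
  by have [_ _ _ [le_g gap_g]] := gap p0; apply: (gap_top le_g gap_g).
have lt_gpe : g < size pe by rewrite sze; move: ge; rewrite /gaps; order.
rewrite set_cat -/A -/E; split.
  rewrite map_cat /= -va; congr cat; last first.
    by apply/eq_in_map => x xa; rewrite (ins_valence_A ins) // inE.
  have lt_k := nth_gap_tops vce ge.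
  apply: (@eq_from_nth _ 0).
    by rewrite size_map size_incr_nth size_valences // lt_k.
  move=> i; rewrite size_map => lti; have s0 : chord N by case: (se) lti => // x.
  have p0 : 'I_N by exact: s0.1.
  have iE : nth s0 se i \in E by rewrite inE mem_nth.
  rewrite (nth_map s0) // (ins_valence_E ins) // nth_incr_nth -ve (nth_map s0) //.
  rewrite addnC; congr (nat_of_bool _ + _).
  have top_k := tope p0 s0 g ge; rewrite top_gap in top_k.
  apply/idP/eqP => [top_i|<-//].
  apply/eqP; rewrite -(nth_uniq s0 _ _ use) ?sse ?lt_k -?sse //.
  exact/eqP/(top_chord_uniq mE top_k).
move=> p0 s0 i lti /=; pose P (q : 'I_N) k : Prop := top_chord (A :|: E) q (nth s0 (se ++ sa) k).
have nthE k : k < csize e -> nth s0 (se ++ sa) k = nth s0 se k.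
  by move=> ltk; rewrite nth_cat sse ltk.
have nthA k : nth s0 (se ++ sa) (csize e + k) = nth s0 sa k.
  by rewrite nth_cat sse ltnNge leq_addr /= addKn.
have top_left j : j < gaps e -> P (nth p0 pe j) (nth 0 (gap_tops e) j).
  move=> ltj; rewrite /P nthE ?nth_gap_tops //; have [|jE _] := inE_ p0 j.
    by rewrite sze; move: ltj; rewrite /gaps; order.
  by apply: (ins_top_E ins) (tope p0 s0 j ltj) _ => d dA dr; apply: (endpoint_uncovered ins).
suff: P (nth p0 (splice g pa pe) i) (nth 0 (gap_tops (Ins a e g)) i) by [].
pose ta := [seq csize e + k | k <- gap_tops a].
have -> : gap_tops (Ins a e g) =
    head 0 ta :: take g.+1 (gap_tops e) ++ behead ta ++ drop g (gap_tops e) by [].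
apply: (@splice_gaps _ _ P p0 0); rewrite ?size_map ?szta ?szte //.
- by rewrite sza /gaps; have := csize_gt0 a; order.
- by rewrite sze /gaps; have := csize_gt0 e; order.
- by rewrite size_takel ?szte.
- exact: gaps_gt0.
- rewrite /P pa0 (nth_map 0) ?szta ?gaps_gt0 // nthA.
  have := topa p0 s0 0 (gaps_gt0 a); rewrite pa0 => top0.
  suff -> : nth s0 sa (nth 0 (gap_tops a) 0) = r by apply: ins_top_source ins.
  apply: (top_chord_uniq mA top0); apply/top_chordP; split=> //.
    by rewrite /covers leqnn (chord_lt mA rinA).
  by move=> x xA rx; rewrite /covers leqNgt rx.
- by move=> j le_jg; rewrite nth_take //; apply: top_left; apply: leq_ltn_trans ge.
- case=> // j /= lt_j; have [jA jr] := inA p0 j (ltnW lt_j).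
  rewrite /P (nth_map 0) ?szta // nthA.
  have top_j := topa p0 s0 j.+1 lt_j; apply: (ins_top_A ins) (top_j).
  by apply: contraTneq top_j => ->; apply: (root_not_top ins jA jr).
- rewrite /P nthE ?nth_gap_tops //; have [lA lr le_l _] := gap p0.
  apply: (ins_top_E ins) => [|d dA _]; last by rewrite /covers ltnNge le_l // andbF.
  have lb : in_block E r (last p0 pa).
    have /endpointsP[d dA [ld|->]] := lA; last exact: (in_block_sink ins).
    by rewrite ld; apply: (in_block_source ins) => //; apply: contraNneq lr => <-; rewrite ld.
  by rewrite (in_block_top _ lb) -(top_gap p0); apply: tope.
- by move=> j /andP[_ lt_j]; apply: top_left.
by move: lti; rewrite /gaps /=; have := csize_gt0 a; have := csize_gt0 e; order.
Qed.

(** [cycle_free c] enters at the block of [a]: a gap there is judged by [A] alone once the gap of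
    [E] holding the block is known to be admissible. *)
Lemma coded_active c ep s : coded c ep s -> cycle_free c ->
  forall p0 i, i < gaps c -> allowed [set x in s] (nth p0 ep i) = nth false (active c) i.
Proof.
elim=> [p q pq _ p0 [|//] _|a e g pa sa pe se ca IHa ce IHe ge st].
  have pq_in : (p, q) \in [set x in [:: (p, q)]] by rewrite !inE.
  apply/allowedP => z; rewrite !inE => /eqP-> zq; exists p => //.
  apply/top_chordP; split=> // x; rewrite !inE => /eqP->; by rewrite ltnn.
move=> /and3P[/IHa{}IHa /IHe{}IHe act_g] p0 i lti.
have [r [ins pa0 inA inE_ gap]] := coded_step ca ce ge st.
have [_ _ sza ssa] := coded_size ca; have [_ _ sze sse] := coded_size ce.
have [vca _ _ _] := coded_size ca; have [vce _ _ _] := coded_size ce.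
have [szta szte] := (size_active vca, size_active vce).
have rinA := is_root_mem (ins_root ins); rewrite set_cat.
set A := [set x in sa] in ins inA rinA gap IHa *.
set E := [set x in se] in ins inE_ gap IHe *.
have [lA lr le_l [le_g gap_g]] := gap p0.
have alwE : allowed E (sink r) by rewrite -(gap_allowed le_g gap_g) IHe.
pose P (q : 'I_N) k : Prop := allowed (A :|: E) q = k.
have right_act j : g < j < gaps e -> P (nth p0 pe j) (nth false (active e) j).
  case/andP=> gj ltj; have [|jE [nr jr]] := inE_ p0 j.
    by rewrite sze; move: ltj; rewrite /gaps; order.
  rewrite /P (allowed_right ins) // ?IHe //; move: nr jr; rewrite [j <= g]leqNgt gj.
  by case: ltngtP.
have act0 : nth false (active a) 0 by case: (a) => [|? ? ?].
suff: P (nth p0 (splice g pa pe) i) (nth false (active (Ins a e g)) i) by [].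
have -> : active (Ins a e g) =
    head false (active a) :: nseq g.+1 false ++ behead (active a) ++ drop g (active e).
  by rewrite -nth0 act0.
apply: (@splice_gaps _ _ P p0 false); rewrite ?szta ?szte ?size_nseq //.
- by rewrite sza /gaps; have := csize_gt0 a; order.
- by rewrite sze /gaps; have := csize_gt0 e; order.
- exact: gaps_gt0.
- by rewrite /P pa0 act0; apply: allowed_source ins.
- move=> j le_jg; rewrite nth_nseq if_same; have [|jE [nr jr]] := inE_ p0 j.
    by rewrite sze; move: ge; rewrite /gaps; order.
  by apply/negbTE/(allowed_left ins); rewrite ?jr.
- case=> // j /= lt_j; have [jA jr] := inA p0 j (ltnW lt_j).
  by rewrite /P (allowed_block ins) // IHa.
- by rewrite /P act_g; apply: (allowed_last ins).
by move: lti; rewrite /gaps /=; have := csize_gt0 a; have := csize_gt0 e; order.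
Qed.

End Tops.

(** * Top cycles *)

Section TopCycles.

Variable N : nat.
Implicit Types (x y z r d e : chord N) (C D A E : {set chord N}) (ys : seq (chord N)).

Lemma top_cycle_freeS C D : D \subset C -> top_cycle_free C -> top_cycle_free D.
Proof.
move=> sDC; apply: contra => /existsP[B /and3P[sBD B3 cyc]].
by apply/existsP; exists B; rewrite (subset_trans sBD sDC) B3.
Qed.

Lemma relabel_lt D (p q : 'I_N) : relabel_point D p < relabel_point D q -> p < q.
Proof.
apply: contraTT; rewrite -!leqNgt => le_qp; apply: subset_leq_card; apply/subsetP => u.
by rewrite !inE => /andP[-> /leq_trans->].
Qed.

Definition has_label D x (i j : nat) : bool :=
  (relabel_point D (source x) == i) && (relabel_point D (sink x) == j).

(** Here [z] is the chord (2, 2m - 1), and the chords (2i - 1, 2i + 2) of the cycle are renumbered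
    from 0, hence 2i + 1 and 2i + 4. *)
Lemma top_cycleP D : 3 <= #|D| -> perm_eq (relabel D) (top_cycle #|D|) ->
  exists z (x : nat -> chord N), [/\ z \in D, has_label D z 2 (2 * #|D| - 1),
    forall i, i.+1 < #|D| -> x i \in D /\ has_label D (x i) (2 * i + 1) (2 * i + 4)
  & forall d, d \in D -> d = z \/ exists2 i, i.+1 < #|D| & d = x i].
Proof.
move=> D3 cyc; have memR i j : (i, j) \in top_cycle #|D| -> exists2 d, d \in D & has_label D d i j.
  rewrite -(perm_mem cyc) => /mapP[d]; rewrite mem_enum => dD [-> ->].
  by exists d; rewrite // /has_label !eqxx.
have [|z zD zl] := memR 2 (2 * #|D| - 1); first by rewrite mem_head.
pose x i := odflt z [pick d in D | has_label D d (2 * i + 1) (2 * i + 4)].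
have xP i : i.+1 < #|D| -> x i \in D /\ has_label D (x i) (2 * i + 1) (2 * i + 4).
  move=> lti; rewrite /x; case: pickP => [d /andP[]//|none].
  have [|d dD dl] := memR (2 * i + 1) (2 * i + 4); last by have := none d; rewrite dD dl.
  rewrite in_cons; apply/orP; right; apply/mapP; exists i.+1; last by congr pair; order.
  by rewrite mem_iota; order.
exists z, x; split=> // d dD.
have dR : (relabel_point D (source d), relabel_point D (sink d)) \in relabel D.
  by apply/mapP; exists d; rewrite ?mem_enum.
have label_inj e i : e \in D -> relabel_point D (source d) = i ->
    relabel_point D (source e) = i -> d = e.
  move=> eD di ei; have uR : uniq (map fst (relabel D)).
    rewrite (perm_uniq (perm_map fst cyc)) /= -map_comp; apply/andP; split.
      by apply/mapP => -[k]; rewrite mem_iota /=; order.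
    by rewrite map_inj_in_uniq ?iota_uniq // => k l; rewrite !mem_iota /=; order.
  have : {in enum D &, injective (fun c => relabel_point D (source c))}.
    have := uR; rewrite /relabel -map_comp; set h := _ \o _ => uh u v uD vD huv.
    apply/eqP; rewrite -(nth_index u uD) -[v](nth_index u vD) nth_uniq ?index_mem ?enum_uniq //.
    rewrite -(nth_uniq 0 _ _ uh) ?size_map ?index_mem //.
    by rewrite !(nth_map u) ?index_mem // !nth_index //; apply/eqP.
  by apply; rewrite ?mem_enum // di ei.
move: dR; rewrite (perm_mem cyc) in_cons => /predU1P[[ds dt]|/mapP[i]].
  by left; apply: label_inj zD ds _; case/andP: zl => /eqP.
rewrite mem_iota => lti [ds dt]; right; exists i.-1; first by order.
have [|xD /andP[/eqP xs _]] := xP i.-1; first by order.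
by apply: label_inj xD ds _; rewrite xs; order.
Qed.

(* The chords of a top cycle after its first one, the root, and its second
   one, z: each starts before the sink q of the previous chord. *)
Fixpoint chain z (q : nat) ys : bool :=
  match ys with
  | [::] => false
  | y :: ys' => [&& source z < source y, source y < q, q < sink y &
      if ys' is y' :: _ then (q < source y') && chain z (sink y) ys'
      else q < sink z < sink y]
  end.

Section Chain.

Variable z : chord N.

(** The endpoints of the cycle in increasing order, after the sources of the root and of [z]: the
    source of each chord precedes the sink of the previous one. *)
Fixpoint chain_points (q : 'I_N) ys : seq 'I_N :=
  match ys with
  | [::] => [::]
  | y :: ys' => source y :: q :: (if ys' is [::] then [:: sink z; sink y] else chain_points (sink y) ys')
  end.

Lemma chain_sorted (p q : 'I_N) ys : p < source (head z ys) -> chain z q ys ->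
  path (@ord_lt N) p (chain_points q ys).
Proof.
elim: ys p q => //= y ys IHys p q py /and4P[zy yq qy]; rewrite /ord_lt py yq /=.
case: ys IHys => [_ /andP[q1 q2]|y' ys IHys /andP[qy' ch]]; first by rewrite /= /ord_lt q1 q2.
exact: IHys qy' ch.
Qed.

Lemma size_chain_points q ys : ys != [::] -> size (chain_points q ys) = (size ys).*2.+2.
Proof. by elim: ys q => //= y [|y' ys] // IHys q _; rewrite IHys. Qed.

Lemma nth_chain_points p0 q ys i : i < size ys ->
  [/\ nth p0 (chain_points q ys) i.*2 = source (nth z ys i),
      nth p0 (chain_points q ys) i.*2.+3 = sink (nth z ys i),
      nth p0 (chain_points q ys) 1 = q & nth p0 (chain_points q ys) (size ys).*2 = sink z].
Proof.
elim: ys q i => //= y [|y' ys] IHys q [|i] //= lti.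
  by have [_ _ n1 nz] := IHys (sink y) 0 isT; split.
by have [n0 n3 n1 nz] := IHys (sink y) i lti; split.
Qed.

Lemma mem_chain_points q ys p : p \in chain_points q ys ->
  [\/ p = q, p = sink z | exists2 y, y \in ys & p = source y \/ p = sink y].
Proof.
elim: ys q => //= y ys IHys q; rewrite !in_cons => /or3P[/eqP->|/eqP->|].
- by constructor 3; exists y; rewrite ?mem_head //; left.
- by constructor 1.
case: ys IHys => [_|y' ys IHys].
  rewrite !inE => /orP[]/eqP->; first by constructor 2.
  by constructor 3; exists y; rewrite ?mem_head //; right.
case/IHys => [->|->|[x xin px]].
- by constructor 3; exists y; rewrite ?mem_head //; right.
- by constructor 2.
by constructor 3; exists x; rewrite // in_cons xin orbT.
Qed.

Lemma chain_sources q ys : subseq [seq source y | y <- ys] (chain_points q ys).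
Proof.
elim: ys q => //= y ys IHys q; rewrite eqxx; apply: subseq_trans (subseq_cons _ _).
by case: ys IHys => [//|y' ys IHys]; apply: IHys.
Qed.

Lemma rank_nth D (s : seq 'I_N) p0 i : sorted (@ord_lt N) s -> endpoints D =i s ->
  i < size s -> relabel_point D (nth p0 s i) = i.+1.
Proof.
move=> st eqs lti; set p := nth p0 s i.
have szt : size (take i.+1 s) = i.+1 by rewrite size_takel.
have ut : uniq (take i.+1 s).
  by apply/take_uniq/(sorted_uniq (@ord_lt_trans N) (@ord_lt_irr N)).
rewrite -[RHS]szt -(card_uniqP ut); apply: eq_card => u; rewrite inE eqs.
move: st; rewrite -{1 2}(cat_take_drop i.+1 s) sorted_lt_cat mem_cat => /and3P[/allrelP lt_td stt _].
have pt : p \in take i.+1 s by rewrite /p -(nth_take p0 (ltnSn i)) mem_nth ?szt.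
have lt_p v : v \in take i.+1 s -> v <= p.
  case/(nthP p0)=> j; rewrite szt ltnS => le_ji <-; rewrite /p -(nth_take p0 (ltnSn i)).
  case: (ltngtP j i) le_ji => // [lt_ji _|-> //].
  have := sorted_ltn_nth (@ord_lt_trans N) p0 stt j i.
  by rewrite !inE szt ltnS (ltnW lt_ji) ltnSn => /(_ isT isT lt_ji)/ltnW.
apply/andP/idP => [[/orP[//|ud] up]|ut']; last by rewrite ut' lt_p.
by have := lt_td _ _ pt ud; rewrite /ord_lt ltnNge up.
Qed.

Lemma chain_top_cycle r ys (D := [set x in r :: z :: ys]) :
    source r < source z -> chain z (sink r) ys ->
  3 <= #|D| /\ perm_eq (relabel D) (top_cycle #|D|).
Proof.
move=> rz ch; have nz_ys : ys != [::] by apply: contraTneq ch => ->.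
have zy : source z < source (head z ys) by case: (ys) ch => //= y ys' /andP[].
pose s := source r :: source z :: chain_points (sink r) ys.
have st : sorted (@ord_lt N) s by rewrite /= /ord_lt rz; apply: chain_sorted.
have n_gt0 : 0 < size ys by case: (ys) nz_ys.
have szs : size s = (size ys).+2.*2 by rewrite /= size_chain_points.
have p0 := source r.
have nth_s i : i <= size ys -> nth p0 s i.*2 = source (nth z (r :: ys) i) /\
    nth p0 s i.*2.+3 = sink (nth z (r :: ys) i).
  case: i => [_|i lti] /=; last by have [] := nth_chain_points p0 (sink r) lti.
  by have [_ _ ->] := nth_chain_points p0 (sink r) n_gt0.
have nth_z : nth p0 s (size ys).*2.+2 = sink z.
  by have [_ _ _] := nth_chain_points p0 (sink r) n_gt0.
have endD : endpoints D =i s.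
  move=> p; apply/endpointsP/idP => [[c]|].
    have mem_s i : i < (size ys).+2.*2 -> nth p0 s i \in s by rewrite -szs; apply: mem_nth.
    have ins d : d \in r :: ys -> source d \in s /\ sink d \in s.
      case/(nthP z)=> i /= lti <-; have [<- <-] := nth_s i lti.
      have le_i : i.*2 <= (size ys).*2 by rewrite leq_double.
      by split; apply: mem_s; rewrite !doubleS !ltnS // !leqW.
    rewrite inE in_cons orbCA -in_cons in_cons => /orP[/eqP->|/ins[i1 i2]] [] -> //.
      by rewrite !in_cons eqxx orbT.
    by rewrite -nth_z mem_s // !doubleS !ltnS leqW.
  rewrite !in_cons => /or3P[/eqP->|/eqP->|/mem_chain_points[->|->|[y yin py]]].
  - by exists r; [rewrite inE mem_head | left].
  - by exists z; [rewrite !inE eqxx orbT | left].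
  - by exists r; [rewrite inE mem_head | right].
  - by exists z; [rewrite !inE eqxx orbT | right].
  by exists y; rewrite // !inE yin !orbT.
have rank i : i < (size ys).+2.*2 -> relabel_point D (nth p0 s i) = i.+1.
  by rewrite -szs; apply: rank_nth.
have u_s : uniq (r :: z :: ys).
  apply: (@map_uniq _ _ (@source N)).
  apply: (@subseq_uniq _ _ s); last exact: (sorted_uniq (@ord_lt_trans N) (@ord_lt_irr N)).
  by rewrite /= !eqxx; apply: chain_sources.
have cardD : #|D| = (size ys).+2 by rewrite cardsE (card_uniqP u_s).
rewrite cardD; split; first by rewrite !ltnS.
have -> : top_cycle (size ys).+2 =
    [seq (relabel_point D (source c), relabel_point D (sink c)) | c <- z :: r :: ys].
  rewrite [RHS]/=; congr (_ :: _).
    have -> : source z = nth p0 s 1 by [].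
    by rewrite -nth_z !rank; [congr pair|..]; lia.
  rewrite -[RHS]/(map _ (r :: ys)).
  apply: (@eq_from_nth _ (0, 0)); first by rewrite !size_map size_iota.
  move=> i; rewrite size_map size_iota => lti.
  rewrite (nth_map 0) ?size_iota // nth_iota // (nth_map z) //.
  have [<- <-] := nth_s i lti; rewrite !rank; [congr pair|..]; lia.
apply: perm_map; apply: uniq_perm; first exact: enum_uniq.
  by move: u_s; rewrite /= !in_cons !negb_or eq_sym => /and3P[/andP[-> ->] -> ->].
by move=> c; rewrite mem_enum !inE orbCA.
Qed.

End Chain.

Section Ins.

Variables (A E : {set chord N}) (r : chord N).
Hypothesis insAE : insertion A E r.

Let mA := ins_mA insAE.
Let mE := ins_mE insAE.
Let rA := ins_root insAE.
Let rinA := is_root_mem rA.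

Lemma cross_same_side x y : x \in A :|: E -> y \in A :|: E -> x != r -> y != r ->
  cross x y -> (x \in E) = (y \in E).
Proof.
rewrite !in_setU => /orP[xA|xE] /orP[yA|yE] xr yr; rewrite ?xE ?yE //.
- by move=> _; apply/idP/idP => /(ins_notin insAE); rewrite ?xA ?yA.
- by rewrite crossC (ins_cross insAE) // (negPf xr).
- by rewrite (ins_cross insAE) // (negPf yr).
Qed.

(** Crossings that avoid the root stay within [A] or within [E], so a top cycle meeting both starts
    with the root and has all its other chords in [E]. Its chords after [z] start later than [z] and
    together cover every gap from [sink r] to [sink z], so [z] is not the top chord of any of
    them. *)
Lemma ins_top_cycle D : top_cycle_free A -> top_cycle_free E -> allowed E (sink r) ->
  D \subset A :|: E -> 3 <= #|D| -> ~~ perm_eq (relabel D) (top_cycle #|D|).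
Proof.
move=> tfA tfE alw sD D3; apply/negP => cyc.
have nsub B : top_cycle_free B -> ~~ (D \subset B).
  by apply: contra => sDB; apply/existsP; exists D; rewrite sDB D3.
have [z [x [zD /andP[/eqP zs /eqP zt] xP memD]]] := top_cycleP D3 cyc.
have inAE d (dD : d \in D) := subsetP sD d dD.
have xD i (lti : i.+1 < #|D|) := (xP i lti).1.
have xs i : i.+1 < #|D| -> relabel_point D (source (x i)) = 2 * i + 1.
  by move=> lti; have [_ /andP[/eqP]] := xP i lti.
have xt i : i.+1 < #|D| -> relabel_point D (sink (x i)) = 2 * i + 4.
  by move=> lti; have [_ /andP[_ /eqP]] := xP i lti.
have next i : i.+2 < #|D| -> right_neighbor (x i) (x i.+1).
  move=> lti; rewrite /right_neighbor; have lti' : i.+1 < #|D| by order.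
  by apply/and3P; split; apply: (@relabel_lt D); rewrite ?xs ?xt //; order.
have z_last : right_neighbor z (x #|D|.-2).
  by apply/and3P; split; apply: (@relabel_lt D); rewrite ?zs ?zt ?xs ?xt //; order.
have lt_z i : 0 < i -> i.+1 < #|D| -> source z < source (x i).
  by move=> i0 lti; apply: (@relabel_lt D); rewrite zs xs //; order.
have x0_z : right_neighbor (x 0) z.
  by apply/and3P; split; apply: (@relabel_lt D); rewrite ?zs ?zt ?xs ?xt //; order.
have lt_x0 i : 0 < i -> i.+1 < #|D| -> source (x 0) < source (x i).
  by move=> i0 lti; apply: (@relabel_lt D); rewrite !xs //; order.
have zr : z != r.
  apply/eqP => zr; have := is_root_le (ins_is_root insAE) (inAE _ (xD 0 (ltnW D3))).
  by case/and3P: x0_z; rewrite zr; order.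
have xr i : 0 < i -> i.+1 < #|D| -> x i != r.
  move=> i0 lti; apply/eqP => xr; have := lt_x0 i i0 lti.
  by have := is_root_le (ins_is_root insAE) (inAE _ (xD 0 (ltnW D3))); rewrite xr; order.
have sideS i : 0 < i -> i.+1 < #|D| -> (x i \in E) = (z \in E).
  move=> i0 lti; have [j defj] : exists j, #|D|.-2 = i + j by exists (#|D|.-2 - i); order.
  elim: j i i0 lti defj => [|j IHj] i i0 lti defj.
    rewrite addn0 in defj; rewrite -defj in lti i0 *; apply/esym/cross_same_side => //.
    - exact: inAE.
    - exact/inAE/xD.
    - exact: xr.
    - by rewrite /cross z_last.
  have lti' : i.+2 < #|D| by order.
  rewrite -(IHj i.+1) //; last by order.
  apply: cross_same_side; rewrite ?xr //; [exact/inAE/xD|exact/inAE/xD|].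
  by rewrite /cross next.
have sub_side : (x 0 \in E) = (z \in E) -> False.
  have tf : top_cycle_free (if z \in E then E else A) by case: ifP.
  move=> side0; case/negP: (nsub _ tf); apply/subsetP => d dD; have side : (d \in E) = (z \in E).
    by case: (memD d dD) => [->//|[[|i] lti ->]]; [|apply: sideS].
  have := inAE d dD; rewrite in_setU side.
  by case: ifP => [zE _|_]; [rewrite side | rewrite orbF].
have [x0r|x0r] := eqVneq (x 0) r; last first.
  apply: sub_side; apply: cross_same_side; rewrite ?inAE ?xD // ?(ltnW D3) //.
  by rewrite /cross x0_z.
have [zE|zE] := boolP (z \in E); last first.
  by apply: sub_side; rewrite (negPf zE) x0r; apply/negbTE/negP => /(ins_notin insAE); rewrite rinA.
have zb : covers z (sink r).
  by case/and3P: x0_z; rewrite x0r /covers => _ /ltnW-> ->.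
have [q' le_q /top_chordP[_ /andP[_ lt_q] uz]] := allowedP _ _ alw z zE zb.
have [i [i0 lti iq]] : exists i, [/\ 0 < i, i.+1 < #|D| & covers (x i) q'].
  have lt_last : q' < sink (x #|D|.-2) by case/and3P: z_last => _ _; apply: ltn_trans.
  have : #|D|.-2.+1 < #|D| by order.
  elim: (#|D|.-2) lt_last => [|j IHj] lt_j ltj; first by move: lt_j; rewrite x0r ltnNge le_q.
  have [lt_q'|le_q'] := ltnP q' (sink (x j)); first by apply: IHj => //; apply: ltnW.
  exists j.+1; split=> //; rewrite /covers lt_j andbT.
  by case/and3P: (next j ltj) => _ lt_s _; apply: ltnW; apply: leq_trans le_q'.
by have := uz (x i); rewrite sideS // zE iq => /(_ isT (lt_z i i0 lti)).
Qed.

(** Greedy choice: among the chords above the gap that start after z, take the one with the last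
    sink. Its maximality, recorded in the last clause, forces the following chord to start after q,
    so that chords two steps apart do not cross. *)
Lemma chain_exists z (q : nat) : z \in E -> source z <= q -> q < sink z ->
    (forall e, e \in E -> source e != q :> nat) ->
    (forall q' : nat, q <= q' -> ~~ top_chord E q' z) ->
  exists y ys, [/\ all (mem E) (y :: ys), chain z q (y :: ys) &
    forall e, e \in E -> source z < source e -> covers e q -> sink e <= sink y].
Proof.
move=> zE; have [n] := ubnP (sink z - q); elim: n q => // n IHn q ltn zq qz neq ntop.
have /exists_inP[e eE /andP[ze eq]] : [exists e in E, (source z < source e) && covers e q].
  apply: contraR (ntop q (leqnn q)) => /exists_inPn nc; apply/top_chordP; split=> //.
    by rewrite /covers zq.
  by move=> e eE ze; have := nc e eE; rewrite ze.
pose S := [set e in E | (source z < source e) && covers e q].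
have nzS : S != set0 by apply/set0Pn; exists e; rewrite inE eE ze.
have [y] := max_sink nzS; rewrite inE => /and3P[yE zy /andP[yq qy]] ymax.
have {}ymax d : d \in E -> source z < source d -> covers d q -> sink d <= sink y.
  by move=> dE zd dq; apply: ymax; rewrite inE dE zd.
have lt_yq : source y < q by rewrite ltn_neqAle neq.
have ne_yz : y != z by apply: contraTneq zy => ->; rewrite ltnn.
have [_ /(_ ne_yz)[_ _ _ ne_t]] := mE yE zE.
have [lt_zy|lt_yz|/eqP] := ltngtP (sink z) (sink y); last by rewrite eq_sym (negPf ne_t).
  by exists y, [::]; split=> //=; rewrite ?yE // zy lt_yq qy qz lt_zy.
have [|||||y' [ys [allE ch ymax']]] := IHn (sink y).
- by order.
- by order.
- by [].
- move=> d dE; have [->|ne_dy] := eqVneq d y; first by have := chord_lt mE yE; order.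
  by have [_ /(_ ne_dy)[_ ]] := mE dE yE.
- by move=> q' le_q'; apply: ntop; order.
exists y, (y' :: ys); split=> //; first by rewrite /= yE.
move: ch; rewrite [chain z q _]/= -/(chain z (sink y) (y' :: ys)) => ch.
rewrite zy lt_yq qy ch andbT /= ltnNge; apply/negP => le_y'q.
have y'E : y' \in E by case/andP: allE.
have /and4P[zy' _ lt_y' _] := ch.
have := ymax y' y'E zy'; rewrite /covers le_y'q (ltn_trans qy lt_y') => /(_ isT).
by rewrite leqNgt lt_y'.
Qed.

Lemma ins_top_cycle_free :
  top_cycle_free (A :|: E) = [&& top_cycle_free A, top_cycle_free E & allowed E (sink r)].
Proof.
apply/idP/and3P => [tf|[tfA tfE alw]]; last first.
  apply/negP => /existsP[D /and3P[sD D3 cyc]].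
  by have := ins_top_cycle tfA tfE alw sD D3; rewrite cyc.
split; try by apply: top_cycle_freeS tf; rewrite ?subsetUl ?subsetUr.
apply: contraLR tf => /allowedP nalw; apply/negPn.
have /exists_inP[z zE /andP[zb ntop]] : [exists z in E, covers z (sink r) &&
    [forall q' : 'I_N, (sink r <= q') ==> ~~ top_chord E q' z]].
  apply: contra_notT nalw => /exists_inPn nz z zE zb.
  have := nz z zE; rewrite zb /= => /forallPn[q']; rewrite negb_imply negbK => /andP[le_q top].
  by exists q'.
have [zs zt] := andP zb.
have [||y [ys [allE ch _]]] := chain_exists zE zs zt.
- by move=> e eE; have [] := ins_neq insAE eE.
- move=> q' le_q; apply/negP => top; have /top_chordP[_ /andP[_ lt_q] _] := top.
  have := forallP ntop (Ordinal (ltn_trans lt_q (ltn_ord _))).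
  by rewrite /= le_q top.
have [D3 cyc] := chain_top_cycle (ins_first insAE zE) ch.
apply/existsP; exists [set x in r :: z :: y :: ys]; rewrite D3 cyc !andbT.
apply/subsetP => x; rewrite inE => /predU1P[->|/predU1P[->|xys]]; rewrite in_setU ?rinA ?zE ?orbT //.
by have -> : x \in E := allP allE x xys; rewrite orbT.
Qed.

End Ins.

Lemma coded_cycle_free c ep (s : seq (chord N)) : coded c ep s ->
  top_cycle_free [set x in s] = cycle_free c.
Proof.
elim=> [p q pq|a e g pa sa pe se ca tfa ce tfe ge st].
  apply/negP => /existsP[D /and3P[sD D3 _]]; have := leq_trans D3 (subset_leq_card sD).
  by rewrite cardsE (card_uniqP _).
have [r [ins _ _ _ gap]] := coded_step ca ce ge st; rewrite set_cat.
rewrite (ins_top_cycle_free ins) tfa tfe /=.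
have [tfa'|] := boolP (cycle_free a); last by [].
have [tfe'|] := boolP (cycle_free e); last by [].
have p0 := source r.
have [_ _ _ [le_g gap_g]] := gap p0.
by rewrite -(gap_allowed le_g gap_g) (coded_active ce).
Qed.

End TopCycles.

(** * Sums over connected diagrams *)

Definition insertions (l : seq code) : seq code :=
  One :: [seq Ins ae.1 ae.2 g | ae <- [seq (a, e) | a <- l, e <- l], g <- iota 0 (gaps ae.2)].

(** One round of insertions per unit of size is enough, as both parts of an insertion are smaller
    than the whole. *)
Fixpoint codes (k : nat) : seq code :=
  if k is k'.+1 then [seq c <- insertions (codes k') | csize c <= k] else [::].

Lemma mem_insertions l c : (c \in insertions l) =
  if c is Ins a e g then [&& a \in l, e \in l & g < gaps e] else true.
Proof.
rewrite in_cons; case: c => [|a e g]; first by rewrite eqxx.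
rewrite orFb; apply/allpairsPdep/and3P => [[[a' e'] [g' [/allpairsP[[a1 e1] [/= a1l e1l [-> ->]]] /=]]]|[al el ge]].
  by rewrite mem_iota => lt_g [-> -> ->]; split.
by exists (a, e), g; split; rewrite ?mem_iota //; apply/allpairsP; exists (a, e).
Qed.

Lemma uniq_insertions l : uniq l -> uniq (insertions l).
Proof.
move=> ul; rewrite /= (_ : One \notin _ = true); last by apply/negP => /allpairsPdep[? [? []]].
apply: allpairs_uniq_dep; first by apply: allpairs_uniq => // -[? ?] [? ?] _ _ [-> ->].
  by move=> ae _; apply: iota_uniq.
by move=> [[a e] g] [[a' e'] g'] _ _ /= [-> -> ->].
Qed.

Lemma uniq_codes k : uniq (codes k).
Proof. by elim: k => // k IHk; apply/filter_uniq/uniq_insertions. Qed.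

Lemma mem_codes k c : (c \in codes k) = valid c && (csize c <= k).
Proof.
elim: k c => [|k IHk] c.
  by rewrite [codes 0]/= in_nil leqNgt csize_gt0 andbF.
rewrite -[codes k.+1]/([seq c <- insertions (codes k) | csize c <= k.+1]) mem_filter mem_insertions andbC; case: c => [|a e g] //=.
rewrite !IHk; have := csize_gt0 a; have := csize_gt0 e.
case: (valid a) => //=; case: (valid e); rewrite ?andbF //=.
case: (g < gaps e); rewrite ?andbF //=; lia.
Qed.

Lemma sum_codes (R : nmodType) (M n : nat) (F : code -> R) : n <= M ->
  (\sum_(c <- codes M | csize c == n) F c)%R =
  ((if n == 1 then F One else 0) + \sum_(a <- codes M) \sum_(e <- codes M | csize a + csize e == n)
    \sum_(0 <= g < gaps e) F (Ins a e g))%R.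
Proof.
move=> le_nM; rewrite -big_filter.
have -> : (\sum_(i <- [seq i <- codes M | csize i == n]) F i =
    \sum_(i <- insertions (codes M) | csize i == n) F i)%R.
  rewrite -[RHS]big_filter; apply: perm_big; apply: uniq_perm.
  - exact/filter_uniq/uniq_codes.
  - exact/filter_uniq/uniq_insertions/uniq_codes.
  move=> c; rewrite !mem_filter mem_codes mem_insertions; case: eqP => //= szc.
  rewrite szc le_nM andbT; case: c szc => //= a e g szc; rewrite !mem_codes.
  have [-> ->] : csize a <= M /\ csize e <= M by lia.
  by rewrite !andbT.
rewrite big_cons /= eq_sym; set S := (\sum_(j <- _ | _) _)%R.
have -> : S = (\sum_(a <- codes M) \sum_(e <- codes M | csize a + csize e == n)
    \sum_(0 <= g < gaps e) F (Ins a e g))%R.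
  rewrite /S big_mkcond big_allpairs_dep big_allpairs_dep; apply: eq_bigr => a _.
  rewrite [RHS]big_mkcond; apply: eq_bigr => e _ /=; case: ifP => _; last by rewrite big1_eq.
  by rewrite /index_iota subn0.
by case: ifP => //; rewrite GRing.add0r.
Qed.

(** * Diagrams on 2n points and their codes *)

Section Diagrams.

Variable n : nat.

Definition code_diagram (c : code) : {set chord n.*2} := [set x in realize c (enum 'I_n.*2)].

Lemma coded_code_diagram c : valid c -> csize c = n ->
  coded c (enum 'I_n.*2) (realize c (enum 'I_n.*2)).
Proof.
by move=> vc szc; apply: realize_coded; rewrite // ?enum_ord_sorted // size_enum_ord szc.
Qed.

Lemma code_diagram_connected c : valid c -> csize c = n -> connected_diagram (code_diagram c).
Proof.
move=> vc szc; have [mC cC nzC epC] := coded_diagram (coded_code_diagram vc szc).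
apply/and3P; split=> //; apply/andP; split.
  by apply/forall_inP => x; apply: chord_lt.
apply/forallP => p; have /endpointsP[x xC px] : p \in endpoints (code_diagram c).
  by rewrite epC mem_enum.
apply/cards1P; exists x; apply/setP => y; rewrite in_set1 inE.
apply/andP/eqP => [[yC yp]|->]; last by split=> //; case: px => ->; rewrite eqxx ?orbT.
apply/eqP/negPn/negP => ne_yx; have [_ /(_ ne_yx)[n1 n2 n3 n4]] := mC y x yC xC.
move: px n1 n2 n3 n4; case/orP: yp => /eqP->; by case=> ->; rewrite eqxx.
Qed.

Lemma connected_diagram_code (C : {set chord n.*2}) : connected_diagram C ->
  exists c, [/\ valid c, csize c = n & C = code_diagram c].
Proof.
case/and3P=> dC nzC cC; have mC := diagram_matching dC.
have [c [s [co defC]]] := coded_exists mC cC nzC; exists c.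
have epC : endpoint_seq C = enum 'I_n.*2.
  apply: eq_sorted_lt; [exact: endpoint_seq_sorted|exact: enum_ord_sorted|move=> p].
  rewrite mem_endpoint_seq mem_enum inE; apply/exists_inP.
  have /andP[_ /forallP/(_ p)/cards1P[x defx]] := dC.
  by have := set11 x; rewrite -defx inE => /andP[xC xp]; exists x.
rewrite epC in co; have [vc _ sz _] := coded_size co; split=> //.
  by move/eqP: sz; rewrite size_enum_ord => /eqP/double_inj.
by rewrite /code_diagram -(coded_realize co).
Qed.

Lemma sum_diagrams (R : nmodType) (M : nat) (P : pred {set chord n.*2})
    (F : {set chord n.*2} -> R) : n <= M ->
  (\sum_(C : {set chord n.*2} | connected_diagram C && P C) F C)%R =
  (\sum_(c <- codes M | (csize c == n) && P (code_diagram c)) F (code_diagram c))%R.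
Proof.
move=> le_nM; rewrite -[RHS]big_filter.
have -> : (\sum_(C : {set chord n.*2} | connected_diagram C && P C) F C =
   \sum_(C <- [seq code_diagram c | c <- codes M & (csize c == n) && P (code_diagram c)]) F C)%R.
  transitivity (\sum_(C <- enum [pred C | connected_diagram C && P C]) F C)%R.
    by rewrite big_enum.
  apply: perm_big; apply: uniq_perm.
  - exact: enum_uniq.
  - rewrite map_inj_in_uniq; first exact/filter_uniq/uniq_codes.
    move=> c c'; rewrite !mem_filter !mem_codes => /andP[/andP[/eqP sz _] /andP[v _]].
    move=> /andP[/andP[/eqP sz' _] /andP[v' _]] /coded_inj; apply; exact: coded_code_diagram.
  move=> C; rewrite mem_enum; apply/andP/mapP => [[dC PC]|[c]].
    have [c [vc szc defC]] := connected_diagram_code dC; exists c => //.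
    by rewrite mem_filter mem_codes szc eqxx -defC PC vc le_nM.
  rewrite mem_filter mem_codes => /andP[/andP[/eqP sz Pc] /andP[v _]] ->.
  by rewrite code_diagram_connected // Pc.
by rewrite big_map.
Qed.

Section Weights.

Variables (K : fieldType) (phi f : nat -> K) (c : code).
Hypotheses (vc : valid c) (szc : csize c = n).

Let co := coded_code_diagram vc szc.

Lemma code_diagram_t1 : t 1 (code_diagram c) = first_label c.
Proof. exact: coded_t1 co. Qed.

Lemma code_diagram_weight_f : weight_f f (code_diagram c) = code_weight_f f c.
Proof. exact: coded_weight_f co. Qed.

Lemma code_diagram_weight_phi :
  weight_phi phi (code_diagram c) = (\prod_(v <- valences c) phi v)%R.
Proof.
have [<- _] := coded_tops co; have [mC _ _ _] := coded_diagram co.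
rewrite big_map -[RHS]/(\prod_(x <- realize c (enum 'I_n.*2)) phi (valence (code_diagram c) x))%R.
rewrite big_uniq /=; last exact: coded_uniq co.
apply: eq_big => [x|x xC]; first by rewrite inE.
by rewrite valencyE.
Qed.

Lemma code_diagram_cycle_free : top_cycle_free (code_diagram c) = cycle_free c.
Proof. exact: coded_cycle_free co. Qed.

End Weights.

End Diagrams.

(** * The functional equation *)

Import GRing.Theory.
Local Open Scope ring_scope.

Lemma first_label_gt0 c : (0 < first_label c)%N.
Proof. by case: c. Qed.

Lemma first_label_le c : (first_label c <= csize c)%N.
Proof. by elim: c => //= a _ e IHe _; have := csize_gt0 a; lia. Qed.

(** * Coefficientwise dependence and uniqueness *)

Section PowerSeriesFacts.

Variable K : fieldType.
Implicit Types (G H : fps {poly K}).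

Lemma eq_fps_mul (R : nzRingType) (F F' G G' : fps R) n :
    (forall i, (i <= n)%N -> F i = F' i) -> (forall i, (i <= n)%N -> G i = G' i) ->
  fps_mul F G n = fps_mul F' G' n.
Proof.
move=> eqF eqG; apply: eq_bigr => i _; rewrite eqF ?eqG ?leq_subr //.
by rewrite -ltnS.
Qed.

Lemma eq_fps_exp G H k n :
  (forall i, (i <= n)%N -> G i = H i) -> fps_exp G k n = fps_exp H k n.
Proof.
move=> eqG; suff: forall i, (i <= n)%N -> fps_exp G k i = fps_exp H k i by apply.
elim: k => // k IHk i le_in; apply: eq_fps_mul => j le_ji.
  by apply: eqG; apply: leq_trans le_in.
by apply: IHk; apply: leq_trans le_in.
Qed.

Lemma eq_fps_comp (phi : fps K) G H n :
  (forall i, (i <= n)%N -> G i = H i) -> fps_comp phi G n = fps_comp phi H n.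
Proof. by move=> eqG; apply: eq_bigr => k _; rewrite (eq_fps_exp _ eqG). Qed.

Lemma fps_exp_small G k n : G 0%N = 0 -> (n < k)%N -> fps_exp G k n = 0.
Proof.
move=> G0; elim: k n => // k IHk n; rewrite ltnS => le_nk.
rewrite [fps_exp G _ _]big1 // => -[[|i] lti] _ /=; first by rewrite G0 mul0r.
transitivity (G i.+1 * fps_exp G k (n - i.+1)%N) => //.
by rewrite IHk ?mulr0 //; lia.
Qed.

(** The factor x makes the coefficient of x^(n+1) a function of the coefficients up to x^n. *)
Lemma solution_unique (L : {poly K} -> {poly K}) (phi : fps K) G H :
  solution L phi G -> solution L phi H -> G =1 H.
Proof.
move=> [G0 solG] [H0 solH] n; elim/ltn_ind: n => -[|n] IHn; first by rewrite G0 H0.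
rewrite solG solH /= /fps_map; congr L; apply: eq_fps_comp => i le_in.
exact: IHn.
Qed.

End PowerSeriesFacts.

(** * Generating series of codes *)

Section CodeSums.

Variables (K : fieldType) (f : nat -> K) (M : nat).
(** [D] is d/dz or the difference quotient and [W c] the weight of [c] in K[z]; [good] selects the
    codes of the sum, and [ok] the gaps that keep a code good. *)
Variables (D : {linear {poly K} -> {poly K}}) (W : code -> {poly K}).
Variables (good : code -> bool) (ok : code -> nat -> bool).

Hypothesis good_Ins : forall a e g, good (Ins a e g) = [&& good a, good e & ok e g].
Hypothesis W_Ins : forall a e, valid a -> valid e -> good a -> good e ->
  \sum_(0 <= g < gaps e | ok e g) W (Ins a e g) = W a * D (W e).

(** The coefficient of x^n. The choice [h = f] gives the series P, and the indicator of j selects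
    the codes with t_1 = j + 1. *)
Definition code_sum (h : nat -> K) (n : nat) : {poly K} :=
  \sum_(c <- codes M | good c && (csize c == n))
    (h (first_label c - 1)%N * code_weight_f f c) *: W c.

Definition shift (h : nat -> K) (m : nat) : K := if m is m'.+1 then h m' else 0.

Lemma iter_shift j h m : iter j shift h m = if (m < j)%N then 0 else h (m - j)%N.
Proof. by elim: j m => [|j IHj] [|m] //=; rewrite IHj. Qed.

(* Inserting a into e raises the first label of e by one. *)
Lemma code_sum_shift h n : (n <= M)%N ->
  code_sum (shift h) n = \sum_(i < n.+1) code_sum f i * D (code_sum h (n - i)).
Proof.
move=> le_nM; pose T a e := ((f (first_label a - 1)%N * code_weight_f f a) *: W a) *
  D ((h (first_label e - 1)%N * code_weight_f f e) *: W e).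
transitivity (\sum_(a <- codes M) \sum_(e <- codes M)
    if [&& good a, good e & (csize a + csize e == n)%N] then T a e else 0).
  rewrite /code_sum (eq_bigl _ _ (fun c => andbC _ _)) big_mkcondr sum_codes //=.
  rewrite mul0r scale0r !if_same add0r !big_seq; apply: eq_bigr => a.
  rewrite mem_codes => /andP[va _]; rewrite big_mkcond !big_seq; apply: eq_bigr => e.
  rewrite mem_codes => /andP[ve _]; case: eqP => [sz|_]; last by rewrite !andbF.
  rewrite andbT; have [ga|nga] := boolP (good a); last first.
    by rewrite big1 // => g _; rewrite good_Ins (negPf nga).
  have [ge|nge] := boolP (good e); last first.
    by rewrite big1 // => g _; rewrite good_Ins (negPf nge) andbF.
  have -> : T a e = (f (first_label a - 1)%N * code_weight_f f a *
      (h (first_label e - 1)%N * code_weight_f f e)) *: (W a * D (W e)).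
    by rewrite /T linearZ /= -scalerAl -scalerAr scalerA.
  rewrite -W_Ins // scaler_sumr [RHS]big_mkcond; apply: eq_bigr => g _.
  rewrite good_Ins ga ge /=; case: ifP => // _; congr (_ *: _).
  have -> : shift h ((first_label e).+1 - 1)%N = h (first_label e - 1)%N.
    by rewrite subn1 /=; case: (first_label e) (first_label_gt0 e) => // m _; rewrite subn1.
  by ring.
transitivity (\sum_(i < n.+1) \sum_(a <- codes M) \sum_(e <- codes M)
    if [&& good a, csize a == i, good e & csize e == n - i]%N then T a e else 0); last first.
  apply: eq_bigr => i _; rewrite /code_sum linear_sum /= mulr_suml [RHS]big_mkcond.
  apply: eq_bigr => a _; case: (good a) => /=; last by rewrite big1_eq.
  case: (csize a == i) => /=; last by rewrite big1_eq.
  by rewrite mulr_sumr [RHS]big_mkcond.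
rewrite [RHS]exchange_big; apply: eq_bigr => a _.
rewrite [RHS]exchange_big; apply: eq_bigr => e _ /=; case: (good a) => /=; last by rewrite big1_eq.
case: (good e) => /=; last by rewrite big1 // => i _; rewrite andbF.
case: eqP => sz.
  have lt_a : (csize a < n.+1)%N by rewrite ltnS -sz leq_addr.
  have e_eq : csize e == (n - csize a)%N by rewrite -sz addKn.
  rewrite (bigD1 (Ordinal lt_a)) //= eqxx e_eq big1 ?addr0 // => i ne_i.
  by case: eqP => // eq_i; case/eqP: ne_i; apply: val_inj.
rewrite big1 // => i _; case: eqP => //= eq_i; case: eqP => // eq_e.
by case: sz; have := ltn_ord i; lia.
Qed.

Lemma code_sum0 h : code_sum h 0 = 0.
Proof.
rewrite /code_sum big_pred0 // => c; have := csize_gt0 c.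
by case: (csize c) => // m _; rewrite andbF.
Qed.

End CodeSums.

(** * The flow as a ring morphism *)

Section Flow.

Variables (K : fieldType) (D : {linear {poly K} -> {poly K}}).

(* Polynomials in x with coefficients in K[z]; D acts on K[z]. *)
Definition delta (P a : {poly {poly K}}) : {poly {poly K}} := P * map_poly D a.

Lemma coef_delta P a n : (delta P a)`_n = \sum_(i < n.+1) P`_i * D a`_(n - i).
Proof. by rewrite coefM; apply: eq_bigr => i _; rewrite coef_map_id0 ?linear0. Qed.

Variable N : nat -> K.

(** The coefficient of x^n y^J in the sum over J of y^J (P D)^J a / [N J] at z = 0: an exponential
    for [N J] = J!, a geometric series for [N J] = 1. *)
Definition flow_coef (P : {poly {poly K}}) J (a : {poly {poly K}}) n : K := ((iter J (delta P) a)`_n)`_0 / N J.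

Definition flow (P a : {poly {poly K}}) : fps {poly K} := fun n => \poly_(J < n.+1) flow_coef P J a n.

(** Each application of [delta P] raises the order in x, so the bound on J in [flow] cuts nothing
    off. *)
Lemma iter_delta_eq0 (P : {poly {poly K}}) J a n : P`_0 = 0 -> (n < J)%N -> (iter J (delta P) a)`_n = 0.
Proof.
move=> P0; elim: J n => // J IHJ n; rewrite ltnS /= coef_delta => le_nJ.
rewrite big1 // => -[[|i] lti] _ /=; first by rewrite P0 mul0r.
by rewrite IHJ ?linear0 ?mulr0 //; lia.
Qed.

Lemma coef_flow (P : {poly {poly K}}) a J n : P`_0 = 0 -> (flow P a n)`_J = flow_coef P J a n.
Proof.
move=> P0; rewrite coef_poly ltnS; case: leqP => // lt_nJ.
by rewrite /flow_coef iter_delta_eq0 // coef0 mul0r.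
Qed.

Lemma iter_delta_sum P J (I : finType) (c : I -> K) (a : I -> {poly {poly K}}) n :
  (iter J (delta P) (\sum_i (c i)%:P *: a i))`_n =
  \sum_i c i *: (iter J (delta P) (a i))`_n.
Proof.
elim: J n => [|J IHJ] n.
  by rewrite coef_sum; apply: eq_bigr => i _; rewrite coefZ mul_polyC.
rewrite iterS coef_delta; transitivity (\sum_(k < n.+1) \sum_i
    c i *: (P`_k * D (iter J (delta P) (a i))`_(n - k))).
  apply: eq_bigr => k _; rewrite IHJ linear_sum mulr_sumr; apply: eq_bigr => i _.
  by rewrite linearZ /= scalerAr.
rewrite exchange_big; apply: eq_bigr => i _; rewrite iterS coef_delta scaler_sumr.
exact: eq_bigr.
Qed.

Lemma iter_delta_mulX P J a : iter J (delta P) ('X * a) = 'X * iter J (delta P) a.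
Proof.
elim: J => //= J ->; rewrite /delta [RHS]mulrCA; congr (_ * _).
apply/polyP => n; rewrite coefXM !coef_map_id0 ?linear0 // coefXM.
by case: n => [|n] /=; rewrite ?linear0 // coef_map_id0 ?linear0.
Qed.

Hypothesis N0 : N 0%N = 1.
Hypothesis D_1 : D 1 = 0.

(* The only property of D that is used: after normalization by N, its
   iterates, evaluated at z = 0, satisfy the Leibniz rule. *)
Hypothesis flow_coefM : forall (P a b : {poly {poly K}}) J n, P`_0 = 0 -> flow_coef P J (a * b) n =
  \sum_(j < J.+1) \sum_(i < n.+1) flow_coef P j a i * flow_coef P (J - j) b (n - i).

Variable P : {poly {poly K}}.
Hypothesis P0 : P`_0 = 0.

Lemma flowM a b n : flow P (a * b) n = fps_mul (flow P a) (flow P b) n.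
Proof.
apply/polyP => J; rewrite coef_flow // flow_coefM // coef_sum exchange_big.
apply: eq_bigr => i _; rewrite coefM; apply: eq_bigr => j _.
by rewrite !coef_flow.
Qed.

Lemma flow1 n : flow P 1 n = fps_one {poly K} n.
Proof.
have d1 : delta P 1 = 0.
  rewrite /delta (_ : map_poly D 1 = 0) ?mulr0 //; apply/polyP => i.
  by rewrite coef_map_id0 ?linear0 // coef1 coef0; case: eqP; rewrite ?D_1 ?linear0.
have dJ J : iter J (delta P) 0 = 0.
  elim: J => //= J ->; rewrite /delta (_ : map_poly D 0 = 0) ?mulr0 //.
  by apply/polyP => i; rewrite coef_map_id0 ?linear0 // !coef0 linear0.
apply/polyP => J; rewrite coef_flow // /flow_coef /fps_one.
case: J => [|J]; last by rewrite iterSr d1 dJ !coef0 mul0r; case: eqP; rewrite ?coef1 ?coef0.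
by rewrite /= N0 divr1 coef1; case: eqP => _; rewrite ?coef1 ?coef0.
Qed.

Lemma flowX a k n : flow P (a ^+ k) n = fps_exp (flow P a) k n.
Proof.
elim: k n => [|k IHk] n; first exact: flow1.
by rewrite exprS flowM; apply: eq_fps_mul.
Qed.

(** Linearity and multiplicativity let the flow pass through a polynomial in z; powers beyond n do
    not contribute because the flow of z has no constant term in x. *)
Lemma flow_poly (phi : nat -> K) B n : (n <= B)%N -> flow P 'X%:P 0%N = 0 ->
  flow P (\poly_(k < B.+1) phi k)%:P n = fps_comp phi (flow P 'X%:P) n.
Proof.
move=> le_nB F0; have -> : (\poly_(k < B.+1) phi k)%:P =
    \sum_(k < B.+1) (phi k)%:P *: ('X%:P ^+ k) :> {poly {poly K}}.
  rewrite poly_def rmorph_sum; apply: eq_bigr => k _.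
  by rewrite -mul_polyC rmorphM /= -[(phi k)%:P%:P * _]/(_) mul_polyC rmorphXn.
transitivity (\sum_(k < B.+1) phi k *: fps_exp (flow P 'X%:P) k n).
  apply/polyP => J; rewrite coef_flow // /flow_coef iter_delta_sum !coef_sum mulr_suml.
  by apply: eq_bigr => k _; rewrite -flowX !coefZ coef_flow // mulrA.
have le_nB1 : (n.+1 <= B.+1)%N by [].
rewrite /fps_comp (big_ord_widen _ (fun k => phi k *: fps_exp (flow P 'X%:P) k n) le_nB1).
rewrite [RHS]big_mkcond.
apply: eq_bigr => k _; case: ltnP => // lt_nk.
by rewrite fps_exp_small ?scaler0.
Qed.

End Flow.

(** * The functional equation for sums over codes *)

Section CodeSolution.

Variables (K : fieldType) (f phi : nat -> K) (M B : nat).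
Variables (D : {linear {poly K} -> {poly K}}) (W : code -> {poly K}).
Variables (good : code -> bool) (ok : code -> nat -> bool) (N : nat -> K).
Variable L : {poly K} -> {poly K}.

Hypothesis good_One : good One.
Hypothesis good_Ins : forall a e g, good (Ins a e g) = [&& good a, good e & ok e g].
Hypothesis W_Ins : forall a e, valid a -> valid e -> good a -> good e ->
  \sum_(0 <= g < gaps e | ok e g) W (Ins a e g) = W a * D (W e).
Hypothesis W_One : W One = \poly_(k < B.+1) phi k.
Hypothesis le_MB : (M <= B)%N.
Hypothesis N0 : N 0%N = 1.
Hypothesis D_1 : D 1 = 0.
Hypothesis D_X : D 'X = 1.
Hypothesis flow_coefM : forall (P a b : {poly {poly K}}) J n, P`_0 = 0 -> flow_coef D N P J (a * b) n =
  \sum_(j < J.+1) \sum_(i < n.+1) flow_coef D N P j a i * flow_coef D N P (J - j) b (n - i).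
Hypothesis L_linear : forall a p q, L (a *: p + q) = a *: L p + L q.
(** After division by [N J], both operators act on monomials by this same formula. *)
Hypothesis L_X : forall J,
  (N J)^-1 *: L 'X^J = \sum_(j < J.+1) (f (J - j)%N / N j.+1) *: 'X^(j.+1).

Let P := \poly_(n < M.+1) code_sum f M W good f n.

Lemma code_sum_poly0 : P`_0 = 0.
Proof. by rewrite coef_poly /= code_sum0. Qed.

Lemma coef_iter_delta (a : {poly {poly K}}) h J n : (forall i, (i <= M)%N -> a`_i = code_sum f M W good h i) ->
    (n <= M)%N ->
  (iter J (delta D P) a)`_n = code_sum f M W good (iter J (@shift K) h) n.
Proof.
move=> ah; elim: J n => [|J IHJ] n le_nM; first exact: ah.
rewrite /= coef_delta (code_sum_shift f good_Ins W_Ins) //; apply: eq_bigr => i _.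
have le_in : (i <= n)%N by rewrite -ltnS.
rewrite coef_poly ltnS (leq_trans le_in le_nM) IHJ //.
by apply: leq_trans le_nM; apply: leq_subr.
Qed.

Definition code_solution (n : nat) : {poly K} :=
  \sum_(c <- codes M | good c && (csize c == n))
    (code_weight_f f c * (W c)`_0) *: ((N (first_label c - 1))^-1 *: L 'X^(first_label c - 1)).

Lemma delta_X : delta D P 'X%:P = P.
Proof.
rewrite /delta (_ : map_poly D _ = 1) ?mulr1 //; apply/polyP => i.
rewrite coef_map_id0 ?linear0 // coefC coef1; by case: eqP; rewrite ?D_X ?linear0.
Qed.

(** As D z = 1, the first application of [delta P] to z gives P, the series with [h = f], which J
    more applications shift. So y^(J+1) comes with f (t_1 - 1 - J) / [N J.+1], and by [L_X] these
    terms add up to L(y^(t_1 - 1)) / [N (t_1 - 1)]. *)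
Lemma flow_X n : (n <= M)%N -> flow D N P 'X%:P n = code_solution n.
Proof.
move=> le_nM; have coefP J : (iter J.+1 (delta D P) 'X%:P)`_n =
    code_sum f M W good (iter J (@shift K) f) n.
  rewrite iterSr delta_X; apply: coef_iter_delta => // i le_iM.
  by rewrite coef_poly ltnS le_iM.
have flowS J : flow_coef D N P J.+1 'X%:P n =
    \sum_(c <- codes M | good c && (csize c == n))
      (code_weight_f f c * (W c)`_0) *
      ((if (first_label c - 1 < J)%N then 0 else f (first_label c - 1 - J)%N) / N J.+1).
  rewrite /flow_coef coefP /code_sum coef_sum mulr_suml; apply: eq_bigr => c _.
  by rewrite coefZ iter_shift; ring.
rewrite /flow poly_def big_ord_recl {1}/flow_coef /= coefC.
rewrite (_ : (if n == 0%N then 'X else 0)`_0 = 0 :> K); last by case: eqP; rewrite ?coefX ?coef0.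
rewrite mul0r scale0r add0r /code_solution.
under eq_bigr => J _ do rewrite flowS scaler_suml.
rewrite exchange_big; apply: eq_bigr => c /andP[_ /eqP szc].
rewrite L_X scaler_sumr.
have le_n : ((first_label c - 1).+1 <= n)%N.
  by have := first_label_le c; have := first_label_gt0 c; lia.
rewrite (big_ord_widen n (fun j => (code_weight_f f c * (W c)`_0) *:
  ((f (first_label c - 1 - j)%N / N j.+1) *: 'X^(j.+1))) le_n) [RHS]big_mkcond.
apply: eq_bigr => j _; rewrite ltnS ltnNge /bump /=.
by rewrite add1n; case: (j <= _)%N; rewrite /= ?mul0r ?mulr0 ?scale0r ?scalerA.
Qed.

Lemma L_sum (I : Type) (r : seq I) (Q : pred I) (c : I -> K) (p : I -> {poly K}) :
  L (\sum_(i <- r | Q i) c i *: p i) = \sum_(i <- r | Q i) c i *: L (p i).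
Proof.
have L0 : L 0 = 0 by have := L_linear (-1) 0 0; rewrite scaler0 addr0 scaleN1r addNr.
by elim/big_rec2: _ => [|i x y _ <-].
Qed.

(** Only [One] has first label 1, so x phi(z) is the series whose [h] is the indicator of 0. The
    factor x commutes with [delta P] and accounts for the passage from n to n + 1. *)
Lemma flow_phi n : (n < M)%N -> L (flow D N P (W One) %:P n) = code_solution n.+1.
Proof.
move=> lt_nM; pose h m : K := (m == 0%N)%:R.
have coefX i : (i <= M)%N -> ('X * (W One)%:P)`_i = code_sum f M W good h i.
  move=> le_iM; rewrite coefXM coefC /code_sum.
  rewrite (eq_bigl _ _ (fun c => andbC _ _)) big_mkcondr sum_codes //= good_One.
  rewrite [X in _ + X]big1 => [|a _]; last first.
    rewrite big1 // => e _; rewrite big1 // => g _; rewrite /h subn1 /=.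
    by case: (first_label e) (first_label_gt0 e) => // m _; rewrite mul0r scale0r if_same.
  by rewrite addr0 /h subnn mulr1 scale1r; case: i le_iM => [|[|i]].
have coefP J : (iter J (delta D P) (W One)%:P)`_n = code_sum f M W good (iter J (@shift K) h) n.+1.
  by rewrite -(coef_iter_delta J coefX lt_nM) iter_delta_mulX coefXM.
have -> : flow D N P (W One)%:P n = \sum_(c <- codes M | good c && (csize c == n.+1))
    (code_weight_f f c * (W c)`_0 / N (first_label c - 1)%N) *: 'X^(first_label c - 1).
  rewrite /flow poly_def; under eq_bigr => J _.
    rewrite /flow_coef coefP /code_sum coef_sum mulr_suml scaler_suml.
    under eq_bigr => c _ do rewrite coefZ iter_shift.
    over.
  rewrite exchange_big; apply: eq_bigr => c /andP[_ /eqP szc].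
  have lt_n : (first_label c - 1 < n.+1)%N.
    by have := first_label_le c; have := first_label_gt0 c; lia.
  rewrite (bigD1 (Ordinal lt_n)) //= ltnn subnn /h eqxx mul1r big1 ?addr0 // => J ne_J.
  have ne : (J != first_label c - 1 :> nat)%N.
    by apply: contraNneq ne_J => eqJ; apply/eqP/val_inj.
  case: ltnP => [_|le_J]; first by rewrite !mul0r scale0r.
  by rewrite subn_eq0 leqNgt ltn_neqAle ne le_J !mul0r scale0r.
by rewrite L_sum; apply: eq_bigr => c _; rewrite scalerA.
Qed.

Lemma code_solution0 : code_solution 0 = 0.
Proof.
rewrite /code_solution big_pred0 // => c; have := csize_gt0 c.
by case: (csize c) => // m _; rewrite andbF.
Qed.

Lemma code_solutionS n : (n < M)%N ->
  code_solution n.+1 = L (fps_comp phi code_solution n).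
Proof.
move=> lt_nM; rewrite -flow_phi // W_One.
rewrite flow_poly ?code_sum_poly0 ?flow_X ?code_solution0 //; last exact: leq_trans (ltnW lt_nM) le_MB.
congr L; apply: eq_fps_comp => i le_in; apply: flow_X.
exact: leq_trans le_in (ltnW lt_nM).
Qed.

End CodeSolution.

(** * Leibniz rules for the derivative and the difference quotient *)

Section Leibniz.

Variable K : fieldType.
Implicit Types (P a b u v : {poly {poly K}}).

Lemma delta_deriv P a b :
  delta (@deriv K) P (a * b) = delta (@deriv K) P a * b + a * delta (@deriv K) P b.
Proof.
rewrite /delta -mulrA [a * (P * _)]mulrCA -mulrDr; congr (_ * _); apply/polyP => n.
rewrite coef_map_id0 ?linear0 // coefD !coefM linear_sum -big_split /=.
by apply: eq_bigr => i _; rewrite derivM !coef_map_id0 ?linear0.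
Qed.

Lemma deltaMn (D : {linear {poly K} -> {poly K}}) P (I : Type) (r : seq I) (a : I -> {poly {poly K}}) (m : I -> nat) :
  delta D P (\sum_(i <- r) a i *+ m i) = \sum_(i <- r) delta D P (a i) *+ m i.
Proof.
rewrite /delta; under [RHS]eq_bigr => i _ do rewrite -mulrnAr.
rewrite -mulr_sumr; congr (_ * _); apply/polyP => n.
rewrite coef_map_id0 ?linear0 // !coef_sum linear_sum; apply: eq_bigr => i _.
by rewrite !coefMn linearMn coef_map_id0 ?linear0.
Qed.

Lemma iter_delta_deriv P a b J : iter J (delta (@deriv K) P) (a * b) =
  \sum_(j < J.+1) (iter j (delta (@deriv K) P) a * iter (J - j) (delta (@deriv K) P) b) *+ 'C(J, j).
Proof.
set d := delta _ P; elim: J => [|J IHJ]; first by rewrite big_ord1.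
have dM u v : d (u * v) = d u * v + u * d v by apply: delta_deriv.
rewrite iterS IHJ {1}/d deltaMn -/d.
under eq_bigr => j _ do rewrite dM mulrnDl -iterS -[d (iter (J - j) d b)]iterS.
rewrite big_split /= [in RHS]big_ord_recl /= bin0 mulr1n ?subn0.
under [in RHS]eq_bigr => j _ do rewrite /bump /= add1n subSS binS mulrnDr.
rewrite big_split /= addrA [RHS]addrC; congr (_ + _).
rewrite big_ord_recl /= bin0 mulr1n ?subn0; congr (_ + _).
rewrite [RHS]big_ord_recr /= bin_small // mulr0n addr0.
apply: eq_bigr => j _; rewrite /bump /= add1n.
have -> : (J - j = (J - j.+1).+1)%N by rewrite -subSn ?subSS // ltn_ord.
by [].
Qed.

Lemma flow_coefM_bin (charK0 : [pchar K] =i pred0) P a b J n : P`_0 = 0 ->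
  let N j : K := j`!%:R in
  flow_coef (@deriv K) N P J (a * b) n = \sum_(j < J.+1) \sum_(i < n.+1)
    flow_coef (@deriv K) N P j a i * flow_coef (@deriv K) N P (J - j) b (n - i).
Proof.
move=> _ N; have nz j : N j != 0.
  by rewrite /N ((pcharf0P _).1 charK0) -lt0n fact_gt0.
rewrite /flow_coef iter_delta_deriv !coef_sum mulr_suml; apply: eq_bigr => j _.
rewrite !coefMn coefM coef_sum -mulr_natr -mulrA mulr_suml; apply: eq_bigr => i _.
rewrite coef0M.
have -> : 'C(J, j)%:R = N J / (N j * N (J - j)%N) :> K.
  apply: (canRL (mulfK _)); first by rewrite mulf_neq0.
  by rewrite /N -!natrM bin_fact // -ltnS.
by field; rewrite !nz.
Qed.

Notation D1 := (@drop_poly K 1).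

(** Evaluation at z = 0 with values kept in K[z]; [delta] for the difference quotient is linear over
    such values. *)
Definition const_coef : {poly {poly K}} -> {poly {poly K}} := map_poly (fun p : {poly K} => (p`_0)%:P).

Lemma coef_const_coef a i : (const_coef a)`_i = ((a`_i)`_0)%:P.
Proof. by rewrite coef_map_id0 // coef0. Qed.

Lemma drop_polyM (p q : {poly K}) : D1 (p * q) = D1 p * q + (p`_0)%:P * D1 q.
Proof.
apply/polyP => i; rewrite coef_drop_poly coefD coefM coefCM coef_drop_poly addn1.
rewrite big_ord_recl subn0 addrC; congr (_ + _); rewrite coefM; apply: eq_bigr => j _.
by rewrite coef_drop_poly addn1 subSS.
Qed.

Lemma delta_drop P a b : delta D1 P (a * b) = delta D1 P a * b + const_coef a * delta D1 P b.
Proof.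
rewrite /delta -mulrA [const_coef a * (P * _)]mulrCA -mulrDr; congr (_ * _); apply/polyP => n.
rewrite coef_map_id0 ?linear0 // coefD !coefM linear_sum -big_split /=.
apply: eq_bigr => i _; rewrite drop_polyM !coef_const_coef.
by rewrite [in RHS]coef_map_id0 ?linear0 // [in RHS]coef_map_id0 ?linear0.
Qed.

Lemma delta_const_coef P u v : delta D1 P (const_coef u * v) = const_coef u * delta D1 P v.
Proof.
rewrite delta_drop [X in X * v + _](_ : _ = 0) ?mul0r ?add0r.
  congr (_ * _); apply/polyP => i; by rewrite !coef_const_coef coefC.
rewrite /delta (_ : map_poly _ _ = 0) ?mulr0 //; apply/polyP => i.
rewrite coef_map_id0 ?linear0 // coef_const_coef coef0 /= drop_poly_eq0 //.
exact: size_polyC_leq1.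
Qed.

(** The rule [delta_drop] is asymmetric in a and b. At z = 0 the asymmetry disappears: the first
    summand becomes the missing term j = J of the sum. *)
Lemma iter_delta_drop P a b J : iter J (delta D1 P) (a * b) =
  iter J (delta D1 P) a * b +
  \sum_(j < J) const_coef (iter j (delta D1 P) a) * iter (J - j) (delta D1 P) b.
Proof.
set d := delta _ P; elim: J => [|J IHJ]; first by rewrite big_ord0 addr0.
have dD u v : d (u + v) = d u + d v.
  rewrite /d /delta -mulrDr; congr (_ * _); apply/polyP => i.
  by rewrite coefD !coef_map_id0 ?linear0 // coefD linearD.
have d_sum (F : 'I_J -> {poly {poly K}}) : d (\sum_(j < J) F j) = \sum_(j < J) d (F j).
  have d0 : d 0 = 0.
    by rewrite /d /delta (_ : map_poly _ 0 = 0) ?mulr0 // map_poly0.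
  by elim/big_rec2: _ => [|j x y _ <-].
rewrite iterS IHJ dD d_sum {1}/d delta_drop -/d big_ord_recr /= subSnn -addrA; congr (_ + _).
rewrite addrC; congr (_ + _); apply: eq_bigr => j _.
by rewrite /d delta_const_coef -/d -iterS subSn // ltnW.
Qed.

Lemma flow_coefM_div P a b J n : P`_0 = 0 ->
  let N (j : nat) : K := 1 in
  flow_coef D1 N P J (a * b) n = \sum_(j < J.+1) \sum_(i < n.+1)
    flow_coef D1 N P j a i * flow_coef D1 N P (J - j) b (n - i).
Proof.
move=> _ N; rewrite /flow_coef iter_delta_drop coefD coef_sum coefD coef_sum divr1.
rewrite [RHS]big_ord_recr subnn /= addrC; congr (_ + _).
  by rewrite coefM coef_sum; apply: eq_bigr => i _; rewrite coef0M !divr1.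
apply: eq_bigr => j _; rewrite coefM coef_sum; apply: eq_bigr => i _.
by rewrite coef0M coef_const_coef coefC /= !divr1.
Qed.

End Leibniz.

(** * Linearity of the operators and their values on monomials *)

Section Operators.

Variable K : fieldType.
Implicit Types (f : fps K) (p q : {poly K}).

(** [apply_series] stops at the size of its argument. The three sums are extended to a common
    length, the added terms vanishing because D lowers degrees. *)
Lemma apply_series_linear f (D : {linear {poly K} -> {poly K}}) :
    (forall p i, (size p <= i)%N -> iter i D p = 0) ->
  forall (a : K) p q, apply_series f D (a *: p + q) = a *: apply_series f D p + apply_series f D q.
Proof.
move=> D0 a p q; pose n := maxn (size (a *: p + q)) (maxn (size p) (size q)).
have wide (p' : {poly K}) : (size p' <= n)%N ->
    apply_series f D p' = \sum_(i < n) f i *: iter i D p'.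
  move=> le_n; rewrite /apply_series.
  rewrite (big_ord_widen n (fun i : nat => f i *: iter i D p') le_n) big_mkcond.
  by apply: eq_bigr => i _; case: ltnP => // /D0->; rewrite scaler0.
rewrite !wide ?leq_max ?leqnn ?orbT // scaler_sumr -big_split; apply: eq_bigr => i _ /=.
have iterD j : iter j D (a *: p + q) = a *: iter j D p + iter j D q.
  by elim: j => //= j ->; rewrite linearP.
by rewrite iterD scalerDr !scalerA mulrC.
Qed.

Lemma Lbin_linear f (a : K) p q : Lbin f (a *: p + q) = a *: Lbin f p + Lbin f q.
Proof.
rewrite /Lbin apply_series_linear ?integralZD // => {}p i le_i.
exact: derivn_poly0.
Qed.

Lemma Ldiv_linear f (a : K) p q : Ldiv f (a *: p + q) = a *: Ldiv f p + Ldiv f q.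
Proof.
rewrite /Ldiv (@apply_series_linear f (drop_poly 1)) ?mulrDr ?scalerAr // => {}p i le_i.
have iterE j p' : iter j (drop_poly 1) p' = drop_poly j p' :> {poly K}.
  elim: j => [|j IHj]; first by rewrite drop_poly0l.
  by rewrite iterS IHj; apply/polyP => k; rewrite !coef_drop_poly addn1 addSnnS.
by rewrite iterE drop_poly_eq0.
Qed.

Lemma Lbin_X f (charK0 : [pchar K] =i pred0) J :
  (J`!%:R)^-1 *: Lbin f 'X^J = \sum_(j < J.+1) (f (J - j)%N / (j.+1)`!%:R) *: 'X^(j.+1).
Proof.
rewrite LbinXn // scalerA mulVf ?scale1r.
  by rewrite big_add1 big_mkord; apply: eq_bigr => j _; rewrite subSS.
by rewrite ((pcharf0P _).1 charK0) -lt0n fact_gt0.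
Qed.

Lemma Ldiv_X f J :
  1^-1 *: Ldiv f 'X^J = \sum_(j < J.+1) (f (J - j)%N / 1) *: 'X^(j.+1).
Proof.
rewrite LdivXn invr1 scale1r big_add1 big_mkord.
by apply: eq_bigr => j _; rewrite subSS mulr1.
Qed.

End Operators.

(** A chord of valency v is the top one in v + 1 of the 2m - 1 gaps. Hence cutting [phi] at degree
    2m changes no weight of a diagram of size m. *)
Lemma valences_lt c v : valid c -> v \in valences c -> (v < (csize c).*2)%N.
Proof.
move=> vc /(nthP 0%N)[i]; rewrite size_valences // => lti <-.
have := count_size (pred1 i) (gap_tops c).
rewrite count_gap_tops // size_gap_tops // => le_v; apply: leq_trans le_v _.
by rewrite leq_pred.
Qed.

(** * Weights of codes for the binomial operator *)

Section Binomial.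

Variables (K : fieldType) (p : {poly K}).

Definition bin_weight (vs : seq nat) : {poly K} := \prod_(v <- vs) p^`N(v).

(** The factor [v.+1] is the number of gaps whose top chord is a given chord of valency v; this is
    why Taylor coefficients are the right weights. *)
Lemma deriv_nderivn v : p^`N(v)^`() = p^`N(v.+1) *+ v.+1.
Proof.
apply/polyP => i; rewrite coef_deriv coefMn !coef_nderivn -!mulrnA addnS addSn.
congr (_ *+ _); rewrite [RHS]mulnC mul_bin_left mulnC; congr (_ * _)%N.
by rewrite -addnS addKn.
Qed.

Lemma deriv_bin_weight vs :
  (bin_weight vs)^`() = \sum_(k < size vs) bin_weight (incr_nth vs k) *+ (nth 0%N vs k).+1.
Proof.
rewrite /bin_weight; elim: vs => [|v vs IHvs]; first by rewrite big_nil big_ord0 derivC.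
rewrite big_cons derivM IHvs deriv_nderivn big_ord_recl /= big_cons mulrnAl mulr_sumr.
congr (_ + _); apply: eq_bigr => k _ /=.
by rewrite big_cons mulrnAr.
Qed.

Lemma sum_count (R : nmodType) (F : nat -> R) n (s : seq nat) : all (fun k => k < n)%N s ->
  \sum_(k <- s) F k = \sum_(i < n) F i *+ count_mem (i : nat) s.
Proof.
elim: s => [_|k s IHs /= /andP[ltk /IHs IH]].
  by rewrite big_nil big1 // => i _; rewrite mulr0n.
rewrite big_cons IH; under [RHS]eq_bigr => i _ do rewrite mulrnDr.
rewrite [RHS]big_split /=; congr (_ + _).
rewrite (bigD1 (Ordinal ltk)) //= eqxx mulr1n big1 ?addr0 // => i ne_ik.
suff -> : (k == i :> nat) = false by rewrite mulr0n.
by apply: contraNF ne_ik => /eqP eq_ki; apply/eqP/val_inj.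
Qed.

Lemma bin_weight_Ins a e : valid a -> valid e ->
  \sum_(0 <= g < gaps e) bin_weight (valences (Ins a e g)) =
  bin_weight (valences a) * (bin_weight (valences e))^`().
Proof.
move=> va ve; pose F k := bin_weight (valences a) * bin_weight (incr_nth (valences e) k).
transitivity (\sum_(k <- gap_tops e) F k).
  rewrite [RHS](big_nth 0%N) size_gap_tops //; apply: eq_bigr => g _.
  by rewrite /F /bin_weight /= big_cat /= mulrC.
rewrite (sum_count F (gap_tops_lt ve)) deriv_bin_weight size_valences // mulr_sumr.
by apply: eq_bigr => k _; rewrite count_gap_tops // mulrnAr.
Qed.

End Binomial.

(** * Weights of codes for the divided power operator *)

Section Divided.

Variables (K : fieldType) (p : {poly K}).

(* An active chord may still gain children, the valency of an inactive one is final. *)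
Definition div_factor (b : bool) (v : nat) : {poly K} :=
  if b then drop_poly v p else (p`_v)%:P.

Definition div_weight (act : seq nat) (vs : seq nat) : {poly K} :=
  \prod_(i < size vs) div_factor ((i : nat) \in act) (nth 0%N vs i).

Definition active_tops (c : code) : seq nat := mask (active c) (gap_tops c).

(** [drop_poly v p] is the v-fold difference quotient of p. The rule [drop_polyM] is expanded along
    the active gaps: choosing gap g fixes the chords active only before it, raises the valency of
    its own chord, which stays active, and leaves the later ones alone. *)
Lemma sum_active (vs L : seq nat) (act : seq bool) :
    size act = size L -> uniq (mask act L) -> all (fun k => k < size vs)%N L ->
  \sum_(0 <= g < size L | nth false act g)
    \prod_(i < size vs) div_factor ((i : nat) \in mask (drop g act) (drop g L))
      (nth 0%N (incr_nth vs (nth 0%N L g)) i) =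
  drop_poly 1 (div_weight (mask act L) vs).
Proof.
elim: L act => [|x L IHL] [|b act] //= => [_ _ _|[szact] uniqL /andP[ltx allL]].
  (* Without active chords every factor is constant, so the difference quotient of the product
     vanishes. *)
  rewrite big_geq // /div_weight drop_poly_eq0 //.
  elim/big_ind: _ => [|u v|i _]; first by rewrite size_poly1.
    move=> /size1_polyC-> /size1_polyC->; rewrite -polyCM; exact: size_polyC_leq1.
  exact: size_polyC_leq1.
rewrite big_mkcond big_ltn //= big_add1 /= -big_mkcond.
have uniqL' : uniq (mask act L) by case: b uniqL => //= /andP[].
rewrite IHL //; case: b uniqL => /= [/andP[xM _]|_]; last by rewrite add0r.
rewrite /div_weight (bigD1 (Ordinal ltx)) //= [in RHS](bigD1 (Ordinal ltx)) //=.
rewrite mem_head drop_polyM nth_incr_nth eqxx /= coef_drop_poly.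
have dropS : drop_poly 1 (drop_poly (nth 0%N vs x) p) = drop_poly (nth 0%N vs x).+1 p.
  by apply/polyP => i; rewrite !coef_drop_poly addn1 addSnnS.
rewrite dropS; congr (_ * _ + _).
  apply: eq_bigr => i ne_ix; rewrite nth_incr_nth.
  suff -> : (x == i :> nat) = false by [].
  by apply: contraNF ne_ix => /eqP eq_xi; apply/eqP/val_inj.
rewrite (bigD1 (Ordinal ltx)) //= (negPf xM) {1 3}/div_factor !mul_polyC drop_polyZ add0n; congr (_ *: drop_poly _ _); apply: eq_bigr => i ne_ix.
rewrite in_cons (_ : (i == x :> nat) = false) //.
by apply: contraNF ne_ix => /eqP eq_xi; apply/eqP/val_inj.
Qed.

Lemma active_tops_Ins a e g : valid a -> valid e -> (g < gaps e)%N ->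
  active_tops (Ins a e g) = [seq (csize e + k)%N | k <- active_tops a] ++
    mask (drop g (active e)) (drop g (gap_tops e)).
Proof.
move=> va ve lt_g; have [sza sta] := (size_active va, size_gap_tops va).
have ste := size_gap_tops ve; have act0 : head false (active a) by case: (a).
rewrite /active_tops map_mask.
have -> : active (Ins a e g) =
  true :: nseq g.+1 false ++ behead (active a) ++ drop g (active e) by [].
pose ta := [seq (csize e + k)%N | k <- gap_tops a]; rewrite -/ta.
have -> : gap_tops (Ins a e g) = head 0%N ta :: take g.+1 (gap_tops e) ++ behead ta ++
  drop g (gap_tops e) by [].
rewrite mask_cons mask_cat; last by rewrite size_nseq size_takel // ste.
rewrite mask_false cat0s mask_cat; last by rewrite !size_behead size_map sza sta.
have : size (active a) = size ta by rewrite size_map sza.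
by case: (active a) act0 => //= b act ->; case: (ta).
Qed.

(** Although gap [g] of [e] is split in two, its left half becomes inactive, so no chord of [e] gets
    a second active gap. *)
Lemma active_tops_uniq c : valid c -> cycle_free c ->
  uniq (active_tops c) /\ all (fun k => k < csize c)%N (active_tops c).
Proof.
elim: c => // a IHa e IHe g /and3P[va ve lt_g] /and3P[ca ce act_g].
have [[ua alla] [ue alle]] := (IHa va ca, IHe ve ce).
have sub : subseq (mask (drop g (active e)) (drop g (gap_tops e))) (active_tops e).
  rewrite /active_tops -{2}(cat_take_drop g (active e)) -{2}(cat_take_drop g (gap_tops e)).
  rewrite mask_cat ?suffix_subseq // !size_takel ?size_active ?size_gap_tops // ltnW //.
have all_e : all (fun k => k < csize e)%N (mask (drop g (active e)) (drop g (gap_tops e))).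
  by apply/allP => k /(mem_subseq sub)/(allP alle).
rewrite active_tops_Ins //; split.
  rewrite cat_uniq map_inj_uniq; last by move=> k l /addnI.
  rewrite ua (subseq_uniq sub ue) andbT /=; apply/hasPn => k /(allP all_e) ltk.
  by apply/mapP => -[l _ defk]; rewrite defk ltnNge leq_addr in ltk.
rewrite all_cat all_map; apply/andP; split.
  by apply: sub_all alla => k /=; rewrite addnC ltn_add2r.
by apply: sub_all all_e => k /leq_trans; apply; apply: leq_addl.
Qed.

Lemma div_weight_Ins a e : valid a -> valid e -> cycle_free a -> cycle_free e ->
  \sum_(0 <= g < gaps e | nth false (active e) g)
    div_weight (active_tops (Ins a e g)) (valences (Ins a e g)) =
  div_weight (active_tops a) (valences a) *
    drop_poly 1 (div_weight (active_tops e) (valences e)).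
Proof.
move=> va ve ca ce; have [ue alle] := active_tops_uniq ve ce.
have [sva sve] := (size_valences va, size_valences ve).
have ste := size_gap_tops ve; have szact : size (active e) = size (gap_tops e).
  by rewrite ste size_active.
rewrite -(sum_active szact ue); last by rewrite sve gap_tops_lt.
rewrite mulr_sumr ste [LHS]big_nat_cond [RHS]big_nat_cond; apply: eq_bigr => g /andP[/andP[_ lt_g] act_g].
have lt_k := nth_gap_tops ve lt_g; rewrite active_tops_Ins // {1}/div_weight.
have szi : size (incr_nth (valences e) (nth 0%N (gap_tops e) g)) = csize e.
  by rewrite size_incr_nth sve lt_k.
set Mk := mask (drop g _) _; have all_Mk : all (fun k => k < csize e)%N Mk.
  apply/allP => k /mem_mask/mem_drop; exact: (allP (gap_tops_lt ve)).
rewrite [size (valences (Ins a e g))]size_cat szi big_split_ord /= mulrC /div_weight sva sve.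
congr (_ * _); apply: eq_bigr => i _; rewrite nth_cat szi ?addKn.
  rewrite ltnNge leq_addr /=; congr div_factor; rewrite mem_cat.
  rewrite [X in _ || X](_ : _ = false) ?orbF; last first.
    by apply/negP => /(allP all_Mk); rewrite ltnNge leq_addr.
  by rewrite mem_map // => k l /addnI.
rewrite ltn_ord mem_cat [X in X || _](_ : _ = false) //.
by apply/mapP => -[l _ defi]; have := ltn_ord i; rewrite defi ltnNge leq_addr.
Qed.

End Divided.

(** * From codes to the two expansions over diagrams *)

Section Solutions.

Variables (K : fieldType) (f phi : fps K).

Lemma diagram_sum n M (Good : pred {set chord n.*2}) (good : code -> bool)
    (W : code -> {poly K}) (H : nat -> {poly K}) :
    (n <= M)%N ->
    (forall c, valid c -> csize c = n -> Good (code_diagram n c) = good c) ->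
    (forall c, c \in codes M -> (W c)`_0 = \prod_(v <- valences c) phi v) ->
  \sum_(C : {set chord n.*2} | connected_diagram C && Good C)
    (weight_f f C * weight_phi phi C) *: H (t 1 C - 1)%N =
  \sum_(c <- codes M | good c && (csize c == n))
    (code_weight_f f c * (W c)`_0) *: H (first_label c - 1)%N.
Proof.
move=> le_nM goodE W0; rewrite (sum_diagrams Good _ le_nM).
rewrite -big_filter -[RHS]big_filter (eq_in_filter (a2 := fun c => good c && (csize c == n))).
  rewrite !big_seq; apply: eq_bigr => c; rewrite mem_filter => /andP[/andP[_ /eqP szc] cM].
  have vc : valid c by move: cM; rewrite mem_codes => /andP[].
  by rewrite code_diagram_weight_f // code_diagram_weight_phi // code_diagram_t1 // W0.
move=> c; rewrite mem_codes => /andP[vc _]; case: eqP => [szc|]; last by rewrite andbF.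
by rewrite goodE // andbT.
Qed.

Variables (L : {poly K} -> {poly K}) (D : {linear {poly K} -> {poly K}}) (N : nat -> K).
Variables (good : code -> bool) (ok : code -> nat -> bool).
Variable W : {poly K} -> code -> {poly K}.
Variable Good : forall n, pred {set chord n.*2}.

Hypothesis good_One : good One.
Hypothesis good_Ins : forall a e g, good (Ins a e g) = [&& good a, good e & ok e g].
Hypothesis W_Ins : forall p a e, valid a -> valid e -> good a -> good e ->
  \sum_(0 <= g < gaps e | ok e g) W p (Ins a e g) = W p a * D (W p e).
Hypothesis W_One : forall p, W p One = p.
Hypothesis W_0 : forall p c, valid c -> (W p c)`_0 = \prod_(v <- valences c) p`_v.
Hypothesis N0 : N 0%N = 1.
Hypothesis D_1 : D 1 = 0.
Hypothesis D_X : D 'X = 1.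
Hypothesis flow_coefM : forall (P a b : {poly {poly K}}) J n, P`_0 = 0 ->
  flow_coef D N P J (a * b) n =
  \sum_(j < J.+1) \sum_(i < n.+1) flow_coef D N P j a i * flow_coef D N P (J - j) b (n - i).
Hypothesis L_linear : forall a p q, L (a *: p + q) = a *: L p + L q.
Hypothesis L_X : forall J,
  (N J)^-1 *: L 'X^J = \sum_(j < J.+1) (f (J - j)%N / N j.+1) *: 'X^(j.+1).
Hypothesis Good_code : forall n c, valid c -> csize c = n -> Good (code_diagram n c) = good c.

Lemma diagram_solution : solution L phi (fun n =>
  \sum_(C : {set chord n.*2} | connected_diagram C && Good C)
    (weight_f f C * weight_phi phi C) *: ((N (t 1 C - 1))^-1 *: L 'X^(t 1 C - 1))).
Proof.
(* No single polynomial can replace [phi]. Any M at least n yields the coefficient [G n], so at each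
   order one bound serves all the coefficients in the equation. *)
set G := fun n => _; pose p M : {poly K} := \poly_(k < M.*2.+1) phi k.
have G_code n M : (n <= M)%N -> G n = code_solution f M (W (p M)) good N L n.
  move=> le_nM; apply: (diagram_sum (fun m => (N m)^-1 *: L 'X^m)) => // c.
    by move=> vc; apply: Good_code.
  rewrite mem_codes => /andP[vc szc]; rewrite W_0 // !big_seq; apply: eq_bigr => v vin.
  by rewrite coef_poly ltnS ltnW // (leq_trans (valences_lt vc vin)) // leq_double.
split; first by rewrite (G_code 0%N 0%N) // code_solution0.
case=> [|n] /=; first by rewrite (G_code 0%N 0%N) // code_solution0.
rewrite (G_code n.+1 n.+1) // /fps_map.
rewrite (code_solutionS (D := D) (ok := ok) (phi := phi) (B := n.+1.*2)) //.
- congr L; apply: eq_fps_comp => i le_in; rewrite (G_code i n.+1) //.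
  exact: leqW.
- by move=> a e; apply: W_Ins.
by rewrite -addnn leq_addr.
Qed.

End Solutions.

Lemma bin_weight_0 (K : fieldType) (p : {poly K}) vs :
  (bin_weight p vs)`_0 = \prod_(v <- vs) p`_v.
Proof.
rewrite /bin_weight; elim: vs => [|v vs IHvs]; first by rewrite !big_nil coef1.
by rewrite !big_cons coef0M IHvs coef_nderivn addn0 binn mulr1n.
Qed.

Lemma div_weight_0 (K : fieldType) (p : {poly K}) act vs :
  (div_weight p act vs)`_0 = \prod_(v <- vs) p`_v.
Proof.
rewrite /div_weight [RHS](big_nth 0%N) big_mkord.
elim/big_rec2: _ => [|i x y _ IH]; first by rewrite coef1.
by rewrite coef0M IH /div_factor; case: ifP => _; rewrite ?coef_drop_poly ?coefC.
Qed.

Theorem theorem5p1 (K : fieldType) (charK0 : [pchar K] =i pred0)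
    (phi f : fps K) (phi0 : phi 0%N = 1) :
  let Gbin : fps {poly K} := fun n =>
    \sum_(C : {set chord n.*2} | connected_diagram C)
      (weight_f f C * weight_phi phi C) *:
        (((t 1 C - 1)`!)%:R^-1 *: Lbin f 'X^(t 1 C - 1)) in
  let Gdiv : fps {poly K} := fun n =>
    \sum_(C : {set chord n.*2} | connected_diagram C && top_cycle_free C)
      (weight_f f C * weight_phi phi C) *: Ldiv f 'X^(t 1 C - 1) in
  [/\ solution (Lbin f) phi Gbin,
      forall G : fps {poly K}, solution (Lbin f) phi G -> G =1 Gbin,
      solution (Ldiv f) phi Gdiv
    & forall G : fps {poly K}, solution (Ldiv f) phi G -> G =1 Gdiv].
Proof.
move=> Gbin Gdiv.
(* [Gbin] and [Gdiv] match the general form only pointwise: the former up to a trivial condition on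
   diagrams, the latter up to a factor 1^-1. *)
have eq_solution L (G H : fps {poly K}) : G =1 H -> solution L phi G -> solution L phi H.
  move=> eqGH [G0 solG]; split=> [|n]; first by rewrite -eqGH.
  rewrite -eqGH solG; case: n => //= n; rewrite /fps_map; congr L.
  by apply: eq_fps_comp => i _.
have solbin : solution (Lbin f) phi Gbin.
  have := @diagram_solution K f phi (Lbin f) (@deriv K) (fun j => j`!%:R)
    xpredT (fun _ _ => true) (fun p c => bin_weight p (valences c)) (fun n => xpredT).
  move=> sol; apply: eq_solution (sol _ _ _ _ _ _ _ _ _ _ _ _) => //.
  - by move=> n; apply: eq_bigl => C; rewrite andbT.
  - by move=> p a e va ve _ _; apply: bin_weight_Ins.
  - by move=> p; rewrite /bin_weight big_seq1 nderivn0.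
  - by move=> p c _; apply: bin_weight_0.
  - exact: derivC.
  - exact: derivX.
  - by move=> P a b J n; apply: flow_coefM_bin.
  - exact: Lbin_linear.
  by move=> J; apply: Lbin_X.
have soldiv : solution (Ldiv f) phi Gdiv.
  have := @diagram_solution K f phi (Ldiv f) (drop_poly 1) (fun=> 1)
    cycle_free (fun e g => nth false (active e) g)
    (fun p c => div_weight p (active_tops c) (valences c)) (fun n => @top_cycle_free n.*2).
  move=> sol; apply: eq_solution (sol _ _ _ _ _ _ _ _ _ _ _ _) => //.
  - by move=> n; apply: eq_bigr => C _; rewrite invr1 scale1r.
  - by move=> p a e; apply: div_weight_Ins.
  - by move=> p; rewrite /div_weight big_ord1; apply: drop_poly0l.
  - by move=> p c _; apply: div_weight_0.
  - by rewrite /= drop_poly_eq0 // size_poly1.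
  - by rewrite -['X]mul1r -['X]expr1 /= drop_polyMXn_id.
  - by move=> P a b J n; apply: flow_coefM_div.
  - exact: Ldiv_linear.
  - by move=> J; apply: Ldiv_X.
  by move=> n c vc szc; apply: code_diagram_cycle_free.
by split=> // G solG; apply: solution_unique solG _.
Qed.
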